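(* Let $\Omega$, $A$, $Q$ and $Q^{w}$ be as in the context, $D=\deg\Omega$, and let $q$ be generic. In the stable range, $Q$ is generated by $D$ generators of degree $1$ subject to $D$ linear relations; that is, in the stable range of degrees the minimal graded free resolution of the left $A$-module $Q$ has the form $$0\to A(-2)^{D}\to A(-1)^{D}\to Q\to 0 .$$ Similarly, for a white vertex $w$ of $\Omega$, in the stable range of degrees the minimal graded free resolution of $Q^{w}$ has the form $$0\to A(-2)^{D}\to A\oplus A(-1)^{D-1}\to Q^{w}\to 0 .$$
   Context: Algebra. The ground field is $\mathbb C$. Let $q_{ij}\in\mathbb C^*$ ($1\le i,j\le 3$), $q_{ii}=1$, $q_{ij}=q_{ji}^{-1}$, and $q=q_{12}q_{23}q_{31}$. $A$ is the algebra generated by $x_1,x_2,x_3$ with relations $x_jx_i=q_{ij}x_ix_j$, and $T=A[x_1^{-1},x_2^{-1},x_3^{-1}]$; both are graded by total degree. Write $x^c=x_1^{c_1}x_2^{c_2}x_3^{c_3}$, $c\in\mathbb Z^3$; monomials matter only up to scalars, and $A x^c=x^cA$ is an $A$-bimodule. For a graded module, $A(i)_d=A_{i+d}$. Domains. Projecting $\mathbb Z^3$ to $\mathbb R^3/\mathbb R(1,1,1)\cong\mathbb R^2$, monomials of $T_0$ are the black and monomials of $T_1$ the white vertices of the hexagonal graph (a black $x^v$ and a white $x^{u}$ are adjacent iff $u=v+e_i$ for some $i$); dually, they are the black and white triangles of the triangular lattice. For $\deg x^c\le 1$, $\Delta(c)$ is the equilateral triangle formed by the white triangles of monomials in $(Ax^c)_1$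 and the black triangles of monomials in $(Ax^c)_0$. $\Omega$ is a simply connected polygonal domain, a union of such small triangles, that can be tiled by rhombi (a rhombus is a union of adjacent black and white triangles). It is assumed that the three slopes of boundary segments appear along $\partial\Omega$ in cyclic order; $\deg\Omega$ is the number of times $\partial\Omega$ cycles through the three slopes. Modules. Write $\Omega=\bigcup_i\Delta(\mathbf a_i)\setminus\bigcup_j\Delta(\mathbf b_j)$, with corresponding inclusion of bimodules $\sum_j A x^{\mathbf b_j}\subset\sum_i Ax^{\mathbf a_i}\subset T$, and let $M=\sum_i Ax^{\mathbf a_i}\big/\sum_j Ax^{\mathbf b_j}$. So $M_0$ (resp. $M_1$) has a basis of black (resp. white) triangles of $\Omega$. Let $K:M\to M$, $K f=f\cdot(x_1+x_2+x_3)$, a degree $1$ map of left $A$-modules, and $Q=\ker K$, a graded left $A$-module. For a white vertex $w$ of $\Omega$ with monomial $x^w$, $M^w=M/Ax^w$ (quotient by the image of $Ax^w$), and $Q^w$ is the kernel of right multiplication by $x_1+x_2+x_3$ on $M^w$. Stable range. Let $\Omega(i)$ be the region with white triangles given by monomials of $M_{i+1}$ (and black by $M_i$). An integer $d\ge 0$ is in the stable range if the regions $\Omega(i)$, $0\le i\le d$, have the same combinatorics as $\Omega=\Omega(0)$ (same cyclic sequence of boundary segments with their slopes and colors). More precisely, $M$ has a resolution $0\to F_3\to F_2\to F_1\to F_0\to M\to0$ by direct sums of modules $Ax^c$, with maps natural inclusions (up to sign), $F_0=\bigoplus Ax^{\mathbf a_i}$, and the stable range extends until the first generator of positive degree appears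 in some $F_i$. For $M^w$ the definition is the same, disregarding the generator $x^w$ of $F_1$ in degree 1; $w$ is assumed to be sufficiently far from $\partial\Omega$. ''In the stable range'' means that the assertion is made in degrees $d$ in the stable range. ''Generic $q$'' means outside a proper Zariski closed subset of parameters. *)

(* Defs.v *)
From HB Require Import structures.
From mathcomp Require Import all_boot all_order all_algebra finmap ring.
From mathcomp Require Import reals complex.
From mathcomp Require Import monalg.
(* Not imported: its notations clash with those of monalg. *)
From mathcomp Require mpoly.

Set Implicit Arguments.
Unset Strict Implicit.
Unset Printing Implicit Defensive.

Import Order.TTheory GRing.Theory Num.Theory.

Local Open Scope ring_scope.

(* The indices 1, 2, 3 are the elements 0, 1, 2 of 'I_3 = Z/3, so that j + 1
   and j + 2 are the two other indices, in cyclic order. *)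

Record qparam (C : fieldType) := QParam {
  qij :> 'I_3 -> 'I_3 -> C;
  qij_neq0 : forall i j, qij i j != 0;
  qii1 : forall i, qij i i = 1;
  qijV : forall i j, qij i j = (qij j i)^-1 }.

(* (q_12, q_23, q_31), which identifies the parameter space with (C^* )^3. *)
Definition qcoord (C : fieldType) (q : qparam C) : 'I_3 -> C :=
  fun i => q i (i + 1).

Definition zariski_closed (C : fieldType) (Z : ('I_3 -> C) -> Prop) :=
  exists S : mpoly.mpoly 3 C -> Prop,
    forall t, Z t <-> forall P, S P -> mpoly.meval t P = 0.

Definition generically (C : fieldType) (S : qparam C -> Prop) :=
  exists Z : ('I_3 -> C) -> Prop,
    [/\ zariski_closed Z,
        exists q : qparam C, ~ Z (qcoord q) &
        forall q : qparam C, ~ Z (qcoord q) -> S q].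

Definition expo := {ffun 'I_3 -> int}.

Definition deg (c : expo) : int := \sum_i c i.

Definition ebase (i : 'I_3) : expo := [ffun j => (i == j)%:R].

(* lee c d : x^d is a left (equivalently, right) multiple of x^c in A. *)
Definition lee (c d : expo) : bool := [forall i, c i <= d i].

Definition qtorus (C : fieldType) (q : qparam C) : Type := {malg C[expo]}.

HB.instance Definition _ (C : fieldType) (q : qparam C) :=
  GRing.Lmodule.copy (qtorus q) {malg C[expo]}.

Section QTorus.
Variables (C : fieldType) (q : qparam C).
Local Notation T := (qtorus q).

(* x^c x^d = cocyc c d x^(c+d) for the ordered monomials
   x^c = x_1^c_1 x_2^c_2 x_3^c_3 : moving x_i^(d_i) to the left across
   x_j^(c_j), i < j, produces q_ij^(c_j d_i). *)
Definition cocyc (c d : expo) : C :=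
  \prod_(ij : 'I_3 * 'I_3 | (ij.1 < ij.2)%N) q ij.1 ij.2 ^ (c ij.2 * d ij.1).

Definition qmul (f g : T) : T :=
  \sum_(c <- msupp f) \sum_(d <- msupp g)
     << cocyc c d * (mcoeff c f * mcoeff d g) *g c + d >>.

Lemma cocycDl c c' d : cocyc (c + c') d = cocyc c d * cocyc c' d.
Proof.
rewrite /cocyc -big_split; apply: eq_bigr => ij _ /=.
by rewrite ffunE mulrDl expfzDr // qij_neq0.
Qed.

Lemma cocycDr c d d' : cocyc c (d + d') = cocyc c d * cocyc c d'.
Proof.
rewrite /cocyc -big_split; apply: eq_bigr => ij _ /=.
by rewrite ffunE mulrDr expfzDr // qij_neq0.
Qed.

Lemma cocyc0l d : cocyc 0 d = 1.
Proof. by rewrite /cocyc big1 // => ij _; rewrite ffunE mul0r expr0z. Qed.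

Lemma cocyc0r c : cocyc c 0 = 1.
Proof. by rewrite /cocyc big1 // => ij _; rewrite ffunE mulr0 expr0z. Qed.

Lemma qmulw (d1 d2 : {fset expo}) (f g : T) :
  (msupp f `<=` d1)%fset -> (msupp g `<=` d2)%fset ->
  qmul f g = \sum_(c <- d1) \sum_(d <- d2)
     << cocyc c d * (mcoeff c f * mcoeff d g) *g c + d >>.
Proof.
move=> le1 le2; rewrite /qmul (big_fset_incl _ le1) /=.
  apply/eq_bigr=> c _; apply/big_fset_incl => // k _ /mcoeff_outdom ->.
  by rewrite !mulr0 monalgU0.
move=> k _ /mcoeff_outdom fk.
by rewrite big1 // => k' _; rewrite fk mul0r mulr0 monalgU0.
Qed.

Lemma qmul_monom c d (s t : C) :
  qmul << s *g c >> << t *g d >> = << cocyc c d * (s * t) *g c + d >>.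
Proof.
by rewrite (qmulw msuppU_le msuppU_le) !big_seq_fset1 !mcoeffUU.
Qed.

Lemma qmulDl : left_distributive qmul +%R.
Proof.
move=> f f' g.
rewrite [in RHS](qmulw (fsubsetUl _ (msupp f')) (fsubset_refl _)).
rewrite [in RHS](qmulw (fsubsetUr (msupp f) _) (fsubset_refl _)).
rewrite (qmulw (msuppD_le _ _) (fsubset_refl _)).
rewrite -big_split /=; apply/eq_bigr=> c _.
rewrite -big_split /=; apply/eq_bigr=> d _.
by rewrite mcoeffD mulrDl mulrDr monalgUD.
Qed.

Lemma qmulDr : right_distributive qmul +%R.
Proof.
move=> f g g'.
rewrite [in RHS](qmulw (fsubset_refl _) (fsubsetUl _ (msupp g'))).
rewrite [in RHS](qmulw (fsubset_refl _) (fsubsetUr (msupp g) _)).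
rewrite (qmulw (fsubset_refl _) (msuppD_le _ _)).
rewrite -big_split /=; apply/eq_bigr=> c _.
rewrite -big_split /=; apply/eq_bigr=> d _.
by rewrite mcoeffD !mulrDr monalgUD.
Qed.

Lemma qmul0l : left_zero 0 qmul.
Proof. by move=> g; rewrite /qmul msupp0 big_seq_fset0. Qed.

Lemma qmul0r : right_zero 0 qmul.
Proof.
by move=> f; rewrite /qmul big1 // => c _; rewrite msupp0 big_seq_fset0.
Qed.

Lemma qtorus_ind (P : T -> Prop) :
  P 0 -> (forall f g, P f -> P g -> P (f + g)) ->
  (forall c s, P << s *g c >>) -> forall f, P f.
Proof.
by move=> P0 PD PU f; rewrite [f]monalgE; apply: big_ind => // c _; apply: PU.
Qed.

Lemma qmulA : associative qmul.
Proof.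
move=> f g h; elim/qtorus_ind: f => [|f f' IH IH'|c s].
- by rewrite !qmul0l.
- by rewrite !qmulDl IH IH'.
elim/qtorus_ind: g => [|g g' IH IH'|d t].
- by rewrite !(qmul0l, qmul0r).
- by rewrite !(qmulDl, qmulDr) IH IH'.
elim/qtorus_ind: h => [|h h' IH IH'|e u].
- by rewrite !qmul0r.
- by rewrite !qmulDr IH IH'.
rewrite !qmul_monom cocycDl cocycDr addrA; congr << _ *g _ >>; ring.
Qed.

Lemma qmul1l : left_id (<< 0 >> : T) qmul.
Proof.
elim/qtorus_ind => [|f g IH IH'|c s]; first exact: qmul0r.
  by rewrite qmulDr IH IH'.
by rewrite qmul_monom cocyc0l !mul1r add0r.
Qed.

Lemma qmul1r : right_id (<< 0 >> : T) qmul.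
Proof.
elim/qtorus_ind => [|f g IH IH'|c s]; first exact: qmul0l.
  by rewrite qmulDl IH IH'.
by rewrite qmul_monom cocyc0r mul1r mulr1 addr0.
Qed.

Lemma qone_neq0 : (<< 0 >> : T) != 0.
Proof. by rewrite monalgU_eq0 oner_eq0. Qed.

HB.instance Definition _ := GRing.Zmodule_isNzRing.Build (qtorus q)
  qmulA qmul1l qmul1r qmulDl qmulDr qone_neq0.

Definition xm (c : expo) : T := << c >>.

Lemma cocyc_base (i j : 'I_3) :
  cocyc (ebase j) (ebase i) = if (i < j)%N then q i j else 1.
Proof.
rewrite /cocyc; case: ifP => ij.
  rewrite (bigD1 (i, j)) //= !ffunE !eqxx mulr1 expr1z big1 ?mulr1 //.
  move=> [k l] /= /andP[_]; rewrite xpair_eqE negb_and !ffunE.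
  rewrite [i == k]eq_sym [j == l]eq_sym => /orP[] /negPf->.
    by rewrite mulr0 expr0z.
  by rewrite mul0r expr0z.
rewrite big1 // => -[k l] /= kl; rewrite !ffunE.
case: eqP => [jl|_]; last by rewrite mul0r expr0z.
case: eqP => [ik|_]; last by rewrite mulr0 expr0z.
by move: kl ij; rewrite -jl -ik => ->.
Qed.

(* The defining relations x_j x_i = q_ij x_i x_j. *)
Lemma xm_rel (i j : 'I_3) :
  xm (ebase j) * xm (ebase i) = q i j *: (xm (ebase i) * xm (ebase j)).
Proof.
have -> : xm (ebase j) * xm (ebase i)
   = << cocyc (ebase j) (ebase i) *g ebase j + ebase i >>.
  by rewrite [LHS]qmul_monom !mulr1.
have -> : xm (ebase i) * xm (ebase j)
   = << cocyc (ebase i) (ebase j) *g ebase j + ebase i >>.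
  by rewrite [LHS]qmul_monom !mulr1 addrC.
apply/malgP => k; rewrite mcoeffZ !mcoeffU mulrnAr; congr (_ *+ _).
rewrite !cocyc_base; case: (ltngtP i j) => [ij|ji|/val_inj ->].
- by rewrite mulr1.
- by rewrite (qijV q j i) mulfV // qij_neq0.
- by rewrite qii1 mulr1.
Qed.

Definition hom (d : int) (f : T) : Prop :=
  forall c, mcoeff c f != 0 -> deg c = d.

(* A is the span of the monomials x^c with c >= 0. *)
Definition inA (f : T) : Prop := forall c, mcoeff c f != 0 -> lee 0 c.

Definition inAx (c : expo) (f : T) : Prop :=
  exists2 h : T, inA h & f = h * xm c.

(* The left A-module generated by the x^c with c in s. *)
Definition span (s : seq expo) (f : T) : Prop :=
  exists2 h : expo -> T, (forall c, inA (h c)) &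
    f = \sum_(c <- s) h c * xm c.

(* Every module below is a subquotient num/den of T, with den contained in num
   graded A-submodules of T: elements are represented in num and vanish when
   they lie in den. *)

Record subquo := Subquo { num : T -> Prop; den : T -> Prop }.

Definition module (a b : seq expo) : subquo := Subquo (span a) (span b).

Definition sigma : T := \sum_i xm (ebase i).

(* The kernel of f |-> f * (x_1 + x_2 + x_3) on a subquotient for which num
   and den are stable under right multiplication by A. *)
Definition kerK (M : subquo) : subquo :=
  Subquo (fun f => num M f /\ den M (f * sigma)) (den M).

(* The degree d part of the direct sum of the A(-e_i). *)
Definition free (e : seq int) (d : int) (f : 'rV[T]_(size e)) : Prop :=
  forall i, inA (f 0 i) /\ hom (d - e`_i) (f 0 i).

(* A minimal complex 0 -> (+) A(-s_k) -> (+) A(-e_i) -> N -> 0 of graded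
   left A-modules, exact in the degrees d such that I d. The two maps are right
   multiplication by the matrix L and by the column G; minimality says that
   the entries of L lie in the irrelevant ideal of A. *)
Definition min_resolution (I : nat -> Prop) (N : subquo) (e s : seq int) :=
  exists (G : 'cV[T]_(size e)) (L : 'M[T]_(size s, size e)),
  [/\ forall i, num N (G i 0) /\ hom e`_i (G i 0),
      forall k i, [/\ inA (L k i), hom (s`_k - e`_i) (L k i) &
                      s`_k = e`_i -> L k i = 0],
      forall k, den N ((L *m G) k 0) &
      forall d, I d ->
      [/\ forall m, num N m -> hom d%:Z m ->
            exists2 f, free d%:Z f & den N (m - (f *m G) 0 0),
          forall f : 'rV_(size e), free d%:Z f -> den N ((f *m G) 0 0) ->
            exists2 h, free d%:Z h & f = h *m L &
          forall h : 'rV_(size s), free d%:Z h -> h *m L = 0 -> h = 0]].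

Definition sumAx (s : seq expo) (f : 'rV[T]_(size s)) : Prop :=
  forall i : 'I_(size s), inAx s`_i (f 0 i).

(* Matrices of maps (+) A x^(s_i) -> (+) A x^(t_j) whose components are, up to
   sign, natural inclusions, or zero. *)
Definition natural (s t : seq expo) (E : 'M[int]_(size s, size t)) : Prop :=
  forall i j, E i j != 0 -> (E i j = 1 \/ E i j = -1) /\ lee t`_j s`_i.

Definition mon_resolution (M : subquo) (F0 F1 F2 F3 : seq expo) : Prop :=
  exists (E1 : 'M[int]_(size F1, size F0)) (E2 : 'M[int]_(size F2, size F1))
         (E3 : 'M[int]_(size F3, size F2)),
  let d1 : 'M[T]__ := map_mx intr E1 in
  let d2 : 'M[T]__ := map_mx intr E2 in
  let d3 : 'M[T]__ := map_mx intr E3 in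
  [/\ [/\ natural E1, natural E2 & natural E3],
      (forall f : 'rV_(size F0), sumAx f -> num M (\sum_i f 0 i)) /\
      (forall m, num M m -> exists2 f : 'rV_(size F0),
         sumAx f & den M (m - \sum_i f 0 i)),
      forall f : 'rV_(size F0), sumAx f ->
        (den M (\sum_i f 0 i) <-> exists2 g, sumAx g & f = g *m d1),
      forall g, sumAx g -> (g *m d1 = 0 <-> exists2 h, sumAx h & g = h *m d2) &
      (forall h, sumAx h -> (h *m d2 = 0 <-> exists2 k, sumAx k & h = k *m d3))
      /\ (forall k, sumAx k -> k *m d3 = 0 -> k = 0)].

(* No generator of positive degree is visible in the region Omega(d), whose
   triangles are the monomials of degrees d and d + 1. *)
Definition no_new (d : nat) (F : seq expo) : Prop :=
  forall c, c \in F -> ~ (0 < deg c <= d.+1%:Z).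

(* The condition is void for d = 0, since Omega(0) = Omega. *)
Definition stable (a b : seq expo) (d : nat) : Prop :=
  (0 < d)%N -> exists F1 F2 F3,
    mon_resolution (module a b) a F1 F2 F3 /\ no_new d (a ++ F1 ++ F2 ++ F3).

(* The stable range of M^w: one copy of the generator x^w of F_1 is ignored. *)
Definition stablew (a b : seq expo) (w : expo) (d : nat) : Prop :=
  (0 < d)%N -> exists F1 F2 F3,
    mon_resolution (module a (w :: b)) a F1 F2 F3 /\
    no_new d (a ++ rem w F1 ++ F2 ++ F3).

End QTorus.

(* Triangles of the triangular lattice are indexed by exponents: black ones by
   exponents of degree 0, white ones by exponents of degree 1. A vertex of the
   lattice is indexed by an exponent of degree 2; the corners of the white
   triangle u are the u + e_i, those of the black triangle v are the
   v + e_i + e_j, i <> j. A set of triangles is a predicate on exponents. *)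

Definition triangle (x : expo) : bool := (deg x == 0) || (deg x == 1).

Definition Delta (c : expo) : pred expo := fun x => triangle x && lee c x.

(* Omega is the union of the Delta(a_i) minus the union of the Delta(b_j), and
   the sum of the A x^(b_j) is contained in the sum of the A x^(a_i). *)
Definition decomposition (Om : pred expo) (a b : seq expo) : Prop :=
  [/\ all (fun c => deg c <= 1) a, all (fun c => deg c <= 1) b,
      all (fun c => has (fun c' => lee c' c) a) b &
      forall x, Om x = has (fun c => Delta c x) a && ~~ has (fun c => Delta c x) b].

(* t v is the direction of the rhombus covering the black triangle v. *)
Definition tileable (Om : pred expo) : Prop :=
  exists t : expo -> 'I_3,
    (forall v, deg v = 0 -> Om v -> Om (v + ebase (t v))) /\
    (forall u, deg u = 1 -> Om u ->
       exists! v, [/\ deg v = 0, Om v & u = v + ebase (t v)]).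

(* The edge (true, j, u) is the common edge of the white triangle u and the
   black triangle u - e_j, oriented counterclockwise around u; (false, j, u) is
   the same edge with the opposite orientation, counterclockwise around
   u - e_j. Here the plane R^3/R(1,1,1) is oriented so that e_1, e_2, e_3 are in
   counterclockwise order. The first component is thus the color of the
   triangle to the left of the edge. Edges have the same slope iff they have the
   same j, and the same direction iff they also have the same color. *)
Definition edge : Type := (bool * 'I_3 * expo)%type.

Definition color (e : edge) : bool := e.1.1.
Definition slope (e : edge) : 'I_3 := e.1.2.

Definition esrc (e : edge) : expo :=
  e.2 + ebase (slope e + (if color e then 1 else 2%:R)).
Definition etgt (e : edge) : expo :=
  e.2 + ebase (slope e + (if color e then 2%:R else 1)).

(* The edges with Omega to the left and its complement to the right. *)
Definition bedge (Om : pred expo) (e : edge) : bool :=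
  (deg e.2 == 1) &&
  (if color e then Om e.2 && ~~ Om (e.2 - ebase (slope e))
              else ~~ Om e.2 && Om (e.2 - ebase (slope e))).

(* The boundary of Omega is the simple closed lattice polygon p, with Omega to
   its left. *)
Definition boundary (Om : pred expo) (p : seq edge) : Prop :=
  [/\ p != [::], uniq (map esrc p),
      cycle (fun e f => etgt e == esrc f) p &
      forall e, (e \in p) = bedge Om e].

Definition straight (e f : edge) : bool :=
  (color e == color f) && (slope e == slope f).

(* Along p the slopes of consecutive segments follow the cyclic order
   3, 2, 1, 3, 2, 1, ..., in which each slope is obtained from the preceding one
   by a rotation by 60 degrees counterclockwise (as for a convex hexagon). *)
Definition cyclic_slopes (p : seq edge) : bool :=
  cycle (fun e f => straight e f || (slope f == slope e - 1)) p.

Definition nsegments (p : seq edge) : nat :=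
  count (fun e => ~~ straight e (next p e)) p.

(* p cycles D times through the three slopes. *)
Definition degree (p : seq edge) (D : nat) : Prop := nsegments p = (3 * D)%N.

(* Main.v *)
Require Import Defs.
From HB Require Import structures.
From mathcomp Require Import all_boot all_order all_algebra finmap perm ring.
From mathcomp Require Import reals complex.
From mathcomp Require Import -(notations) mpoly.
From mathcomp Require Import monalg zify lra boolp.
Require Import Defs.

Set Implicit Arguments.
Unset Strict Implicit.
Unset Printing Implicit Defensive.
Import Order.TTheory GRing.Theory Num.Theory.
Local Open Scope ring_scope.

(* Everything is graded by Z^3. Comparing coefficients of x^c in the monomial
   resolution of M shows that, for c of degree 2, ..., d + 1, the Koszul complex of
   left multiplication by the x_i on M is exact at the multidegree c. Combined with
   the surjectivity of K, a diagram chase then shows that Q is generated in degrees 0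
   and 1, that its relations are generated in degree 2, and that these relations
   are free. It remains to compute Q_0, Q_1 and the relations of degree 2.

   The matrix of K : M_0 -> M_1 is a weighted adjacency matrix of the bipartite graph
   of Omega. Its determinant is nonzero for generic q, because along a suitable
   curve of parameters the terms of its expansion are weighted by the volumes of
   tilings, and a tiling of maximal volume is unique. Hence Q_0 = 0, while Q^w_0
   is spanned by the m such that K m = x^w. The identity dim M_1 - dim M_2 = D is
   the sum over the lattice vertices of a local identity counting the corners of the
   boundary, and dim M_3 follows from the Koszul complex.

   For M^w one also needs that A_1 (x) m -> Q^w_1 is injective. If a linear form
   kills m, then looking at the support of m where its i-th exponent is minimal gives
   one relation between two of the coefficients of the form for each i = 1, 2, 3, and
   the product of the three relations is q^n = 1 with n > 0. *)

(** * Exponents and supports *)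

(** The generic set is fixed before [w] and the degree are chosen, so one polynomial must serve all
    of them. It is the determinant of K on M_0, cleared of denominators, times the product of the
    q^i - 1 for 0 < i <= 3B, where B bounds the exponents of the black triangles of Omega. The
    supports compared in the last step of the overview consist of such triangles, which bounds n by
    3B. The monomial resolution is only read one multidegree at a time. There M has dimension 0 or
    1, and the Koszul complex is determined by eight booleans on a unit cube, so its exactness is a
    finite check. With N_j = dim M_j the ranks arise as follows. For M, N_0 = N_1 and N_1 - N_2 = D;
    the Koszul complex in degree 3 then gives dim Q_2 = N_2 - N_3 = 2D, against 3D for the free
    module on Q_1, which leaves D relations. For M^w, dim Q_1 = D + 2, of which three dimensions are
    A_1 m, and dim Q_2 = 2D + 3 against 6 + 3(D - 1), which leaves D relations again. *)

Lemma ord3_ind (P : 'I_3 -> Prop) : P 0 -> P 1 -> P 2%:R -> forall i, P i.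
Proof.
move=> P0 P1 P2 [[|[|[|//]]] Hi].
- by have -> : Ordinal Hi = 0 by apply: val_inj.
- by have -> : Ordinal Hi = 1 by apply: val_inj.
- by have -> : Ordinal Hi = 2%:R by apply: val_inj.
Qed.

Lemma sum3 (V : nmodType) (F : 'I_3 -> V) : \sum_i F i = F 0 + F 1 + F 2%:R.
Proof.
rewrite !big_ord_recl big_ord0 addr0 addrA.
by congr (_ + _ + _); congr (F _); apply: val_inj.
Qed.

Lemma sum3_rot (V : nmodType) (F : 'I_3 -> V) (i : 'I_3) :
  \sum_j F j = F i + F (i + 1) + F (i + 2%:R).
Proof.
have e11 : 1 + 1 = 2%:R :> 'I_3 by apply: val_inj.
have e12 : 1 + 2%:R = 0 :> 'I_3 by apply: val_inj.
have e21 : 2%:R + 1 = 0 :> 'I_3 by apply: val_inj.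
have e22 : 2%:R + 2%:R = 1 :> 'I_3 by apply: val_inj.
rewrite sum3; elim/ord3_ind: i; rewrite ?add0r ?e11 ?e12 ?e21 ?e22 //.
  by rewrite -addrA addrC.
by rewrite addrC addrA.
Qed.

Section Exponents.
Implicit Types (c d : expo).

Lemma degD c d : deg (c + d) = deg c + deg d.
Proof. by rewrite /deg -big_split; apply: eq_bigr => i _; rewrite ffunE. Qed.

Lemma degN c : deg (- c) = - deg c.
Proof. by rewrite /deg -sumrN; apply: eq_bigr => i _; rewrite ffunE. Qed.

Lemma ebase_inj : injective ebase.
Proof. by move=> i j /ffunP/(_ i); rewrite !ffunE eqxx; case: eqP => [->|]. Qed.

Lemma degB c d : deg (c - d) = deg c - deg d.
Proof. by rewrite degD degN. Qed.

Lemma deg0 : deg 0 = 0.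
Proof. by rewrite /deg big1 // => i _; rewrite ffunE. Qed.

Lemma deg_ebase i : deg (ebase i) = 1.
Proof.
rewrite /deg (bigD1 i) //= big1 => [|j ji]; rewrite ffunE ?eqxx ?addr0 //.
by rewrite eq_sym (negPf ji).
Qed.

Definition degE := (degD, degN, deg0, deg_ebase).

Lemma leeP c d : reflect (forall i, c i <= d i) (lee c d).
Proof. exact: forallP. Qed.

Lemma lee_trans d c e : lee c d -> lee d e -> lee c e.
Proof.
move=> /leeP cd /leeP de; apply/leeP => i.
exact: le_trans (cd i) (de i).
Qed.

Lemma leexx c : lee c c.
Proof. exact/leeP. Qed.

Lemma lee_add c i : lee c (c + ebase i).
Proof. by apply/leeP => j; rewrite !ffunE lerDl. Qed.

Lemma lee_sub c i : lee (c - ebase i) c.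
Proof. by rewrite -{2}(subrK (ebase i) c) lee_add. Qed.

Lemma lee_deg c d : lee c d -> deg c <= deg d.
Proof. by move=> /leeP cd; apply: ler_sum. Qed.

Lemma lee_lt c d : lee c d -> c != d -> exists i, lee c (d - ebase i).
Proof.
move=> /leeP cd; apply: contra_neqP => H; apply/ffunP => i.
apply/eqP; rewrite eq_le cd /=; case: leP => // lt_cd; case: H.
exists i; apply/leeP => j; rewrite !ffunE.
by case: eqP => [<-|_] /=; move: lt_cd (cd j); lia.
Qed.

Definition above (s : seq expo) : pred expo := fun c => has (fun a => lee a c) s.

Lemma above_le s c d : lee c d -> above s c -> above s d.
Proof.
move=> cd /hasP[a sa ac]; apply/hasP; exists a => //; exact: lee_trans cd.
Qed.

Lemma above_add s c i : above s c -> above s (c + ebase i).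
Proof. exact: above_le (lee_add _ _). Qed.

Lemma above_sub s c : above s c -> c \notin s -> exists i, above s (c - ebase i).
Proof.
move=> /hasP[a sa ac] cs; have [|i] := lee_lt ac.
  by apply: contraNneq cs => <-.
by exists i; apply/hasP; exists a.
Qed.

End Exponents.

Section Torus.
Variables (C : numFieldType) (q : qparam C).
Local Notation T := (qtorus q).
Local Notation xe i := (xm q (ebase i)).
Implicit Types (f g h : T) (c d : expo).

Lemma torusP f g : (forall c, mcoeff c f = mcoeff c g) -> f = g.
Proof. by move=> fg; apply/malgP. Qed.

Lemma coefD c f g : mcoeff c (f + g) = mcoeff c f + mcoeff c g.
Proof. exact: mcoeffD. Qed.

Lemma coef0 c : mcoeff c (0 : T) = 0.
Proof. exact: mcoeff0. Qed.

Lemma coefN c f : mcoeff c (- f) = - mcoeff c f.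
Proof. exact: mcoeffN. Qed.

Lemma coefZ c k f : mcoeff c (k *: f) = k * mcoeff c f.
Proof. exact: mcoeffZ. Qed.

Lemma coef_sum c (I : Type) (r : seq I) (P : pred I) (F : I -> T) :
  mcoeff c (\sum_(i <- r | P i) F i) = \sum_(i <- r | P i) mcoeff c (F i).
Proof.
by apply: (big_morph (fun f : T => mcoeff c f)); [exact: coefD|exact: coef0].
Qed.

Lemma coef_xm c d : mcoeff c (xm q d) = (d == c)%:R.
Proof. by rewrite /xm mcoeffU. Qed.

Lemma cocyc_neq0 c d : cocyc q c d != 0.
Proof. by apply/prodf_neq0 => ij _; rewrite expfz_neq0 ?qij_neq0. Qed.

Lemma monomM c d (s t : C) :
  (<< s *g c >> : T) * (<< t *g d >> : T) = << cocyc q c d * (s * t) *g c + d >>.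
Proof. exact: qmul_monom. Qed.

Lemma coef_xmM c d f :
  mcoeff c (xm q d * f) = cocyc q d (c - d) * mcoeff (c - d) f.
Proof.
elim/qtorus_ind: f => [|f g IHf IHg|e s].
- by rewrite mulr0 !coef0 mulr0.
- by rewrite mulrDr !coefD IHf IHg mulrDr.
rewrite /xm monomM mul1r !mcoeffU.
have -> : (e == c - d) = (d + e == c) by rewrite eq_sym subr_eq addrC eq_sym.
by case: eqP => [<-|_]; rewrite ?mulr1n ?mulr0n ?mulr0 // addrAC subrr add0r.
Qed.

Lemma coef_Mxm c d f :
  mcoeff c (f * xm q d) = cocyc q (c - d) d * mcoeff (c - d) f.
Proof.
elim/qtorus_ind: f => [|f g IHf IHg|e s].
- by rewrite mul0r !coef0 mulr0.
- by rewrite mulrDl !coefD IHf IHg mulrDr.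
rewrite /xm monomM mulr1 !mcoeffU.
have -> : (e == c - d) = (e + d == c) by rewrite eq_sym subr_eq eq_sym.
by case: eqP => [<-|_]; rewrite ?mulr1n ?mulr0n ?mulr0 // addrK.
Qed.

Lemma scale_mul (k : C) f g : (k *: f) * g = k *: (f * g).
Proof.
elim/qtorus_ind: g => [|g g' IHg IHg'|c s]; first by rewrite !mulr0 scaler0.
  by rewrite !mulrDr IHg IHg' scalerDr.
elim/qtorus_ind: f => [|f f' IHf IHf'|d t]; first by rewrite scaler0 !mul0r scaler0.
  by rewrite scalerDr !mulrDl IHf IHf' scalerDr.
have -> : k *: (<< t *g d >> : T) = << k * t *g d >>.
  by apply: torusP => e; rewrite coefZ !mcoeffU mulrnAr.
rewrite !monomM; apply: torusP => e; rewrite coefZ !mcoeffU -mulrnAr.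
by rewrite !mulrnAr; congr (_ *+ _); ring.
Qed.

Lemma mul_scale (k : C) f g : f * (k *: g) = k *: (f * g).
Proof.
elim/qtorus_ind: f => [|f f' IHf IHf'|d t]; first by rewrite !mul0r scaler0.
  by rewrite !mulrDl IHf IHf' scalerDr.
elim/qtorus_ind: g => [|g g' IHg IHg'|c s]; first by rewrite scaler0 !mulr0 scaler0.
  by rewrite scalerDr !mulrDr IHg IHg' scalerDr.
have -> : k *: (<< s *g c >> : T) = << k * s *g c >>.
  by apply: torusP => e; rewrite coefZ !mcoeffU mulrnAr.
rewrite !monomM; apply: torusP => e; rewrite coefZ !mcoeffU -mulrnAr.
by rewrite !mulrnAr; congr (_ *+ _); ring.
Qed.

Lemma xmM c d : xm q c * xm q d = cocyc q c d *: xm q (c + d).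
Proof.
rewrite /xm monomM mulr1; apply: torusP => e.
by rewrite coefZ !mcoeffU mulr1 mulr_natr.
Qed.

(** The submodules of T in use are spanned by monomials, so membership becomes a test on each
    exponent of the support. *)
Definition supp_in (P : pred expo) f : Prop := forall c, mcoeff c f != 0 -> P c.

Section SuppIn.
Variable P : pred expo.

Lemma supp_in0 : supp_in P 0.
Proof. by move=> c; rewrite coef0 eqxx. Qed.

Lemma supp_inD f g : supp_in P f -> supp_in P g -> supp_in P (f + g).
Proof.
move=> Pf Pg c; rewrite coefD; have [/eqP f0|/Pf //] := boolP (mcoeff c f == 0).
by rewrite f0 add0r; apply: Pg.
Qed.

Lemma supp_inN f : supp_in P f -> supp_in P (- f).
Proof. by move=> Pf c; rewrite coefN oppr_eq0; apply: Pf. Qed.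

Lemma supp_inB f g : supp_in P f -> supp_in P g -> supp_in P (f - g).
Proof. by move=> Pf Pg; apply/supp_inD/supp_inN. Qed.

Lemma supp_inZ k f : supp_in P f -> supp_in P (k *: f).
Proof.
by move=> Pf c; rewrite coefZ mulf_eq0 negb_or => /andP[_]; apply: Pf.
Qed.

Lemma supp_in_sum (I : Type) (r : seq I) (Q : pred I) (F : I -> T) :
  (forall i, Q i -> supp_in P (F i)) -> supp_in P (\sum_(i <- r | Q i) F i).
Proof.
by move=> PF; elim/big_ind: _ => //; [exact: supp_in0|exact: supp_inD].
Qed.

Lemma supp_in_out f c : supp_in P f -> ~~ P c -> mcoeff c f = 0.
Proof. by move=> Pf; apply: contraNeq; apply: Pf. Qed.

Lemma supp_in_xm c : P c -> supp_in P (xm q c).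
Proof.
by move=> Pc d; rewrite coef_xm; case: (c =P d) => [<-//|_]; rewrite eqxx.
Qed.

End SuppIn.

Lemma supp_inW (P Q : pred expo) f :
  (forall c, P c -> Q c) -> supp_in P f -> supp_in Q f.
Proof. by move=> PQ Pf c /Pf /PQ. Qed.

Lemma torus_split f : f = \sum_(c <- msupp f) mcoeff c f *: xm q c.
Proof.
rewrite {1}[f]monalgE; apply: eq_bigr => c _.
by apply: torusP => e; rewrite coefZ coef_xm mcoeffU mulr_natr.
Qed.

Lemma supp_in_ind (P : pred expo) (R : T -> Prop) :
  R 0 -> (forall f g, R f -> R g -> R (f + g)) ->
  (forall c k, P c -> R (k *: xm q c)) -> forall f, supp_in P f -> R f.
Proof.
move=> R0 RD RZ f Pf; rewrite [f]torus_split big_seq.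
by elim/big_ind: _ => // c; rewrite -mcoeff_neq0 => /Pf; apply: RZ.
Qed.

Lemma supp_inM (P Q S : pred expo) f g :
  (forall c d, P c -> Q d -> S (c + d)) ->
  supp_in P f -> supp_in Q g -> supp_in S (f * g).
Proof.
move=> PQS Pf Qg; move: f Pf; apply: supp_in_ind => [|f f' IH IH'|c k Pc].
- by rewrite mul0r; apply: supp_in0.
- by rewrite mulrDl; apply: supp_inD.
rewrite scale_mul; apply: supp_inZ.
move: g Qg; apply: supp_in_ind => [|g g' IH IH'|d l Qd].
- by rewrite mulr0; apply: supp_in0.
- by rewrite mulrDr; apply: supp_inD.
rewrite mul_scale; apply: supp_inZ => e.
rewrite coef_xmM coef_xm mulf_eq0 negb_or => /andP[_].
case: (d =P _) => [de _|_]; last by rewrite eqxx.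
have -> : e = c + d by rewrite de addrC subrK.
exact: PQS.
Qed.

Lemma homP (j : int) f : hom j f <-> supp_in (fun c => deg c == j) f.
Proof. by split=> H c /H /eqP. Qed.

Lemma inAxP a f : inAx a f <-> supp_in (lee a) f.
Proof.
split=> [[h hA ->]|Hf].
  apply: (supp_inM (Q := pred1 a)) hA _ => [c d|].
    by move=> /leeP c0 /eqP ->; apply/leeP => i; move: (c0 i); rewrite !ffunE lerDr.
  by apply: supp_in_xm => /=.
move: f Hf; apply: supp_in_ind => [|f g [h hA ->] [h' hA' ->]|c k ac].
- by exists 0; rewrite ?mul0r //; apply: supp_in0.
- by exists (h + h'); rewrite ?mulrDl //; apply: supp_inD.
exists ((k / cocyc q (c - a) a) *: xm q (c - a)).
  apply: supp_inZ; apply: supp_in_xm; apply/leeP => i.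
  by move/leeP: ac => /(_ i); rewrite !ffunE subr_ge0.
rewrite scale_mul xmM subrK scalerA divfK //; exact: cocyc_neq0.
Qed.

Lemma spanP s f : span s f <-> supp_in (above s) f.
Proof.
split=> [[h hA ->]|].
  rewrite big_seq; apply: supp_in_sum => a sa.
  have /inAxP : inAx a (h a * xm q a) by exists (h a).
  by apply: supp_inW => c ac; apply/hasP; exists a.
move: f; apply: supp_in_ind => [|f g [h hA ->] [h' hA' ->]|c k].
- exists (fun=> 0); first by move=> _; apply: supp_in0.
  by rewrite big1 // => c _; rewrite mul0r.
- exists (fun c => h c + h' c); first by move=> c; apply: supp_inD (hA c) (hA' c).
  by rewrite -big_split; apply: eq_bigr => c _; rewrite mulrDl.
case/hasP => a sa ac.
have /inAxP[h hA kc] : supp_in (lee a) (k *: xm q c).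
  exact/supp_inZ/supp_in_xm.
(* [a] may be repeated in [s]. *)
have n0 : (count_mem a s)%:R != 0 :> C.
  by rewrite pnatr_eq0 -lt0n -has_count has_pred1.
exists (fun b => if b == a then (count_mem a s)%:R^-1 *: h else 0).
  by move=> b; case: (b == a); [exact: supp_inZ hA|exact: supp_in0].
rewrite (bigID (pred1 a)) /= [X in _ + X]big1 => [|b /negPf->]; last first.
  by rewrite mul0r.
rewrite (eq_bigr (fun _ => (count_mem a s)%:R^-1 *: (k *: xm q c))) => [|b /eqP ->].
  rewrite big_const_seq iter_addr addr0 addr0 -scaler_nat scalerA mulfV //.
  by rewrite scale1r.
by rewrite eqxx scale_mul -kc.
Qed.

End Torus.

(** * Cyclic indices and the unit cube below a multidegree *)

Lemma ord3_11 (i : 'I_3) : i + 1 + 1 = i + 2%:R.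
Proof. by rewrite -addrA. Qed.

Lemma ord3_12 (i : 'I_3) : i + 1 + 2%:R = i.
Proof. by elim/ord3_ind: i; apply: val_inj. Qed.

Lemma ord3_21 (i : 'I_3) : i + 2%:R + 1 = i.
Proof. by elim/ord3_ind: i; apply: val_inj. Qed.

Lemma ord3_22 (i : 'I_3) : i + 2%:R + 2%:R = i + 1.
Proof. by elim/ord3_ind: i; apply: val_inj. Qed.

Lemma ord3_val : (1 + 1 = 2%:R :> 'I_3) * (1 + 2%:R = 0 :> 'I_3) *
  (2%:R + 1 = 0 :> 'I_3) * (2%:R + 2%:R = 1 :> 'I_3) * (0 + 1 = 1 :> 'I_3) *
  (0 + 2%:R = 2%:R :> 'I_3).
Proof. by do !split; apply: val_inj. Qed.

Definition ord3E := (ord3_11, ord3_12, ord3_21, ord3_22).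

(** Indexed by the direction left out, so that the middle Koszul differential has the shape of a
    cross product. *)
Definition sub2 (k : 'I_3) (c : expo) : expo := c - ebase (k + 1) - ebase (k + 2%:R).
Definition sub3 (c : expo) : expo := c - ebase 0 - ebase 1 - ebase 2%:R.

Lemma sub2l (i : 'I_3) c : c - ebase i - ebase (i + 1) = sub2 (i + 2%:R) c.
Proof. by rewrite /sub2 !ord3E. Qed.

Lemma sub2r (i : 'I_3) c : c - ebase i - ebase (i + 2%:R) = sub2 (i + 1) c.
Proof. by rewrite /sub2 !ord3E addrAC. Qed.

Lemma sub3_sub2 (k : 'I_3) c : sub2 k c - ebase k = sub3 c.
Proof.
apply/ffunP => i; elim/ord3_ind: k; rewrite /sub2 /sub3 !ord3_val !ffunE;
  move: (c i) (_ == i)%:R (_ == i)%:R (_ == i)%:R => ????; lia.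
Qed.

Lemma deg_sub2 k c : deg (sub2 k c) = deg c - 2.
Proof. by rewrite /sub2 !degE; lia. Qed.

Lemma deg_sub3 c : deg (sub3 c) = deg c - 3.
Proof. by rewrite /sub3 !degE; lia. Qed.

(* The module M has the basis x^c, mon a b c. *)
Definition mon (a b : seq expo) : pred expo := fun c => above a c && ~~ above b c.

(* The component of multidegree c of the Koszul complex of M lives on the cube of
   the c - sum_(i in S) e_i. The conditions below (vanishing of the Euler
   characteristic, and of two kinds of obvious cycles) suffice for its exactness. *)
Definition acyc (a b : seq expo) (c : expo) : Prop :=
  [/\ (mon a b c + \sum_(k : 'I_3) mon a b (sub2 k c) =
       \sum_(i : 'I_3) mon a b (c - ebase i)%R + mon a b (sub3 c))%N,
      forall i, mon a b (c - ebase i) -> ~~ mon a b c ->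
        mon a b (sub2 (i + 1) c) || mon a b (sub2 (i + 2%:R) c) &
      ~~ mon a b c -> exists i, ~~ mon a b (c - ebase i)].

(** [above a] is closed upwards and the complement of [above b] downwards. *)
Lemma mon_convex a b c d e :
  lee c d -> lee d e -> mon a b c -> mon a b e -> mon a b d.
Proof.
move=> cd de /andP[ac _] /andP[_ be]; rewrite /mon (above_le cd) //.
by apply: contra be; apply: above_le.
Qed.

(* m, M_i, N_k and t are the values of mon a b at c, c - e_i, sub2 k c and sub3 c. *)
Definition cube_ok (m t M0 M1 M2 N0 N1 N2 : bool) : bool :=
  [&& (m + (N0 + N1 + N2) == M0 + M1 + M2 + t)%N,
      [&& M0 && ~~ m ==> N1 || N2, M1 && ~~ m ==> N2 || N0 &
          M2 && ~~ m ==> N0 || N1],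
      ~~ m ==> ~~ [&& M0, M1 & M2],
      [&& m && N0 ==> M1 && M2, m && N1 ==> M2 && M0 & m && N2 ==> M0 && M1],
      [&& t && M0 ==> N1 && N2, t && M1 ==> N2 && N0 & t && M2 ==> N0 && N1] &
      m && t ==> [&& M0, M1, M2, N0, N1 & N2]].

(** The clauses of [cube_ok] that are not part of [acyc] come from convexity. Together they leave
    only patterns of eight booleans whose Koszul complex is exact, as the next three lemmas
    check. *)
Lemma cube_acyc a b c : acyc a b c ->
  cube_ok (mon a b c) (mon a b (sub3 c)) (mon a b (c - ebase 0))
    (mon a b (c - ebase 1)) (mon a b (c - ebase 2%:R))
    (mon a b (sub2 0 c)) (mon a b (sub2 1 c)) (mon a b (sub2 2%:R c)).
Proof.
case; rewrite !sum3 => chi f2 f3.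
pose M i := mon a b (c - ebase i); pose N k := mon a b (sub2 k c).
have s2l (k : 'I_3) : lee (sub2 k c) (c - ebase (k + 1)) by apply: lee_sub.
have s2r (k : 'I_3) : lee (sub2 k c) (c - ebase (k + 2%:R)).
  by rewrite /sub2 addrAC; apply: lee_sub.
have s3 (k : 'I_3) : lee (sub3 c) (sub2 k c) by rewrite -(sub3_sub2 k); apply: lee_sub.
have s1 (i : 'I_3) : lee (c - ebase i) c by apply: lee_sub.
have h4 (k : 'I_3) : mon a b c && N k ==> M (k + 1) && M (k + 2%:R).
  apply/implyP => /andP[mc Nk].
  by rewrite /M !(mon_convex _ _ Nk mc) ?s1 ?s2l ?s2r.
have h5 (i : 'I_3) : mon a b (sub3 c) && M i ==> N (i + 1) && N (i + 2%:R).
  apply/implyP => /andP[mt Mi]; rewrite /N !(mon_convex _ _ mt Mi) ?s3 //.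
    by move: (s2l (i + 2%:R)); rewrite !ord3E.
  by move: (s2r (i + 1)); rewrite !ord3E.
have h6 (i : 'I_3) : mon a b c && mon a b (sub3 c) -> M i && N i.
  move=> /andP[mc mt]; rewrite /M /N !(mon_convex _ _ mt mc) ?s3 ?s1 //.
    by apply: lee_trans (s2l i) (s1 _).
  by apply: lee_trans (s3 (i + 2%:R)) _; move: (s2l (i + 2%:R)); rewrite !ord3E.
rewrite /cube_ok; apply/andP; split; first exact/eqP.
apply/and5P; split.
- have h (i : 'I_3) : M i && ~~ mon a b c ==> N (i + 1) || N (i + 2%:R).
    by apply/implyP => /andP[Mi mc]; apply: f2.
  by move: (h 0) (h 1) (h 2%:R); rewrite !ord3_val => -> -> ->.
- apply/implyP => /f3 [i Mi]; apply: contra Mi => /and3P[? ? ?].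
  by elim/ord3_ind: i.
- by move: (h4 0) (h4 1) (h4 2%:R); rewrite !ord3_val => -> -> ->.
- by move: (h5 0) (h5 1) (h5 2%:R); rewrite !ord3_val => -> -> ->.
- apply/implyP => H; move: (h6 0 H) (h6 1 H) (h6 2%:R H); rewrite /M /N.
  by move=> /andP[-> ->] /andP[-> ->] /andP[-> ->].
Qed.

(** Exactness is modulo the denominator, hence the equations only where [M_i] holds. If [m] holds,
    no vertex of the cube lies in the denominator, so an entry missing from M is truly zero; if [m]
    fails, the cycle condition carries no information. *)
Lemma cube_exact1 (C : numFieldType) (m t M0 M1 M2 N0 N1 N2 : bool) (p0 p1 p2 : C) :
  cube_ok m t M0 M1 M2 N0 N1 N2 ->
  (m -> p0 + p1 + p2 = 0) ->
  (m -> ~~ M0 -> p0 = 0) -> (m -> ~~ M1 -> p1 = 0) -> (m -> ~~ M2 -> p2 = 0) ->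
  exists x y z : C,
    [/\ ~~ N0 -> x = 0, ~~ N1 -> y = 0 & ~~ N2 -> z = 0] /\
    [/\ M0 -> p0 = z - y, M1 -> p1 = x - z & M2 -> p2 = y - x].
Proof.
move=> ok s z0 z1 z2.
have {s} s : m -> p2 = - p0 - p1.
  by move=> /s /eqP; rewrite addrC addr_eq0 opprD => /eqP.
have aux x y z :
    [&& ~~ N0 ==> (x == 0), ~~ N1 ==> (y == 0) & ~~ N2 ==> (z == 0)] ->
    [&& M0 ==> (p0 == z - y), M1 ==> (p1 == x - z) & M2 ==> (p2 == y - x)] ->
  exists x y z : C,
    [/\ ~~ N0 -> x = 0, ~~ N1 -> y = 0 & ~~ N2 -> z = 0] /\
    [/\ M0 -> p0 = z - y, M1 -> p1 = x - z & M2 -> p2 = y - x].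
  case/and3P=> /implyP a1 /implyP a2 /implyP a3.
  case/and3P=> /implyP b1 /implyP b2 /implyP b3.
  by exists x, y, z; do !split; move=> ?; apply/eqP; auto.
move: ok s z0 z1 z2 aux.
case: m; case: t; case: M0; case: M1; case: M2; case: N0; case: N1; case: N2 => //= _ s z0 z1 z2.
all: try (have {}s := s isT); try (have {}z0 := z0 isT isT);
  try (have {}z1 := z1 isT isT); try (have {}z2 := z2 isT isT).
all: repeat match goal with H : @eq (Num.NumField.sort _) ?x 0 |- _ =>
  move: s; rewrite H; clear H x => s end.
all: rewrite ?subr0 ?oppr0 ?sub0r in s.
all: try (have {}s : p1 = - p0 by move/esym/eqP: s; rewrite subr_eq0 => /eqP <-).
all: try (have {}s : p0 = 0 by apply/eqP; rewrite -oppr_eq0 -s).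
all: try (have {}s : p1 = 0 by apply/eqP; rewrite -oppr_eq0 -s).
all: try match type of s with @eq _ ?x _ => subst x end.
(** Once the entries forced to vanish are eliminated, one of the finitely many triples tried below
    is a primitive in each surviving pattern. *)
Ltac cand aux x y z := solve [apply: (aux x y z);
  rewrite /= ?eqxx //=; repeat (apply/andP; split); first [exact: isT | apply/eqP; ring]].
all: move=> aux; first [ cand aux (0:C) (0:C) (0:C)
 | cand aux p1 (0:C) (0:C) | cand aux (-p2) (0:C) (0:C) | cand aux (0:C) p2 (0:C)
 | cand aux (0:C) (-p0) (0:C) | cand aux (0:C) (0:C) p0 | cand aux (0:C) (0:C) (-p1)
 | cand aux (0:C) p2 (-p1) | cand aux (0:C) (-p1-p0) (-p1) | cand aux (0:C) p2 (p2+p0)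
 | cand aux (-p2) (0:C) p0 | cand aux (p1+p0) (0:C) p0 | cand aux (-p2) (0:C) (-p2-p1)
 | cand aux p1 (-p0) (0:C) | cand aux p1 (p2+p1) (0:C) | cand aux (-p0-p2) (-p0) (0:C)].
Qed.

Lemma cube_exact2 (C : numFieldType) (m t M0 M1 M2 N0 N1 N2 : bool) (x y z : C) :
  cube_ok m t M0 M1 M2 N0 N1 N2 ->
  (M0 -> y = z) -> (M1 -> z = x) -> (M2 -> x = y) ->
  (M0 -> ~~ N1 -> y = 0) -> (M0 -> ~~ N2 -> z = 0) ->
  (M1 -> ~~ N2 -> z = 0) -> (M1 -> ~~ N0 -> x = 0) ->
  (M2 -> ~~ N0 -> x = 0) -> (M2 -> ~~ N1 -> y = 0) ->
  exists h : C, (~~ t -> h = 0) /\ [/\ N0 -> x = h, N1 -> y = h & N2 -> z = h].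
Proof.
case: m; case: t; case: M0; case: M1; case: M2; case: N0; case: N1; case: N2 => //= _
  e1 e2 e3 e4 e5 e6 e7 e8 e9.
all: do ?[have {}e1 := e1 isT]; do ?[have {}e2 := e2 isT]; do ?[have {}e3 := e3 isT].
all: try (have {}e4 := e4 isT isT); try (have {}e5 := e5 isT isT); try (have {}e6 := e6 isT isT);
  try (have {}e7 := e7 isT isT); try (have {}e8 := e8 isT isT); try (have {}e9 := e9 isT isT).
all: first [by exists 0; do !split => //; congruence | by exists x; do !split => //; congruence
  | by exists y; do !split => //; congruence | by exists z; do !split => //; congruence ].
Qed.

Lemma cube_exact3 (m t M0 M1 M2 N0 N1 N2 : bool) :
  cube_ok m t M0 M1 M2 N0 N1 N2 -> t -> [|| N0, N1 | N2].
Proof.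
by case: m; case: t; case: M0; case: M1; case: M2; case: N0; case: N1; case: N2.
Qed.

(** * The Koszul complex of M *)

Section Koszul.
Variables (C : numFieldType) (q : qparam C).
Local Notation T := (qtorus q).
Local Notation xe i := (xm q (ebase i)).
Implicit Types (f g : 'I_3 -> T) (h : T) (a b : seq expo) (c d : expo).

(* The Koszul complex T -> T^3 -> T^3 -> T of left multiplication by the x_i. *)
Definition bd1 f : T := \sum_i xe i * f i.

Definition bd2 g (i : 'I_3) : T :=
  xe (i + 1) * g (i + 2%:R) - q i (i + 2%:R) *: (xe (i + 2%:R) * g (i + 1)).

(** Inverse of the scalar by which x_(k+1) x_(k+2) x_k differs from x^(1,1,1). After this rescaling
    the three cyclic products coincide, which makes [bd2] vanish on the image of [bd3]. *)
Definition kap (k : 'I_3) : C :=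
  (cocyc q (ebase (k + 1)) (ebase (k + 2%:R) + ebase k) *
   cocyc q (ebase (k + 2%:R)) (ebase k))^-1.

Definition bd3 h (k : 'I_3) : T := kap k *: (xe k * h).

Lemma cocyc_ebaseC (i j : 'I_3) :
  cocyc q (ebase i) (ebase j) = q j i * cocyc q (ebase j) (ebase i).
Proof.
rewrite !cocyc_base; case: (ltngtP i j) => [ij|ji|/val_inj ->].
- by rewrite (qijV q j i) mulVf // qij_neq0.
- by rewrite mulr1.
- by rewrite qii1 mulr1.
Qed.

Lemma xe_swap (i j : 'I_3) h : xe j * (xe i * h) = q i j *: (xe i * (xe j * h)).
Proof. by rewrite !mulrA xm_rel scale_mul. Qed.

Lemma bd1_bd2 g : bd1 (bd2 g) = 0.
Proof.
rewrite /bd1 /bd2 sum3 !ord3_val !mulrBr !mul_scale.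
rewrite (xe_swap 1 0) (xe_swap 2%:R 1) (xe_swap 0 2%:R).
set u := q 1 0 *: _; set v := q 2%:R 1 *: _; set w := q 0 2%:R *: _.
by rewrite (addrC (u - w)) !subrKA subrr.
Qed.

Lemma bd2_bd3 h i : bd2 (bd3 h) i = 0.
Proof.
rewrite /bd2 /bd3 !mul_scale scalerA (xe_swap (i + 2%:R) (i + 1)) !scalerA -scalerBl.
rewrite [X in X *: _](_ : _ = 0) ?scale0r // /kap !ord3E !cocycDr.
rewrite (cocyc_ebaseC (i + 2%:R) i) (cocyc_ebaseC (i + 1) (i + 2%:R)).
have := cocyc_neq0 q (ebase i) (ebase (i + 1)).
have := cocyc_neq0 q (ebase i) (ebase (i + 2%:R)).
have := cocyc_neq0 q (ebase (i + 2%:R)) (ebase (i + 1)).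
have := qij_neq0 q i (i + 2%:R); have := qij_neq0 q (i + 2%:R) (i + 1).
move=> n1 n2 n3 n4 n5; field; by rewrite n1 n2 n3 n4 n5.
Qed.

Lemma bd1D f g : bd1 (fun i => f i + g i) = bd1 f + bd1 g.
Proof. by rewrite /bd1 -big_split; apply: eq_bigr => i _; rewrite mulrDr. Qed.

Lemma bd1N f : bd1 (fun i => - f i) = - bd1 f.
Proof. by rewrite /bd1 -sumrN; apply: eq_bigr => i _; rewrite mulrN. Qed.

Lemma bd1B f g : bd1 (fun i => f i - g i) = bd1 f - bd1 g.
Proof. by rewrite bd1D bd1N. Qed.

Lemma bd2B f g i : bd2 (fun i => f i - g i) i = bd2 f i - bd2 g i.
Proof.
rewrite /bd2 !mulrBr scalerBr !opprB addrACA [RHS]addrACA; congr (_ + _).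
exact: addrC.
Qed.

Lemma bd1_mul f h : bd1 f * h = bd1 (fun i => f i * h).
Proof. by rewrite /bd1 mulr_suml; apply: eq_bigr => i _; rewrite mulrA. Qed.

Lemma bd2_mul g h i : bd2 g i * h = bd2 (fun i => g i * h) i.
Proof. by rewrite /bd2 mulrBl scale_mul !mulrA. Qed.

Lemma bd3_mul h h' i : bd3 h i * h' = bd3 (h * h') i.
Proof. by rewrite /bd3 scale_mul mulrA. Qed.

Definition grd (s : seq expo) (j : int) : pred expo := fun c => above s c && (deg c == j).

Definition mkT (S : seq expo) (F : expo -> C) : T :=
  \sum_(c <- undup S) F c *: xm q c.

Lemma coef_mkT S F c : mcoeff c (mkT S F) = if c \in S then F c else 0.
Proof.
rewrite /mkT coef_sum; case: ifP => cS; last first.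
  rewrite big_seq big1 // => d; rewrite mem_undup coefZ coef_xm => dS.
  by case: eqP cS => [<-|_]; rewrite ?dS ?mulr0.
rewrite (bigD1_seq c) ?mem_undup ?undup_uniq //= coefZ coef_xm eqxx mulr1.
by rewrite big1 ?addr0 // => d /negPf dc; rewrite coefZ coef_xm dc mulr0.
Qed.

Lemma coef_xe i c h : mcoeff c (xe i * h) = cocyc q (ebase i) (c - ebase i) * mcoeff (c - ebase i) h.
Proof. exact: coef_xmM. Qed.

(* Coefficients normalized so that the twisted Koszul differentials become
   those of the untwisted complex. *)
Definition nrm1 (i : 'I_3) c h : C :=
  cocyc q (ebase i) (c - ebase i) * mcoeff (c - ebase i) h.
Definition nrm2c (k : 'I_3) c : C :=
  cocyc q (ebase (k + 1)) (c - ebase (k + 1)) * cocyc q (ebase (k + 2%:R)) (sub2 k c).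
Definition nrm2 (k : 'I_3) c h : C := nrm2c k c * mcoeff (sub2 k c) h.

Lemma coef_bd1 f c : mcoeff c (bd1 f) = \sum_i nrm1 i c (f i).
Proof. by rewrite /bd1 coef_sum; apply: eq_bigr => i _; rewrite coef_xe. Qed.

Lemma nrm2c_neq0 k c : nrm2c k c != 0.
Proof. by rewrite mulf_neq0 // cocyc_neq0. Qed.

Lemma coef_bd2 g i c :
  nrm1 i c (bd2 g i) = nrm2 (i + 2%:R) c (g (i + 2%:R)) - nrm2 (i + 1) c (g (i + 1)).
Proof.
rewrite /nrm1 /bd2 coefD coefN coefZ !coef_xe sub2l sub2r mulrBr; congr (_ - _).
  by rewrite /nrm2 /nrm2c !ord3E mulrA.
rewrite /nrm2 /nrm2c !ord3E !mulrA; congr (_ * _).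
have E : c - ebase i = sub2 (i + 1) c + ebase (i + 2%:R).
  by rewrite /sub2 !ord3E addrAC subrK.
rewrite E; have -> : c - ebase (i + 2%:R) = sub2 (i + 1) c + ebase i.
  by rewrite /sub2 !ord3E subrK.
rewrite !cocycDr (cocyc_ebaseC (i + 2%:R) i).
by ring.
Qed.

Lemma coef_bd3 : exists2 n : expo -> C, forall c, n c != 0 &
  forall h k c, nrm2 k c (bd3 h k) = n c * mcoeff (sub3 c) h.
Proof.
pose n c := cocyc q (ebase 0) (sub3 c) * cocyc q (ebase 1) (sub3 c) *
            cocyc q (ebase 2%:R) (sub3 c).
exists n.
  by move=> c; rewrite !mulf_neq0 ?cocyc_neq0.
move=> h k c; rewrite /nrm2 /nrm2c /bd3 coefZ coef_xe sub3_sub2.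
have -> : sub2 k c = sub3 c + ebase k by rewrite -(sub3_sub2 k) subrK.
have -> : c - ebase (k + 1) = sub3 c + ebase k + ebase (k + 2%:R).
  by rewrite -(sub3_sub2 k) subrK /sub2 subrK.
have -> : n c
  = cocyc q (ebase k) (sub3 c) * cocyc q (ebase (k + 1)) (sub3 c) * cocyc q (ebase (k + 2%:R)) (sub3 c).
  by rewrite /n; elim/ord3_ind: (k); rewrite !ord3_val //; ring.
move: (sub3 c) => e.
rewrite /kap !cocycDr.
set A := cocyc q (ebase (k + 1)) (ebase k); set B := cocyc q (ebase (k + 1)) (ebase (k + 2%:R)).
set D := cocyc q (ebase (k + 2%:R)) (ebase k).
have nA : A != 0 by apply: cocyc_neq0.
have nB : B != 0 by apply: cocyc_neq0.
have nD : D != 0 by apply: cocyc_neq0.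
by field; rewrite nA nB nD.
Qed.

End Koszul.

Section KoszulExact.
Variables (C : numFieldType) (q : qparam C).
Local Notation T := (qtorus q).
Local Notation xe i := (xm q (ebase i)).
Implicit Types (f g : 'I_3 -> T) (h : T) (a b : seq expo) (c d : expo).

Lemma sub2_le (k i : 'I_3) c : i != k -> lee (sub2 k c) (c - ebase i).
Proof.
move=> ik; have /orP[/eqP->|/eqP->] : (i == k + 1) || (i == k + 2%:R).
- by elim/ord3_ind: i ik; elim/ord3_ind: k.
- exact: lee_sub.
- by rewrite /sub2 addrAC; apply: lee_sub.
Qed.

Lemma nrm1_eq0 (i : 'I_3) c h : (nrm1 i c h == 0) = (mcoeff (c - ebase i) h == 0).
Proof. by rewrite mulf_eq0 (negPf (cocyc_neq0 _ _ _)). Qed.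

Lemma nrm2_eq0 (k : 'I_3) c h : (nrm2 k c h == 0) = (mcoeff (sub2 k c) h == 0).
Proof. by rewrite mulf_eq0 (negPf (nrm2c_neq0 _ _ _)). Qed.

Lemma koszul1_at a b c f : acyc a b c ->
  (forall i, supp_in (above a) (f i)) -> supp_in (above b) (bd1 f) ->
  exists gam : 'I_3 -> C, (forall k, ~~ mon a b (sub2 k c) -> gam k = 0) /\
    forall i, mon a b (c - ebase i) ->
      nrm1 i c (f i) = gam (i + 2%:R) - gam (i + 1).
Proof.
move=> /cube_acyc ok fa fb.
have bz (i : 'I_3) : mon a b c -> ~~ mon a b (c - ebase i) -> nrm1 i c (f i) = 0.
  move=> /andP[_ bc]; rewrite negb_and negbK => /orP[ac|bc']; apply/eqP.
    by rewrite nrm1_eq0 (supp_in_out (fa i)).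
  by move: bc; rewrite (above_le (lee_sub c i)).
have [||||x [y [z [[Nx Ny Nz] [M0 M1 M2]]]]] :=
  cube_exact1 (p0 := nrm1 0 c (f 0)) (p1 := nrm1 1 c (f 1))
    (p2 := nrm1 2%:R c (f 2%:R)) ok; try exact: bz.
  move=> /andP[_ bc]; have := supp_in_out fb bc.
  by rewrite coef_bd1 sum3.
exists (fun k => if k == 0 then x else if k == 1 then y else z).
by split; elim/ord3_ind; rewrite ?ord3_val //=.
Qed.

(** Multidegrees do not interact, so a primitive is chosen on each cube and the choices are
    glued. *)
Lemma koszul1 a b (j : int) f : (forall c, deg c = j -> acyc a b c) ->
  (forall i, supp_in (grd a (j - 1)) (f i)) -> supp_in (above b) (bd1 f) ->
  exists2 g, forall k, supp_in (grd a (j - 2)) (g k) &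
    forall i, supp_in (above b) (f i - bd2 g i).
Proof.
move=> ac fa fb.
have fa' i : supp_in (above a) (f i) by apply: supp_inW (fa i) => c /andP[].
have /choice [gam gamP] c : exists gam : 'I_3 -> C, deg c = j ->
    (forall k, ~~ mon a b (sub2 k c) -> gam k = 0) /\
    forall i, mon a b (c - ebase i) ->
      nrm1 i c (f i) = gam (i + 2%:R) - gam (i + 1).
  have [/eqP/ac cj|/eqP cj] := boolP (deg c == j); last by exists (fun=> 0).
  by have [gam H] := koszul1_at cj fa' fb; exists gam.
(* Elements of T have finite support, so only the cubes met by [f] receive a primitive; elsewhere
   [f] has no coefficient and 0 will do. *)
pose S := [seq c + ebase i | i <- enum 'I_3, c <- msupp (f i)].
have Sf i c : c \notin S -> nrm1 i c (f i) = 0.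
  move=> cS; apply/eqP; rewrite nrm1_eq0; apply: contraNT cS.
  rewrite mcoeff_neq0 => cf; apply/allpairsPdep; exists i, (c - ebase i).
  by rewrite mem_enum subrK.
pose ex (k : 'I_3) d := d + ebase (k + 2%:R) + ebase (k + 1).
have exK (k : 'I_3) : cancel (sub2 k) (ex k) by move=> c; rewrite /ex /sub2 !subrK.
have subK (k : 'I_3) : cancel (ex k) (sub2 k) by move=> c; rewrite /ex /sub2 !addrK.
pose F k d := if deg (ex k d) == j then gam (ex k d) k / nrm2c q k (ex k d) else 0.
pose g k : T := mkT q [seq sub2 k c | c <- S] (F k).
have gE k c : nrm2 k c (g k) = if (c \in S) && (deg c == j) then gam c k else 0.
  rewrite /nrm2 coef_mkT mem_map; last exact: can_inj (exK k).
  case: (c \in S); rewrite ?mulr0 // /F exK; case: (deg c =P j); rewrite ?mulr0 // => _.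
  by rewrite mulrC divfK ?nrm2c_neq0.
exists g => [k d|i d].
  rewrite -[d](subK k) -nrm2_eq0 gE; case: ifP => [/andP[_ /eqP dj]|]; last by rewrite eqxx.
  rewrite /grd deg_sub2 dj eqxx andbT; apply: contraR => H.
  by apply/eqP; apply: (proj1 (gamP _ dj)); rewrite /mon (negPf H).
rewrite -[d](addrK (ebase i)); set c := d + _; rewrite -nrm1_eq0.
have -> : nrm1 i c (f i - bd2 g i) = nrm1 i c (f i) - nrm1 i c (bd2 g i).
  by rewrite /nrm1 coefD coefN mulrBr.
rewrite coef_bd2 !gE; case: (boolP (c \in S)) => /= [cS|cS]; last first.
  by rewrite Sf // !subr0 eqxx.
case: (deg c =P j) => [cj|cj]; last first.
  rewrite !subr0 nrm1_eq0 => /fa /andP[_]; rewrite degB deg_ebase; case: eqP => //.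
  by move: cj; lia.
have [gam0 gamf] := gamP c cj; apply: contraR => nb.
have [/gamf ->|nm] := boolP (mon a b (c - ebase i)); first by rewrite subrr.
(* The remaining case: the monomial is missing from M without lying in the denominator. Then
   everything below it is missing from the numerator too, and all terms vanish. *)
have na : ~~ above a (c - ebase i) by move: nm; rewrite /mon nb andbT.
have nk k : i != k -> gam c k = 0.
  move=> ik; apply: gam0; rewrite /mon negb_and; apply/orP; left.
  by apply: contra na; apply/above_le/sub2_le.
rewrite !nk ?subrr ?subr0; [|by elim/ord3_ind: (i)|by elim/ord3_ind: (i)].
by rewrite nrm1_eq0 (supp_in_out (fa' i)).
Qed.

Lemma koszul2 a b (j : int) g : (forall c, deg c = j -> acyc a b c) ->
  (forall k, supp_in (grd a (j - 2)) (g k)) ->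
  (forall i, supp_in (above b) (bd2 g i)) ->
  exists2 h, supp_in (grd a (j - 3)) h &
    forall k, supp_in (above b) (g k - bd3 h k).
Proof.
move=> ac ga gb.
have ga' k : supp_in (above a) (g k) by apply: supp_inW (ga k) => c /andP[].
have /choice [eta etaP] c : exists eta : C, deg c = j ->
    (~~ mon a b (sub3 c) -> eta = 0) /\
    forall k, mon a b (sub2 k c) -> nrm2 k c (g k) = eta.
  have [/eqP/ac cj|/eqP cj] := boolP (deg c == j); last by exists 0.
  have E i : mon a b (c - ebase i) ->
      nrm2 (i + 2%:R) c (g (i + 2%:R)) = nrm2 (i + 1) c (g (i + 1)).
    move=> /andP[_ nb]; apply/eqP; rewrite -subr_eq0 -coef_bd2 nrm1_eq0.
    by rewrite (supp_in_out (gb i)).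
  have Z i k : i != k -> mon a b (c - ebase i) -> ~~ mon a b (sub2 k c) ->
      nrm2 k c (g k) = 0.
    move=> ik /andP[_ nb]; rewrite negb_and negbK => /orP[na|bb]; apply/eqP.
      by rewrite nrm2_eq0 (supp_in_out (ga' k)).
    by move: nb; rewrite (above_le (sub2_le c ik) bb).
  have E0 := E 0; have E1 := E 1; have E2 := E 2%:R; rewrite !ord3_val in E0 E1 E2.
  have [|||||||||eta [eta0 [H0 H1 H2]]] :=
    cube_exact2 (x := nrm2 0 c (g 0)) (y := nrm2 1 c (g 1)) (z := nrm2 2%:R c (g 2%:R))
      (cube_acyc cj); try (by apply: Z); try by move=> ?; symmetry; auto.
  by exists eta => _; split => //; elim/ord3_ind.
have [n n0 nE] := coef_bd3 q.
pose S := [seq c + ebase (k + 2%:R) + ebase (k + 1) | k <- enum 'I_3, c <- msupp (g k)].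
have Sg k c : c \notin S -> nrm2 k c (g k) = 0.
  move=> cS; apply/eqP; rewrite nrm2_eq0; apply: contraNT cS.
  rewrite mcoeff_neq0 => cg; apply/allpairsPdep; exists k, (sub2 k c).
  by rewrite mem_enum /sub2 !subrK.
pose ex d := d + ebase 2%:R + ebase 1 + ebase 0.
have exK : cancel sub3 ex by move=> c; rewrite /ex /sub3 !subrK.
have subK : cancel ex sub3.
  by move=> c; rewrite /ex /sub3 !addrK.
pose F d := if deg (ex d) == j then eta (ex d) / n (ex d) else 0.
pose h : T := mkT q [seq sub3 c | c <- S] F.
have hE k c : nrm2 k c (bd3 h k) = if (c \in S) && (deg c == j) then eta c else 0.
  rewrite nE coef_mkT mem_map; last exact: can_inj exK.
  case: (c \in S); rewrite ?mulr0 // /F exK; case: (deg c =P j); rewrite ?mulr0 // => _.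
  by rewrite mulrC divfK.
exists h => [d|k d].
  rewrite -[d]subK => H; have := n0 (ex d); move=> n0d.
  have : nrm2 0 (ex d) (bd3 h 0) != 0 by rewrite nE mulf_neq0.
  rewrite hE; case: ifP => [/andP[_ /eqP dj]|]; last by rewrite eqxx.
  rewrite /grd deg_sub3 dj eqxx andbT; apply: contraR => na.
  by apply/eqP; apply: (proj1 (etaP _ dj)); rewrite /mon (negPf na).
pose ex2 d := d + ebase (k + 2%:R) + ebase (k + 1).
have subK2 : sub2 k (ex2 d) = d by rewrite /ex2 /sub2 !addrK.
rewrite -subK2; move: (ex2 d) => c; rewrite -nrm2_eq0.
have -> : nrm2 k c (g k - bd3 h k) = nrm2 k c (g k) - nrm2 k c (bd3 h k).
  by rewrite /nrm2 coefD coefN mulrBr.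
rewrite hE; case: (boolP (c \in S)) => /= [cS|cS]; last first.
  by rewrite Sg // !subr0 eqxx.
case: (deg c =P j) => [cj|cj]; last first.
  rewrite !subr0 nrm2_eq0 => /ga /andP[_]; rewrite deg_sub2; case: eqP => //.
  by move: cj; lia.
have [eta0 etag] := etaP c cj; apply: contraR => nb.
have [/etag ->|nm] := boolP (mon a b (sub2 k c)); first by rewrite subrr.
have na : ~~ above a (sub2 k c) by move: nm; rewrite /mon nb andbT.
have -> : nrm2 k c (g k) = 0.
  by apply/eqP; rewrite nrm2_eq0 (supp_in_out (ga' k)).
rewrite eta0 ?subrr // /mon negb_and; apply/orP; left.
by apply: contra na; apply: above_le; rewrite -(sub3_sub2 k) lee_sub.
Qed.

(** By [cube_exact3] a monomial surviving in M still survives after multiplication by some x_k, and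
    distinct monomials of [h] have distinct products, so nothing cancels. *)
Lemma koszul3 a b (j : int) h : (forall c, deg c = j -> acyc a b c) ->
  supp_in (grd a (j - 3)) h ->
  (forall k, supp_in (above b) (xe k * h)) -> supp_in (above b) h.
Proof.
move=> ac ha hb d dh; apply: contraR (dh) => nb.
pose c := d + ebase 2%:R + ebase 1 + ebase 0.
have cd : sub3 c = d by rewrite /c /sub3 !addrK.
have /andP[ad /eqP dj] := ha _ dh.
have cj : deg c = j by move: dj; rewrite -cd deg_sub3; lia.
have md : mon a b (sub3 c) by rewrite cd /mon ad nb.
have H (k : 'I_3) : ~~ mon a b (sub2 k c).
  rewrite negb_and negbK; apply/orP; right.
  have E : sub2 k c - ebase k = d by rewrite sub3_sub2.
  by apply: (hb k); rewrite coef_xe E mulf_neq0 ?cocyc_neq0.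
by have := cube_exact3 (cube_acyc (ac _ cj)) md; rewrite !(negPf (H _)).
Qed.

Lemma koszul0 a (j : int) h :
  (forall c, deg c = j -> above a c -> exists i, above a (c - ebase i)) ->
  supp_in (grd a j) h ->
  exists2 f, forall i, supp_in (grd a (j - 1)) (f i) & h = bd1 f.
Proof.
move=> gen; move: h; apply: supp_in_ind => [|h h' [f fa ->] [f' fa' ->]|c k].
- exists (fun=> 0) => [i|]; first exact: supp_in0.
  by rewrite /bd1 big1 // => i _; rewrite mulr0.
- exists (fun i => f i + f' i); last by rewrite bd1D.
  by move=> i; apply: supp_inD.
move=> /andP[ac /eqP cj]; have [i ai] := gen c cj ac.
exists (fun l => if l == i then (k / cocyc q (ebase i) (c - ebase i)) *: xm q (c - ebase i) else 0).
  move=> l; case: ifP => _; last exact: supp_in0.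
  by apply/supp_inZ/supp_in_xm; rewrite /grd ai degB deg_ebase cj eqxx.
rewrite /bd1 (bigD1 i) //= eqxx big1 ?addr0 => [|l /negPf ->]; last by rewrite mulr0.
by rewrite mul_scale xmM (addrC (ebase i)) subrK scalerA divfK ?cocyc_neq0.
Qed.

End KoszulExact.

(** * Euler characteristics from the monomial resolution *)

Section Masks.
Variable (F : fieldType).

(** A coordinate projector. Its row space models the part of multidegree c of a sum of modules A
    x^(s_i), in which the i-th summand is visible iff s_i <= c. *)
Definition maskmx n (m : pred 'I_n) : 'M[F]_n := \matrix_(i, j) ((i == j) && m i)%:R.

Lemma mul_maskmx n (m : pred 'I_n) (v : 'rV[F]_n) :
  v *m maskmx m = \row_i (if m i then v 0 i else 0).
Proof.
apply/rowP => i; rewrite !mxE (bigD1 i) //= !mxE eqxx /=.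
rewrite big1 => [|j ji]; last by rewrite mxE (negPf ji) mulr0.
by case: (m i); rewrite ?mulr1 ?mulr0 addr0.
Qed.

Lemma sub_maskmx n (m : pred 'I_n) (v : 'rV[F]_n) :
  reflect (forall i, v 0 i != 0 -> m i) (v <= maskmx m)%MS.
Proof.
apply: (iffP idP) => [/submxP[u ->] i|H].
  by rewrite mul_maskmx mxE; case: (m i); rewrite ?eqxx.
suff -> : v = v *m maskmx m by apply: submxMl.
apply/rowP => i; rewrite mul_maskmx mxE; case: ifP => // mi.
by apply/eqP; apply: contraFT mi; apply: H.
Qed.

Lemma rank_maskmx n (m : pred 'I_n) : \rank (maskmx m) = #|m|.
Proof.
pose B : 'M[F]_(#|m|, n) := \matrix_(k, j) (enum_val k == j)%:R.
have BD : B *m maskmx m = B.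
  apply/matrixP => k j; rewrite !mxE (bigD1 (enum_val k)) //= !mxE eqxx.
  rewrite big1 => [|i ik]; last by rewrite !mxE eq_sym (negPf ik) mul0r.
  have := enum_valP k; rewrite unfold_in => ->.
  by rewrite andbT mul1r addr0.
have DB : maskmx m = B^T *m B.
  apply/matrixP => i j; rewrite !mxE; case: (boolP (m i)) => mi.
    have mi' : i \in m by [].
    rewrite (bigD1 (enum_rank_in mi' i)) //= !mxE enum_rankK_in // eqxx mul1r andbT.
    rewrite big1 ?addr0 // => k; rewrite !mxE => ki.
    case: eqP => [ek|]; last by rewrite mul0r.
    by case/eqP: ki; apply: enum_val_inj; rewrite enum_rankK_in.
  rewrite andbF big1 // => k _; rewrite !mxE; case: eqP => [ek|]; last by rewrite mul0r.
  by have := enum_valP k; rewrite ek unfold_in (negPf mi).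
have BB : B *m B^T = 1%:M.
  apply/matrixP => k l; rewrite !mxE (bigD1 (enum_val k)) //= !mxE eqxx mul1r.
  rewrite big1 ?addr0 => [|i ik]; last by rewrite !mxE eq_sym (negPf ik) mul0r.
  by rewrite (inj_eq enum_val_inj) eq_sym.
have rB : \rank B = #|m|.
  by apply/eqP; change (row_free B); apply/row_freeP; exists B^T.
apply/eqP; rewrite eqn_leq -{1}rB; apply/andP; split.
  by rewrite DB mxrankM_maxr.
by rewrite -rB -{1}BD mxrankM_maxr.
Qed.

Lemma card_nth (T : nmodType) (s : seq T) (P : pred T) :
  #|[pred i : 'I_(size s) | P s`_i]| = count P s.
Proof. by rewrite -sum1_card -sum1_count (big_nth 0) big_mkord. Qed.

End Masks.

Section Euler.
Variables (C : numFieldType) (q : qparam C).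
Local Notation T := (qtorus q).

Definition coefv n (c : expo) (f : 'rV[T]_n) : 'rV[C]_n := \row_i mcoeff c (f 0 i).
Definition monv n (c : expo) (v : 'rV[C]_n) : 'rV[T]_n := \row_i (v 0 i *: xm q c).

Lemma coef_mulz c (f : T) (z : int) : mcoeff c (f * z%:~R) = mcoeff c f * z%:~R.
Proof.
have En n : mcoeff c (f *+ n) = mcoeff c f *+ n.
  by elim: n => [|n IH]; rewrite ?mulr0n ?coef0 // !mulrSr coefD IH.
rewrite !mulrzr; case: z => n; first by rewrite -!pmulrn En.
by rewrite !NegzE !mulrNz coefN -!pmulrn En.
Qed.

(** Integer matrices do not meet the twist of the product: at a fixed multidegree the resolution is
    a complex of vector spaces given by the same matrices. *)
Lemma coefvM m n c (f : 'rV[T]_m) (E : 'M[int]_(m, n)) :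
  coefv c (f *m map_mx intr E) = coefv c f *m map_mx intr E.
Proof.
apply/rowP => j; rewrite !mxE coef_sum; apply: eq_bigr => i _.
by rewrite !mxE coef_mulz.
Qed.

Lemma monvK n c : cancel (@monv n c) (coefv c).
Proof. by move=> v; apply/rowP => i; rewrite !mxE coefZ coef_xm eqxx mulr1. Qed.

Lemma monvM m n c (v : 'rV[C]_m) (E : 'M[int]_(m, n)) :
  monv c v *m map_mx intr E = monv c (v *m map_mx intr E).
Proof.
apply/rowP => j; rewrite !mxE scaler_suml; apply: eq_bigr => i _.
apply: torusP => d; rewrite !mxE coef_mulz !coefZ; ring.
Qed.

Lemma monv0 n c : monv c (0 : 'rV[C]_n) = 0.
Proof. by apply/rowP => i; rewrite !mxE scale0r. Qed.

Lemma sumAx_monv s c (v : 'rV[C]_(size s)) :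
  (v <= maskmx C [pred i : 'I_(size s) | lee s`_i c])%MS -> sumAx (monv c v).
Proof.
move=> /sub_maskmx H i; apply/inAxP => d; rewrite mxE coefZ coef_xm.
case: (c =P d) => [<-|_]; last by rewrite mulr0 eqxx.
by rewrite mulr1; apply: H.
Qed.

Lemma sumAx_coefv s c (f : 'rV[T]_(size s)) : sumAx f ->
  (coefv c f <= maskmx C [pred i : 'I_(size s) | lee s`_i c])%MS.
Proof. by move=> H; apply/sub_maskmx => i; rewrite mxE; move/inAxP: (H i); apply. Qed.

(** The alternating sum over the cube factors as the product over i of [s_i <= c_i] -
    [s_i <= c_i - 1], that is, of [s_i = c_i]. *)
Lemma count_cube (s c : expo) : s != c ->
  (lee s c + \sum_(k : 'I_3) lee s (sub2 k c) =
   \sum_(i : 'I_3) lee s (c - ebase i)%R + lee s (sub3 c))%N.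
Proof.
move=> sc.
have E d : lee s d = [&& s 0 <= d 0, s 1 <= d 1 & s 2%:R <= d 2%:R].
  by apply/leeP/and3P => [H|[? ? ?]]; [split|elim/ord3_ind].
have {sc} : ~~ [&& s 0 == c 0, s 1 == c 1 & s 2%:R == c 2%:R].
  by apply: contra sc => /and3P[/eqP ? /eqP ? /eqP ?]; apply/eqP/ffunP; elim/ord3_ind.
rewrite !sum3 !E /sub2 /sub3 !ord3_val !ffunE /=.
move: (s 0) (s 1) (s 2%:R) (c 0) (c 1) (c 2%:R) => x y z u v w H.
have L (t r : int) : (t <= r - 1) = (t <= r) && (t != r) by lia.
rewrite !subr0 !L; move: H.
by case: (x <= u); case: (y <= v); case: (z <= w); case: (x == u); case: (y == v);
  case: (z == w).
Qed.

Section Resolution.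
Variables (a b F1 F2 F3 : seq expo).
Hypothesis (res : mon_resolution (module q a b) a F1 F2 F3).

Local Notation msk s c := (maskmx C [pred i : 'I_(size s) | lee s`_i c]).

Lemma den_monv c (v : 'rV[C]_(size a)) :
  den (module q a b) (\sum_i (monv c v) 0 i) <-> (\sum_i v 0 i != 0 -> above b c).
Proof.
have -> : \sum_i (monv c v) 0 i = (\sum_i v 0 i) *: xm q c.
  by rewrite scaler_suml; apply: eq_bigr => i _; rewrite mxE.
split=> [/spanP H nz|H].
  by apply: H; rewrite coefZ coef_xm eqxx mulr1.
apply/spanP; have [->|/H bc] := eqVneq (\sum_i v 0 i) 0.
  by rewrite scale0r; apply: supp_in0.
exact/supp_inZ/supp_in_xm.
Qed.

(** At a single multidegree the resolution is an exact sequence of finite dimensional spaces, and M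
    contributes at most one dimension; rank-nullity does the rest. *)
Lemma euler_count c : all (fun d => above a d) b ->
  (mon a b c + count (lee^~ c) F1 + count (lee^~ c) F3 =
   count (lee^~ c) a + count (lee^~ c) F2)%N.
Proof.
move=> ba; have [E1 [E2 [E3 [nat [surj _] ex0 ex1 [ex2 ex3]]]]] := res.
pose e1 := map_mx intr E1 : 'M[C]_(_, _); pose e2 := map_mx intr E2 : 'M[C]_(_, _).
pose e3 := map_mx intr E3 : 'M[C]_(_, _).
pose D0 := msk a c; pose D1 := msk F1 c; pose D2 := msk F2 c; pose D3 := msk F3 c.
have rk s : \rank (msk s c) = count (lee^~ c) s by rewrite rank_maskmx -(card_nth s (lee^~ c)).
(* Exactness descends from T to C: take the coefficients at [c] in one direction, multiply x^c by
   scalars in the other. The same holds for [X1], [X2] and [X3]. *)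
have X0 (v : 'rV[C]_(size a)) : (v <= D0)%MS ->
    (\sum_i v 0 i != 0 -> above b c) <-> (v <= D1 *m e1)%MS.
  move=> vD; have sv := sumAx_monv vD; rewrite -den_monv ex0 //.
  split=> [[g gA E]|/submxP[u ->]].
    have := congr1 (coefv c) E; rewrite monvK coefvM => ->.
    by have /submxP[u ->] := sumAx_coefv c gA; rewrite -mulmxA submxMl.
  exists (monv c (u *m D1)); first by apply: sumAx_monv; apply: submxMl.
  by rewrite monvM mulmxA.
have X1 (v : 'rV[C]_(size F1)) : (v <= D1)%MS ->
    v *m e1 = 0 <-> (v <= D2 *m e2)%MS.
  move=> vD; have sv := sumAx_monv vD.
  have -> : v *m e1 = 0 <-> monv c v *m map_mx intr E1 = 0.
    rewrite monvM; split=> [->|/(congr1 (coefv c))]; first by rewrite monv0.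
    by rewrite monvK -(monv0 _ c) monvK.
  rewrite ex1 //.
  split=> [[g gA E]|/submxP[u ->]].
    have := congr1 (coefv c) E; rewrite monvK coefvM => ->.
    by have /submxP[u ->] := sumAx_coefv c gA; rewrite -mulmxA submxMl.
  exists (monv c (u *m D2)); first by apply: sumAx_monv; apply: submxMl.
  by rewrite monvM mulmxA.
have X2 (v : 'rV[C]_(size F2)) : (v <= D2)%MS ->
    v *m e2 = 0 <-> (v <= D3 *m e3)%MS.
  move=> vD; have sv := sumAx_monv vD.
  have -> : v *m e2 = 0 <-> monv c v *m map_mx intr E2 = 0.
    rewrite monvM; split=> [->|/(congr1 (coefv c))]; first by rewrite monv0.
    by rewrite monvK -(monv0 _ c) monvK.
  rewrite ex2 //.
  split=> [[g gA E]|/submxP[u ->]].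
    have := congr1 (coefv c) E; rewrite monvK coefvM => ->.
    by have /submxP[u ->] := sumAx_coefv c gA; rewrite -mulmxA submxMl.
  exists (monv c (u *m D3)); first by apply: sumAx_monv; apply: submxMl.
  by rewrite monvM mulmxA.
have X3 (v : 'rV[C]_(size F3)) : (v <= D3)%MS -> v *m e3 = 0 -> v = 0.
  move=> vD ve; have := ex3 _ (sumAx_monv vD); rewrite monvM ve monv0 => /(_ erefl).
  by move=> /(congr1 (coefv c)); rewrite monvK -(monv0 _ c) monvK.
have ker m n p r (A : 'M[C]_(m, n)) (B : 'M[C]_(n, p)) (D : 'M[C]_(r, n)) :
    (forall v : 'rV_n, (v <= A)%MS -> v *m B = 0 <-> (v <= D)%MS) ->
    (D <= A)%MS -> (\rank (A *m B) + \rank D = \rank A)%N.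
  move=> H DA; rewrite -(mxrank_mul_ker A B); congr (_ + _)%N.
  suff /eqmxP : (D == A :&: kermx B)%MS by move=> ->.
  apply/andP; split.
    rewrite sub_capmx DA; apply/row_subP => i; apply/sub_kermxP.
    by apply/H; rewrite ?row_sub // (submx_trans (row_sub _ _)).
  apply/row_subP => i.
  have := row_sub i (A :&: kermx B)%MS; rewrite sub_capmx => /andP[iA /sub_kermxP iB].
  exact/H.
have nt s t (E : 'M[int]_(size s, size t)) : natural E ->
    (msk s c *m map_mx intr E <= msk t c)%MS.
  move=> natE; apply/row_subP => i; apply/sub_maskmx => j; rewrite !mxE.
  rewrite (bigD1 i) //= big1 => [|l li]; last first.
    by rewrite !mxE eq_sym (negPf li) mul0r.
  rewrite !mxE eqxx addr0 mulf_eq0 negb_or intr_eq0 /= => /andP[].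
  by rewrite pnatr_eq0 eqb0 negbK => ic /natE [_ ji]; apply: lee_trans ji ic.
have [nat1 nat2 nat3] := nat.
have R2 : (\rank (D2 *m e2) + \rank (D3 *m e3) = \rank D2)%N.
  by apply: ker X2 _; apply: nt.
have R1 : (\rank (D1 *m e1) + \rank (D2 *m e2) = \rank D1)%N.
  by apply: ker X1 _; apply: nt.
have R3 : (\rank (D3 *m e3) = \rank D3)%N.
  have K (v : 'rV_(size F3)) : (v <= D3)%MS -> v *m e3 = 0 <-> (v <= (0 : 'M_(1, size F3)))%MS.
    move=> vD; split=> [/(X3 v vD) ->|]; first exact: sub0mx.
    by move=> /submxP[w ->]; rewrite mulmx0 mul0mx.
  by rewrite -(ker _ _ _ _ _ _ _ K) ?sub0mx // mxrank0 addn0.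
have R0 : (mon a b c + \rank (D1 *m e1) = \rank D0)%N.
  have D10 : (D1 *m e1 <= D0)%MS by apply: nt.
  have [ac|nac] := boolP (above a c); last first.
    have r0 : \rank D0 = 0%N.
      by rewrite rk; apply/eqP; rewrite -leqn0 leqNgt -has_count.
    by rewrite /mon (negPf nac) r0; apply/eqP; rewrite -leqn0 -r0 mxrankS.
  have [bc|nbc] := boolP (above b c).
    rewrite /mon bc andbF; apply/eqP; rewrite eqn_leq !mxrankS //.
    by apply/row_subP => i; apply/X0; rewrite ?row_sub.
  (* Here M is a line at [c], and the map F_0 -> M reads off the sum of the coordinates. *)
  pose s : 'cV[C]_(size a) := const_mx 1.
  have vs (v : 'rV[C]_(size a)) : v *m s = (\sum_i v 0 i)%:M.
    apply/rowP => j; rewrite !ord1 !mxE eqxx mulr1n.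
    by apply: eq_bigr => i _; rewrite !mxE mulr1.
  have K (v : 'rV_(size a)) : (v <= D0)%MS -> v *m s = 0 <-> (v <= D1 *m e1)%MS.
    move=> vD; rewrite -X0 // vs; split=> [/rowP/(_ 0)|H].
      by rewrite !mxE eqxx mulr1n => ->; rewrite eqxx.
    have [->|/H] := eqVneq (\sum_i v 0 i) 0; last by rewrite (negPf nbc).
    by apply/rowP => j; rewrite !mxE mul0rn.
  rewrite -(ker _ _ _ _ _ _ _ K) //; congr (_ + _)%N; rewrite /mon ac nbc; apply/eqP; rewrite eq_sym
    eqn_leq rank_leq_col.
  rewrite lt0n mxrank_eq0; have /hasP[d da dc] := ac.
  have di : (index d a < size a)%N by rewrite index_mem.
  pose v : 'rV[C]_(size a) := delta_mx 0 (Ordinal di).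
  have vD : (v <= D0)%MS.
    apply/sub_maskmx => i; rewrite !mxE eqxx /= pnatr_eq0 eqb0 negbK => /eqP -> /=.
    by rewrite nth_index.
  apply: contraTneq vD => D0s; apply/negP => /submxP[u vE].
  have : v *m s = 0 by rewrite vE -mulmxA D0s mulmx0.
  rewrite vs => /rowP/(_ 0); rewrite !mxE eqxx mulr1n (bigD1 (Ordinal di)) //=.
  rewrite big1 => [|i ik]; last by rewrite !mxE (negPf ik) andbF.
  by rewrite !mxE !eqxx addr0 => /eqP; rewrite oner_eq0.
by rewrite -!rk -/D0 -/D1 -/D2 -/D3 -R0 -R1 -R2 -R3 !addnA.
Qed.

(** Otherwise the vanishing of x_i x^(c - e_i) in M would be a relation that no relation of smaller
    multidegree produces, so F_1 would need a generator at [c]. *)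
Lemma no_opposite c (i : 'I_3) : c \notin F1 ->
  all (fun d => above a d) b ->
  mon a b (c - ebase i) -> ~~ mon a b c ->
  mon a b (sub2 (i + 1) c) || mon a b (sub2 (i + 2%:R) c).
Proof.
move=> cF1 ba mi mc; apply: contraT; rewrite negb_or => /andP[n1 n2].
have [E1 [E2 [E3 [[natE1 _ _] _ ex0 _ _]]]] := res.
have /andP[ai nbi] := mi.
have ac : above a c by apply: above_le ai; apply: lee_sub.
have bc : above b c by move: mc; rewrite /mon ac negbK.
have nal (l : 'I_3) : l != i -> ~~ above a (c - ebase i - ebase l).
  move=> li; have lb : ~~ above b (c - ebase i - ebase l).
    by apply: contra nbi; apply/above_le/lee_sub.
  have /orP[/eqP e|/eqP e] : (l == i + 1) || (l == i + 2%:R).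
  - by elim/ord3_ind: l li {lb}; elim/ord3_ind: i {mi mc n1 n2 ai nbi}.
  - by move: n2 lb; rewrite e sub2l /mon => + nb; rewrite nb andbT.
  - by move: n1 lb; rewrite e sub2r /mon => + nb; rewrite nb andbT.
have /hasP[d da dc] := ai.
have di : (index d a < size a)%N by rewrite index_mem.
pose v : 'rV[C]_(size a) := delta_mx 0 (Ordinal di).
have sv : \sum_i v 0 i = 1.
  rewrite (bigD1 (Ordinal di)) //= big1 => [|k ki]; last by rewrite !mxE (negPf ki) andbF.
  by rewrite !mxE !eqxx addr0.
have vD : (v <= msk a (c - ebase i))%MS.
  apply/sub_maskmx => k; rewrite !mxE eqxx /= pnatr_eq0 eqb0 negbK => /eqP -> /=.
  by rewrite nth_index.
have vDc : (v <= msk a c)%MS.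
  apply/sub_maskmx => k vk; move/sub_maskmx: vD => /(_ k vk) /= H.
  by apply: lee_trans H (lee_sub _ _).
have : den (module q a b) (\sum_i (monv c v) 0 i) by apply/den_monv.
case/ex0 => [|g gA gE]; first exact: sumAx_monv.
have := congr1 (coefv c) gE; rewrite monvK coefvM.
have /sub_maskmx := sumAx_coefv c gA; move: (coefv c g) => u uc vE {g gA gE}.
(* Keep only the relations already available at c - e_i. One that is dropped lies below some c - e_l
   with l <> i; were it to involve a generator a_t <= c - e_i, then a_t would lie below c - e_i -
   e_l, against [nal]. So the truncation still produces [v], one degree too early. *)
pose u1 : 'rV[C]_(size F1) := \row_k (if lee F1`_k (c - ebase i) then u 0 k else 0).
have u1D : (u1 <= msk F1 (c - ebase i))%MS.
  by apply/sub_maskmx => k; rewrite mxE /=; case: ifP; rewrite ?eqxx.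
suff E : v = u1 *m map_mx intr E1.
  have : den (module q a b) (\sum_j (monv (c - ebase i) v) 0 j).
    apply/ex0; first exact: sumAx_monv.
    exists (monv (c - ebase i) u1); first exact: sumAx_monv.
    by rewrite monvM -E.
  by move/den_monv; rewrite sv oner_neq0 (negPf nbi) => /(_ isT).
have natk k t : E1 k t != 0 -> lee a`_t F1`_k by case/natE1.
apply/rowP => t; have [ti|nti] := boolP (lee a`_t (c - ebase i)); last first.
  have -> : v 0 t = 0.
    by apply/eqP; apply: contraNT nti => vt; move/sub_maskmx: vD; apply.
  rewrite mxE big1 // => k _; rewrite !mxE; case: ifP => ki; rewrite ?mul0r //.
  have [->|/natk tk] := eqVneq (E1 k t) 0; first by rewrite mulr0.
  by case/negP: nti; apply: lee_trans tk ki.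
rewrite vE !mxE; apply: eq_bigr => k _; rewrite !mxE; case: ifP => // ki.
have [->|/uc /= uk] := eqVneq (u 0 k) 0; first by rewrite !mul0r.
have [->|/natk tk] := eqVneq (E1 k t) 0; first by rewrite !mulr0.
have [|l kl] := lee_lt uk; first by apply: contraNneq cF1 => <-; apply: mem_nth.
have li : l != i by apply: contraFneq ki => <-.
case/negP: (nal l li); apply/hasP; exists a`_t; first exact: mem_nth.
have /leeP tl := lee_trans tk kl; move/leeP: ti => ti.
apply/leeP => j; move: (tl j) (ti j); rewrite !ffunE.
have : ~~ ((i == j) && (l == j)) by apply: contra li => /andP[/eqP -> /eqP ->].
by move: (i == j) (l == j) (c j) (a`_t j); clear=> [[]] [] //= x y; lia.
Qed.

(** By [euler_count] the characteristic of the cube is a combination of those of the F_i, which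
    vanish by [count_cube] since no generator sits at [c]. If all three x^(c - e_i) survived but x^c
    did not, x^c would be a generator of the denominator. *)
Lemma resolution_acyc c : all (fun d => above a d) b ->
  c \notin a -> c \notin F1 -> c \notin F2 -> c \notin F3 -> c \notin b ->
  acyc a b c.
Proof.
move=> ba ca c1 c2 c3 cb; split=> [|i mi mc|mc].
- have cnt s : c \notin s ->
    (count (lee^~ c) s + \sum_(k : 'I_3) count (lee^~ (sub2 k c)) s =
     \sum_(i : 'I_3) count (lee^~ (c - ebase i)%R) s + count (lee^~ (sub3 c)) s)%N.
    elim: s => [|x s IH] /=; first by rewrite !big1.
    rewrite inE negb_or eq_sym => /andP[xc /IH {}IH]; rewrite !big_split /=.
    by rewrite addnACA IH (count_cube xc) addnACA.
  have e d := euler_count d ba.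
  move: (cnt _ ca) (cnt _ c1) (cnt _ c2) (cnt _ c3) (e c) (e (sub3 c)).
  move: (e (sub2 0 c)) (e (sub2 1 c)) (e (sub2 2%:R c)).
  move: (e (c - ebase 0)) (e (c - ebase 1)) (e (c - ebase 2%:R)).
  rewrite !sum3; clear.
  pose f s x := count (lee^~ x) s; rewrite -!/(f _ _); move: f => f.
  pose g x := nat_of_bool (mon a b x); rewrite -!/(g _); move: g => g.
  move: (c - ebase 0) (c - ebase 1) (c - ebase 2%:R) (sub3 c) (sub2 0 c) (sub2 1 c).
  move: (sub2 2%:R c) => x1 x2 x3 x4 x5 x6 x7.
  lia.
- exact: no_opposite.
apply: contrapT => N.
have H i : mon a b (c - ebase i) by apply: contraT => n; case: N; exists i.
have ac : above a c by case/andP: (H 0) => + _; apply/above_le/lee_sub.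
have bc : above b c by move: mc; rewrite /mon ac negbK.
by have [i bi] := above_sub bc cb; have /andP[_] := H i; rewrite bi.
Qed.

End Resolution.
End Euler.

Lemma subBB (V : zmodType) (x y z : V) : x - y - (z - y) = x - z.
Proof. by rewrite opprB addrA subrK. Qed.

(** * The chase in the stable range *)

Section Graded.
Variables (C : numFieldType) (q : qparam C).
Local Notation T := (qtorus q).
Local Notation xe i := (xm q (ebase i)).
Local Notation sg := (sigma q).
Implicit Types (f g : 'I_3 -> T) (h : T) (a b : seq expo) (c d : expo).

Lemma grd_above s (j : int) h : supp_in (grd s j) h -> supp_in (above s) h.
Proof. by apply: supp_inW => c /andP[]. Qed.

Lemma supp_xe (P Q : pred expo) i h : (forall c, P c -> Q (c + ebase i)) ->
  supp_in P h -> supp_in Q (xe i * h).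
Proof.
move=> PQ; apply: (supp_inM (P := pred1 (ebase i))) => [c d /eqP ->|].
  by rewrite addrC; apply: PQ.
by apply: supp_in_xm => /=.
Qed.

Lemma supp_sigma (P Q : pred expo) h : (forall i c, P c -> Q (c + ebase i)) ->
  supp_in P h -> supp_in Q (h * sg).
Proof.
move=> PQ hP; rewrite /sigma mulr_sumr; apply: supp_in_sum => i _.
apply: (supp_inM (Q := pred1 (ebase i))) hP _ => [c d Pc /eqP ->|]; first exact: PQ.
by apply: supp_in_xm => /=.
Qed.

Lemma grd_add s (j : int) c i : grd s j c -> grd s (j + 1) (c + ebase i).
Proof. by move=> /andP[sc /eqP <-]; rewrite /grd above_add // degD deg_ebase eqxx. Qed.

Lemma grd_xe s (j j' : int) i h : j' = j + 1 -> supp_in (grd s j) h -> supp_in (grd s j') (xe i * h).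
Proof. by move=> ->; apply: supp_xe => c; apply: grd_add. Qed.

Lemma grd_sigma s (j j' : int) h : j' = j + 1 -> supp_in (grd s j) h -> supp_in (grd s j') (h * sg).
Proof. by move=> ->; apply: supp_sigma => i c; apply: grd_add. Qed.

Lemma above_xe s i h : supp_in (above s) h -> supp_in (above s) (xe i * h).
Proof. by apply: supp_xe => c; apply: above_add. Qed.

Lemma above_sigma s h : supp_in (above s) h -> supp_in (above s) (h * sg).
Proof. by apply: supp_sigma => i c; apply: above_add. Qed.

Lemma grd_bd1 s (j j' : int) f : j' = j + 1 ->
  (forall i, supp_in (grd s j) (f i)) -> supp_in (grd s j') (bd1 f).
Proof. by move=> jj H; apply: supp_in_sum => i _; apply: grd_xe jj _. Qed.

Lemma grd_bd2 s (j j' : int) f i : j' = j + 1 ->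
  (forall i, supp_in (grd s j) (f i)) -> supp_in (grd s j') (bd2 f i).
Proof.
by move=> jj H; apply: supp_inB; [|apply: supp_inZ]; apply: grd_xe jj _.
Qed.

Lemma grd_bd3 s (j j' : int) h i : j' = j + 1 ->
  supp_in (grd s j) h -> supp_in (grd s j') (bd3 h i).
Proof. by move=> jj H; apply: supp_inZ; apply: grd_xe jj _. Qed.

Lemma above_bd1 s f : (forall i, supp_in (above s) (f i)) -> supp_in (above s) (bd1 f).
Proof. by move=> H; apply: supp_in_sum => i _; apply: above_xe. Qed.

Lemma above_bd2 s f i : (forall i, supp_in (above s) (f i)) -> supp_in (above s) (bd2 f i).
Proof. by move=> H; apply: supp_inB; [|apply: supp_inZ]; apply: above_xe. Qed.

Lemma above_bd3 s h i : supp_in (above s) h -> supp_in (above s) (bd3 h i).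
Proof. by move=> H; apply: supp_inZ; apply: above_xe. Qed.

Lemma above_mul s h h' : supp_in (above [:: 0]) h -> supp_in (above s) h' ->
  supp_in (above s) (h * h').
Proof.
apply: supp_inM => c d; rewrite /above /= orbF => /leeP c0; apply: above_le.
by apply/leeP => i; move: (c0 i); rewrite !ffunE lerDr.
Qed.

Lemma grd_mul s (j k l : int) h h' : l = j + k ->
  supp_in (grd [:: 0] j) h -> supp_in (grd s k) h' -> supp_in (grd s l) (h * h').
Proof.
move=> ->; apply: supp_inM => c d /andP[]; rewrite /above /= orbF => /leeP c0 /eqP <-.
move=> /andP[sd /eqP <-]; rewrite /grd degD eqxx andbT; apply: above_le sd.
by apply/leeP => i; move: (c0 i); rewrite !ffunE lerDr.
Qed.

Lemma supp_in_trans (P : pred expo) h h' :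
  supp_in P (h - h') -> supp_in P h' -> supp_in P h.
Proof. by move=> H1 H2; rewrite -(subrK h' h); apply: supp_inD. Qed.

Lemma supp_in_sym (P : pred expo) h h' : supp_in P (h - h') -> supp_in P (h' - h).
Proof. by move=> /supp_inN; rewrite opprB. Qed.

(* In these degrees the stable range gives exactness of the Koszul complex of M and
   absence of generators. *)
Definition window a b (n : nat) : Prop :=
  (forall c, 2 <= deg c <= n.+1%:Z -> acyc a b c) /\
  (forall c, 1 <= deg c <= n.+1%:Z -> above a c -> exists i, above a (c - ebase i)).

(* Representatives of the elements of Q of degree j. *)
Definition kerQ a b (j : int) h : Prop :=
  supp_in (grd a j) h /\ supp_in (above b) (h * sg).

Definition surjK a b (j : int) : Prop :=
  forall h, supp_in (grd a (j + 1)) h ->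
    exists2 h', supp_in (grd a j) h' & supp_in (above b) (h - h' * sg).

Section Chase.
Variables (a b : seq expo) (n : nat).
Hypotheses (win : window a b n) (K0 : surjK a b 0).

(** K commutes with left multiplication, and the absence of generators writes each element in the
    next degree as a combination of the x_i times lower ones. *)
Lemma surjK_le (j : nat) : (j <= n)%N -> surjK a b j.
Proof.
elim: j => [//|j IH] jn h hj.
have [|f fj ->] := koszul0 (a := a) (j := j.+1%:Z + 1) (h := h) _ hj.
  by move=> c cj; apply: (proj2 win); lia.
have /choice [k kP] i : exists k, supp_in (grd a j) k /\ supp_in (above b) (f i - k * sg).
  have [||k] := IH _ (f i); [exact: ltnW| |by exists k].
  by move: (fj i); congr (supp_in (grd _ _) _); lia.
exists (bd1 k); first by apply: (grd_bd1 (j := j)); [lia|move=> i; case: (kP i)].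
by rewrite bd1_mul -bd1B; apply: above_bd1 => i; case: (kP i).
Qed.

(** Write h as the sum of the x_i f_i. The f_i sigma form a Koszul cycle of M in degree d + 1, hence
    a boundary of some g; lifting g through K corrects the f_i into elements of Q without changing
    the sum. The degree d + 1 explains the upper bound in [window]. *)
Lemma kerQ_gen (d : nat) h : (2 <= d <= n)%N -> kerQ a b d h ->
  exists2 f, forall i, kerQ a b (d%:Z - 1) (f i) & h = bd1 f.
Proof.
move=> dn [hd hK].
have [|f fd hE] := koszul0 (a := a) (j := d) (h := h) _ hd.
  by move=> c cj; apply: (proj2 win); lia.
have [||| g gd gE] := @koszul1 _ _ a b (d%:Z + 1) (fun i => f i * sg).
- by move=> c cj; apply: (proj1 win); lia.
- by move=> i; apply: grd_sigma (fd i); lia.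
- by rewrite -bd1_mul -hE.
have /choice [k kP] i : exists k, supp_in (grd a (d%:Z - 2)) k /\
    supp_in (above b) (g i - k * sg).
  have [||k] := @surjK_le (d - 2)%N _ (g i); first lia.
    by move: (gd i); congr (supp_in (grd _ _) _); lia.
  by exists k; split=> //; move: p; congr (supp_in (grd _ _) _); lia.
exists (fun i => f i - bd2 k i); last by rewrite bd1B bd1_bd2 subr0.
move=> i; split.
  apply: supp_inB => //; apply: (grd_bd2 (j := d%:Z - 2)); first lia.
  by move=> l; case: (kP l).
rewrite mulrBl bd2_mul; apply: (supp_in_trans (h' := bd2 (fun l => g l - k l * sg) i)).
  by rewrite (bd2B g (fun l => k l * sg)) subBB.
by apply: above_bd2 => l; case: (kP l).
Qed.

(** The same correction one place further: f is a boundary of some g in M, the g_k sigma form a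
    cycle and so come from some h, and h is lifted through K. *)
Lemma kerQ_exact1 (d : nat) f : (3 <= d <= n)%N ->
  (forall i, kerQ a b (d%:Z - 1) (f i)) -> supp_in (above b) (bd1 f) ->
  exists2 g, forall k, kerQ a b (d%:Z - 2) (g k) &
    forall i, supp_in (above b) (f i - bd2 g i).
Proof.
move=> dn fQ fb.
have [||| g gd gE] := @koszul1 _ _ a b d f; [by move=> c cj; apply: (proj1 win); lia| |by []|].
  by move=> i; case: (fQ i).
have [||| h hd hE] := @koszul2 _ _ a b (d%:Z + 1) (fun k => g k * sg).
- by move=> c cj; apply: (proj1 win); lia.
- by move=> k; apply: grd_sigma (gd k); lia.
- move=> i; rewrite -bd2_mul.
  apply: (supp_in_trans (h' := f i * sg)); last by case: (fQ i).
  by rewrite -mulrBl; apply/above_sigma/supp_in_sym.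
have [||k kd kE] := @surjK_le (d - 3)%N _ h; first lia.
  by move: hd; congr (supp_in (grd _ _) _); lia.
have {}kd : supp_in (grd a (d%:Z - 3)) k by move: kd; congr (supp_in (grd _ _) _); lia.
exists (fun i => g i - bd3 k i) => i; last by rewrite bd2B bd2_bd3 subr0.
split; first by apply: supp_inB => //; apply: grd_bd3 kd; lia.
rewrite mulrBl bd3_mul; apply: (supp_in_trans (h' := bd3 h i - bd3 (k * sg) i)).
  by rewrite subBB.
by rewrite -scalerBr -mulrBr; apply: above_bd3.
Qed.

Lemma kerQ_exact2 (d : nat) g : (3 <= d <= n)%N ->
  (forall k, kerQ a b (d%:Z - 2) (g k)) -> (forall i, supp_in (above b) (bd2 g i)) ->
  exists2 h, kerQ a b (d%:Z - 3) h & forall k, supp_in (above b) (g k - bd3 h k).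
Proof.
move=> dn gQ gb.
have [||| h hd hE] := @koszul2 _ _ a b d g; [by move=> c cj; apply: (proj1 win); lia| |by []|].
  by move=> i; case: (gQ i).
exists h => //; split => //.
apply: (@koszul3 _ _ a b (d%:Z + 1)).
- by move=> c cj; apply: (proj1 win); lia.
- by apply: grd_sigma hd; lia.
move=> k.
suff : supp_in (above b) (kap q k *: (xe k * (h * sg))).
  move=> /(supp_inZ (k := (kap q k)^-1)); rewrite scalerA mulVf ?scale1r //.
  by rewrite invr_neq0 // mulf_neq0 // cocyc_neq0.
rewrite -/(bd3 _ k) -bd3_mul.
apply: (supp_in_trans (h' := g k * sg)); last by case: (gQ k).
by rewrite -mulrBl; apply/above_sigma/supp_in_sym.
Qed.

End Chase.
End Graded.

Lemma mxBE (V : zmodType) m n (A B : 'M[V]_(m, n)) i j : (A - B) i j = A i j - B i j.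
Proof. by rewrite !mxE. Qed.

Lemma mx0E (V : zmodType) m n i j : (0 : 'M[V]_(m, n)) i j = 0.
Proof. by rewrite mxE. Qed.

Section Eqs.
Variables (C : numFieldType) (q : qparam C).
Local Notation T := (qtorus q).
Lemma bd1E (f : 'I_3 -> T) : bd1 f = \sum_i xm q (ebase i) * f i. Proof. by []. Qed.
Lemma bd2E (g : 'I_3 -> T) i : bd2 g i = xm q (ebase (i + 1)) * g (i + 2%:R) -
  q i (i + 2%:R) *: (xm q (ebase (i + 2%:R)) * g (i + 1)).
Proof. by []. Qed.
Lemma bd3E (h : T) k : bd3 h k = kap q k *: (xm q (ebase k) * h). Proof. by []. Qed.
Lemma eq_bd1 (f g : 'I_3 -> T) : (forall i, f i = g i) -> bd1 f = bd1 g.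
Proof. by move=> /funext ->. Qed.
Lemma eq_bd2 (f g : 'I_3 -> T) l : (forall i, f i = g i) -> bd2 f l = bd2 g l.
Proof. by move=> /funext ->. Qed.
Lemma bd3B (h h' : T) k : bd3 (h - h') k = bd3 h k - bd3 h' k.
Proof. by rewrite !bd3E mulrBr scalerBr. Qed.
End Eqs.

(** * The Koszul complex of graded free modules *)

Section Rows.
Variables (C : numFieldType) (q : qparam C).
Local Notation T := (qtorus q).
Implicit Types (m n : nat).
Local Opaque bd1 bd2 bd3 xm qmul.

Definition rbd1 n (F : 'I_3 -> 'rV[T]_n) : 'rV[T]_n := \row_i bd1 (fun l => F l 0 i).
Definition rbd2 n (F : 'I_3 -> 'rV[T]_n) (l : 'I_3) : 'rV[T]_n :=
  \row_i bd2 (fun l => F l 0 i) l.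
Definition rbd3 n (h : 'rV[T]_n) (l : 'I_3) : 'rV[T]_n := \row_i bd3 (h 0 i) l.

Lemma rbd1E n (F : 'I_3 -> 'rV[T]_n) i : rbd1 F 0 i = bd1 (fun l => F l 0 i).
Proof. by rewrite mxE. Qed.

Lemma rbd2E n (F : 'I_3 -> 'rV[T]_n) l i : rbd2 F l 0 i = bd2 (fun l => F l 0 i) l.
Proof. by rewrite mxE. Qed.

Lemma rbd3E n (h : 'rV[T]_n) l i : rbd3 h l 0 i = bd3 (h 0 i) l.
Proof. by rewrite mxE. Qed.

Local Opaque rbd1 rbd2 rbd3.

Lemma rbd1M m n (F : 'I_3 -> 'rV[T]_m) (A : 'M[T]_(m, n)) :
  rbd1 F *m A = rbd1 (fun l => F l *m A).
Proof.
apply/rowP => j; rewrite mxE [RHS]rbd1E.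
rewrite (eq_bigr (fun i => \sum_l xm q (ebase l) * (F l 0 i * A i j))); last first.
  by move=> i _; rewrite rbd1E bd1_mul bd1E.
rewrite exchange_big bd1E; apply: eq_bigr => l _ /=.
by rewrite mxE mulr_sumr.
Qed.

Lemma rbd2M m n (F : 'I_3 -> 'rV[T]_m) (A : 'M[T]_(m, n)) l :
  rbd2 F l *m A = rbd2 (fun l => F l *m A) l.
Proof.
apply/rowP => j; rewrite mxE [RHS]rbd2E bd2E; cbv beta.
rewrite [X in _ * X - _]mxE [in X in _ - X]mxE !mulr_sumr scaler_sumr -sumrB.
by apply: eq_bigr => i _; rewrite rbd2E bd2_mul bd2E.
Qed.

Lemma rbd3M m n (h : 'rV[T]_m) (A : 'M[T]_(m, n)) l :
  rbd3 h l *m A = rbd3 (h *m A) l.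
Proof.
apply/rowP => j; rewrite mxE [RHS]rbd3E bd3E [X in _ * X]mxE mulr_sumr scaler_sumr.
by apply: eq_bigr => i _; rewrite rbd3E bd3_mul bd3E.
Qed.

Lemma rbd1B n (F G : 'I_3 -> 'rV[T]_n) :
  rbd1 (fun l => F l - G l) = rbd1 F - rbd1 G.
Proof.
apply/rowP => i; rewrite [RHS]mxBE [LHS]rbd1E [X in X - _]rbd1E [X in _ - X]rbd1E.
apply: etrans (bd1B (fun k => F k 0 i) (fun k => G k 0 i)).
by apply: eq_bd1 => l; rewrite mxBE.
Qed.

Lemma rbd1_rbd2 n (F : 'I_3 -> 'rV[T]_n) : rbd1 (rbd2 F) = 0.
Proof.
apply/rowP => i; apply: (@etrans _ _ (0 : T)); last by rewrite mxE.
rewrite rbd1E; apply: etrans (bd1_bd2 (fun l => F l 0 i)); apply: eq_bd1 => l.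
by rewrite rbd2E.
Qed.

Lemma rbd2_rbd3 n (h : 'rV[T]_n) l : rbd2 (rbd3 h) l = 0.
Proof.
apply/rowP => i; apply: (@etrans _ _ (0 : T)); last by rewrite mxE.
rewrite rbd2E; apply: etrans (bd2_bd3 (h 0 i) l); apply: eq_bd2 => k.
by rewrite rbd3E.
Qed.

Lemma rbd2B n (F G : 'I_3 -> 'rV[T]_n) l :
  rbd2 (fun l => F l - G l) l = rbd2 F l - rbd2 G l.
Proof.
apply/rowP => i; rewrite [RHS]mxBE [LHS]rbd2E [X in X - _]rbd2E [X in _ - X]rbd2E.
apply: etrans (bd2B (fun k => F k 0 i) (fun k => G k 0 i) l).
by apply: eq_bd2 => k; rewrite mxBE.
Qed.

Definition fr (e : seq int) (d : int) (f : 'rV[T]_(size e)) : Prop :=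
  forall i : 'I_(size e), supp_in (grd [:: 0] (d - e`_i)) (f 0 i).

Lemma frB e d (f g : 'rV_(size e)) : fr d f -> fr d g -> fr d (f - g).
Proof. by move=> Hf Hg i; rewrite mxBE; apply: supp_inB. Qed.

Lemma fr_cast e d d' (f : 'rV_(size e)) : d = d' -> fr d f -> fr d' f.
Proof. by move=> ->. Qed.

Lemma fr_rbd1 e d d' (F : 'I_3 -> 'rV_(size e)) : d' = d + 1 ->
  (forall l, fr d (F l)) -> fr d' (rbd1 F).
Proof.
by move=> dd H i; rewrite rbd1E; apply: (grd_bd1 (j := d - e`_i)); [lia|move=> l; apply: H].
Qed.

Lemma fr_rbd2 e d d' (F : 'I_3 -> 'rV_(size e)) l : d' = d + 1 ->
  (forall l, fr d (F l)) -> fr d' (rbd2 F l).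
Proof.
by move=> dd H i; rewrite rbd2E; apply: (grd_bd2 (j := d - e`_i)); [lia|move=> k; apply: H].
Qed.

Lemma fr_rbd3 e d d' (h : 'rV_(size e)) l : d' = d + 1 -> fr d h -> fr d' (rbd3 h l).
Proof. by move=> dd H i; rewrite rbd3E; apply: (grd_bd3 (j := d - e`_i)) (H i); lia. Qed.

Lemma grd0_neg (j : int) (h : T) : j < 0 -> supp_in (grd [:: 0] j) h -> h = 0.
Proof.
move=> j0 hj; apply: torusP => c; rewrite coef0; apply/eqP; apply: contraT => /hj.
by rewrite /grd /above /= orbF => /andP[/lee_deg]; rewrite deg0 => c0 /eqP cj; lia.
Qed.

(** A is itself a module of the form of M, with numerator generated by 1 and zero denominator, so
    the cube lemmas also serve the free modules; only the generator has to be avoided. *)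
Lemma acyc_free c : 1 <= deg c -> acyc [:: 0] [::] c.
Proof.
have M d : mon [:: 0] [::] d = lee 0 d by rewrite /mon /above /= orbF andbT.
move=> c1; split=> [|i|]; rewrite ?M.
- rewrite (eq_bigr (fun k : 'I_3 => nat_of_bool (lee 0 (sub2 k c)))) => [|k _]; last by rewrite M.
  rewrite [RHS](_ : _ = (\sum_(i : 'I_3) lee 0%R (c - ebase i)%R + lee 0%R (sub3 c))%N).
    by apply: count_cube; apply: contraTneq c1 => <-; rewrite deg0.
  by congr (_ + _)%N; apply: eq_bigr => i _; rewrite M.
- by move=> ci /negP[]; apply: lee_trans ci (lee_sub _ _).
by move=> nc; exists 0; rewrite M; apply: contra nc => ci; apply: lee_trans ci (lee_sub _ _).
Qed.

Lemma gen_free c : 1 <= deg c -> above [:: 0] c -> exists i, above [:: 0] (c - ebase i).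
Proof. by move=> c1 /above_sub; apply; rewrite inE; apply: contraTneq c1 => ->; rewrite deg0. Qed.

Lemma row_gen (e : seq int) (d : int) (f : 'rV[T]_(size e)) : (forall i : 'I_(size e), e`_i < d) ->
  fr d f ->
  exists2 F, forall l, fr (d - 1) (F l) & f = rbd1 F.
Proof.
move=> ed fd.
have /choice [F FP] (i : 'I_(size e)) : exists F : 'I_3 -> T,
    (forall l, supp_in (grd [:: 0] (d - e`_i - 1)) (F l)) /\ f 0 i = bd1 F.
  have [|F FP E] := koszul0 _ (fd i); last by exists F.
  by move=> c cj; apply: gen_free; have := ed i; lia.
exists (fun l => \row_i F i l) => [l i|].
  by rewrite mxE; move: (proj1 (FP i) l); congr (supp_in (grd _ _) _); lia.
apply/rowP => i; rewrite rbd1E (proj2 (FP i)); apply: eq_bd1 => l.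
by rewrite mxE.
Qed.

Lemma row_exact1 (e : seq int) (d : int) (F : 'I_3 -> 'rV[T]_(size e)) : (forall i : 'I_(size e),
  e`_i < d) ->
  (forall l, fr (d - 1) (F l)) -> rbd1 F = 0 ->
  exists2 S, forall l, fr (d - 2) (S l) & forall l, F l = rbd2 S l.
Proof.
move=> ed fd F0.
have /choice [S SP] (i : 'I_(size e)) : exists S : 'I_3 -> T,
    (forall l, supp_in (grd [:: 0] (d - e`_i - 2)) (S l)) /\
    (forall l, F l 0 i = bd2 S l).
  have [||| S Sd SE] := @koszul1 _ q [:: 0] [::] (d - e`_i) (fun l => F l 0 i).
  - by move=> c cj; apply: acyc_free; have := ed i; lia.
  - by move=> l; move: (fd l i); congr (supp_in (grd _ _) _); lia.
  - move/rowP: F0 => /(_ i); rewrite rbd1E [RHS]mxE => ->; exact: supp_in0.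
  exists S; split=> // l; apply/eqP; rewrite -subr_eq0; apply/eqP.
  by apply: torusP => c; rewrite coef0; apply/eqP; apply: contraT => /SE.
exists (fun l => \row_i S i l) => l.
  by move=> i; rewrite mxE; move: (proj1 (SP i) l); congr (supp_in (grd _ _) _); lia.
apply/rowP => i; rewrite rbd2E (proj2 (SP i)); apply: eq_bd2 => k.
by rewrite mxE.
Qed.

End Rows.

(** * Generators and relations, from low degrees to the whole window *)

Section Resolve.
Local Opaque bd1 bd2 bd3 rbd1 rbd2 rbd3 xm qmul.
Variables (C : numFieldType) (q : qparam C) (a b : seq expo) (n : nat) (e s : seq int).
Local Notation T := (qtorus q).
Local Notation sg := (sigma q).
Variables (G : 'cV[T]_(size e)) (L : 'M[T]_(size s, size e)).
Hypotheses (win : window a b n) (K0 : surjK q a b 0).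
Hypothesis e01 : forall i : 'I_(size e), 0 <= e`_i <= 1.
Hypothesis s2 : forall k : 'I_(size s), s`_k = 2.
Local Notation ev f := ((f *m G) 0 0).
Hypothesis GQ : forall i : 'I_(size e), kerQ a b e`_i (G i 0).
Hypothesis G_onto : forall j : nat, (j <= 1)%N -> (j <= n)%N -> forall h, kerQ a b j h ->
  exists2 f, fr j f & supp_in (above b) (h - ev f).
Hypothesis G_inj : forall (j : nat) f, (j <= 1)%N -> (j <= n)%N ->
  fr j f -> supp_in (above b) (ev f) -> f = 0.
Hypothesis LG : forall k, supp_in (above b) ((L *m G) k 0).
Hypothesis L_onto : (2 <= n)%N -> forall f, fr 2 f -> supp_in (above b) (ev f) ->
  exists2 h, fr 2 h & f = h *m L.
Hypothesis L_inj : (2 <= n)%N -> forall h, fr 2 h -> h *m L = 0 -> h = 0.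
Hypothesis L_deg : forall (k : 'I_(size s)) (i : 'I_(size e)), supp_in (grd [:: 0] (s`_k - e`_i)) (L
  k i).

Lemma ev_kerQ (j : int) f : fr j f -> kerQ a b j (ev f).
Proof.
move=> fj; rewrite mxE; split.
  apply: supp_in_sum => i _; apply: grd_mul (fj i) (proj1 (GQ i)); lia.
rewrite mulr_suml; apply: supp_in_sum => i _; rewrite -mulrA.
by apply: above_mul (grd_above (fj i)) (proj2 (GQ i)).
Qed.

Lemma mulL_fr (d : int) h : fr d h -> fr d (h *m L).
Proof.
move=> hd i; rewrite mxE; apply: supp_in_sum => k _.
by apply: (grd_mul _ (hd k) (@L_deg k i)); lia.
Qed.

Lemma fr_nth_lt d (i : 'I_(size e)) : (2 <= d)%N -> e`_i < d%:Z.
Proof. by move=> d2; have /andP[_ ?] := e01 i; lia. Qed.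

Lemma ev_rbd1 F : ev (rbd1 F) = bd1 (fun l => ev (F l)).
Proof. by rewrite rbd1M rbd1E. Qed.

Lemma ev_rbd2 F l : ev (rbd2 F l) = bd2 (fun l => ev (F l)) l.
Proof. by rewrite rbd2M rbd2E. Qed.

Lemma ev_rbd3 f l : ev (rbd3 f l) = bd3 (ev f) l.
Proof. by rewrite rbd3M rbd3E. Qed.

Lemma evB (f g : 'rV_(size e)) : ev (f - g) = ev f - ev g.
Proof. by rewrite mulmxBl mxBE. Qed.

Lemma ev_onto (d : nat) : (d <= n)%N -> forall h, kerQ a b d h ->
  exists2 f, fr d f & supp_in (above b) (h - ev f).
Proof.
clear L_onto L_inj.
elim: d => [|[|d] IH] dn h hQ; [exact: G_onto|exact: G_onto|].
have [|F FQ hE] := kerQ_gen win K0 _ hQ; first lia.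
have /choice [f fP] l : exists f, fr d.+1%:Z f /\ supp_in (above b) (F l - ev f).
  have [||f ? ?] := IH _ (F l); [lia| |by exists f].
  by move: (FQ l); congr (kerQ _ _ _ _); lia.
exists (rbd1 f); first by apply: (fr_rbd1 (d := d.+1%:Z)); [lia|move=> l; case: (fP l)].
by rewrite hE ev_rbd1 -bd1B; apply: above_bd1 => l; case: (fP l).
Qed.

Lemma fr_neg h (d : int) : d < 2 -> fr d h -> h = 0 :> 'rV[T]_(size s).
Proof. by move=> d2 hd; apply/rowP => k; rewrite mxE; apply: grd0_neg (hd k); rewrite s2; lia. Qed.

(** Split a relation as the sum of the x_l F_l. The values of the F_l form a Koszul cycle of Q,
    hence a boundary, which is lifted to the free module as [t]. Subtracting the boundary of [t]
    leaves the sum unchanged and turns each F_l into a relation of lower degree. *)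
Lemma rel_onto (d : nat) : (d <= n)%N -> forall f, fr d f -> supp_in (above b) (ev f) ->
  exists2 h, fr d h & f = h *m L.
Proof.
elim: d => [|[|[|d]] IH] dn f fd fb; [| |exact: L_onto|].
- exists 0; first by move=> i; rewrite mxE; apply: supp_in0.
  by rewrite mul0mx (G_inj _ _ fd).
- exists 0; first by move=> i; rewrite mxE; apply: supp_in0.
  by rewrite mul0mx (G_inj _ _ fd).
have [|F Fd fE] := row_gen _ fd; first by move=> i; apply: fr_nth_lt.
have [|||g gQ gE] := kerQ_exact1 (d := d.+3) (f := fun l => ev (F l)) win K0.
- lia.
- by move=> l; apply: ev_kerQ.
- by rewrite -ev_rbd1 -fE.
have /choice [t tP] l : exists t, fr d.+1%:Z t /\ supp_in (above b) (g l - ev t).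
  have [||t ? ?] := @ev_onto d.+1 _ (g l); [lia| |by exists t].
  by move: (gQ l); congr (kerQ _ _ _ _); lia.
have td l : fr d.+1%:Z (t l) by case: (tP l).
have /choice [h hP] l : exists h, fr d.+2%:Z h /\ F l - rbd2 t l = h *m L.
  have [|||h ? ?] := IH _ (F l - rbd2 t l); [lia| | |by exists h].
  - apply: frB; first by apply: fr_cast (Fd l); lia.
    by apply: (fr_rbd2 (d := d.+1%:Z)); first lia.
  rewrite evB [X in _ - X]ev_rbd2; apply: (supp_in_trans (h' := bd2 (fun l => g l - ev (t l)) l)).
    by rewrite (bd2B g (fun l => ev (t l))) subBB.
  by apply: above_bd2 => k; case: (tP k).
exists (rbd1 h); first by apply: (fr_rbd1 (d := d.+2%:Z)); [lia|move=> l; case: (hP l)].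
rewrite rbd1M -[f]subr0 -(rbd1_rbd2 t) fE -rbd1B; congr rbd1.
by apply: funext => l; case: (hP l).
Qed.

(** The chase of [rel_onto] one place further. Exactness for the free module gives S with F = bd2 S;
    the values of S form a cycle of Q; after correction S is a combination [u] of relations, and by
    induction H is the boundary of [u]. *)
Lemma rel_inj (d : nat) : (d <= n)%N -> forall h, fr d h -> h *m L = 0 -> h = 0.
Proof.
elim: d => [|[|[|d]] IH] dn h hd hL; [exact: fr_neg hd|exact: fr_neg hd|exact: L_inj|].
have [|H Hd hE] := row_gen _ hd; first by move=> k; rewrite s2; lia.
have [|||S Sd SE] := row_exact1 (d := d.+3) (F := fun l => H l *m L).
- by move=> i; apply: fr_nth_lt.
- by move=> l; apply: mulL_fr.
- by rewrite -rbd1M -hE.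
have evL (g : 'rV_(size s)) (j : int) : fr j g -> supp_in (above b) (ev (g *m L)).
  move=> gj; rewrite -mulmxA mxE; apply: supp_in_sum => k _.
  exact: above_mul (grd_above (gj k)) (@LG k).
have [|||k kQ kE] := kerQ_exact2 (d := d.+3) (g := fun l => ev (S l)) win.
- lia.
- by move=> l; apply: ev_kerQ.
- by move=> l; rewrite -ev_rbd2 -SE; apply: evL (Hd l).
have [||t td tE] := @ev_onto d _ k; first lia.
  by move: kQ; congr (kerQ _ _ _ _); lia.
have /choice [u uP] l : exists u, fr d.+1%:Z u /\ S l - rbd3 t l = u *m L.
  have [|||u ? ?] := @rel_onto d.+1 _ (S l - rbd3 t l); [lia| | |by exists u].
  - apply: frB; first by apply: fr_cast (Sd l); lia.
    by apply: fr_rbd3 td; lia.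
  rewrite evB [X in _ - X]ev_rbd3; apply: (supp_in_trans (h' := bd3 (k - ev t) l)).
    by rewrite bd3B subBB.
  exact: above_bd3.
have HE l : H l = rbd2 u l.
  apply/eqP; rewrite -subr_eq0; apply/eqP; apply: IH; first lia.
    apply: frB; first by apply: fr_cast (Hd l); lia.
    by apply: (fr_rbd2 (d := d.+1%:Z)); [lia|move=> i; case: (uP i)].
  rewrite mulmxBl rbd2M SE.
  have -> : (fun l => u l *m L) = (fun l => S l - rbd3 t l).
    by apply: funext => i; case: (uP i).
  by rewrite rbd2B rbd2_rbd3 subr0 subrr.
by rewrite hE; have -> : H = rbd2 u by [apply: funext]; rewrite rbd1_rbd2.
Qed.

End Resolve.

(** * Counting triangles *)

Section Lists.
Variables (a b : seq expo).

Definition monos (n : nat) : seq expo :=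
  [seq [ffun i : 'I_3 => if i == 0 then x%:Z else if i == 1 then y%:Z else n%:Z - x%:Z - y%:Z]
     | x <- iota 0 n.+1, y <- iota 0 n.+1].

Lemma mem_monos c : lee 0 c -> c \in monos `|deg c|%N.
Proof.
move=> /leeP c0; have := c0 0; have := c0 1; have := c0 2%:R; rewrite !ffunE => n2 n1 n0.
have dE : deg c = c 0 + c 1 + c 2%:R by rewrite /deg sum3.
apply/allpairsP; exists (`|(c 0)%R|%N, `|(c 1)%R|%N); split.
- by rewrite mem_iota /=; lia.
- by rewrite mem_iota /=; lia.
apply/ffunP; elim/ord3_ind; rewrite ffunE /= ?gez0_abs // dE ?addr_ge0 //.
have H (x y z : int) : z = x + y + z - x - y by lia.
exact: H.
Qed.

(** The enumeration also yields exponents with a negative third coordinate and repetitions; the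
    filter and [undup] make it exact. *)
Definition grdl (j : int) : seq expo :=
  undup [seq c <- [seq d + m | d <- a, m <- monos `|(j - deg d)%R|%N] | grd a j c].

Lemma mem_grdl j c : (c \in grdl j) = grd a j c.
Proof.
rewrite mem_undup mem_filter; apply/idP/idP => [/andP[]//|gc].
rewrite gc andTb; case/andP: gc => /hasP[d da dc] /eqP cj.
apply/allpairsPdep; exists d, (c - d); split => //; last by rewrite addrC subrK.
rewrite -cj -degB; apply: mem_monos; apply/leeP => i; move/leeP: dc => /(_ i).
by rewrite !ffunE subr_ge0.
Qed.

Definition monl (j : int) : seq expo := [seq c <- grdl j | ~~ above b c].

Lemma uniq_grdl j : uniq (grdl j). Proof. exact: undup_uniq. Qed.

Lemma uniq_monl j : uniq (monl j). Proof. exact/filter_uniq/uniq_grdl. Qed.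

Lemma mem_monl j c : (c \in monl j) = mon a b c && (deg c == j).
Proof. by rewrite mem_filter mem_grdl /grd /mon; case: (above b c); rewrite ?andbF ?andbT. Qed.

Lemma count_shift (d : expo) (j k : int) : lee 0 d -> k = j + deg d ->
  (\sum_(c <- grdl k) mon a b (c - d)%R)%N = size (monl j).
Proof.
move=> d0 kE; have cd c : lee c (c + d).
  by apply/leeP => i; move/leeP: d0 => /(_ i); rewrite !ffunE lerDl.
rewrite big_seq (eq_bigr (fun c => if mon a b (c - d) then 1%N else 0%N)); last first.
  by move=> c _; case: (mon _ _ _).
rewrite -big_seq -big_mkcond sum1_count -size_filter -[RHS](size_map (fun c => c + d)).
apply/perm_size/uniq_perm; first exact/filter_uniq/uniq_grdl.
  by rewrite map_inj_uniq ?uniq_monl //; apply: addIr.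
move=> c; rewrite mem_filter mem_grdl; apply/andP/mapP => [[mc /andP[_ /eqP cj]]|[e]].
  exists (c - d); last by rewrite subrK.
  by rewrite mem_monl mc degB cj kE addrK eqxx.
rewrite mem_monl => /andP[me /eqP ej] ->; rewrite addrK me; split => //.
rewrite /grd degD ej kE eqxx andbT; apply: above_le (cd e) _.
by case/andP: me.
Qed.

End Lists.

Section Local.
(* For a lattice vertex c, W i and B i tell whether the white triangle c - e_i and
   the opposite black triangle c - e_(i+1) - e_(i+2) belong to Omega; inb and outb
   are the boundary edges ending, respectively starting, at c. *)
Variables (W B : 'I_3 -> bool).

Definition inb (x : bool * 'I_3) : bool :=
  if x.1 then W (x.2 + 2%:R) && ~~ B (x.2 + 1) else ~~ W (x.2 + 1) && B (x.2 + 2%:R).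
Definition outb (x : bool * 'I_3) : bool :=
  if x.1 then W (x.2 + 1) && ~~ B (x.2 + 2%:R) else ~~ W (x.2 + 2%:R) && B (x.2 + 1).

Hypothesis H1 : forall x y, outb x -> outb y -> x = y.
Hypothesis H2 : forall x y, inb x -> outb y -> (x == y) || (y.2 == x.2 - 1).
Variable st : bool * 'I_3 -> bool.
Hypothesis H3 : forall x y, inb x -> outb y -> st x = (x == y).

(** The hexagon around c as seen in degrees 0 and 1: under acyclicity this decides whether the
    degree 2 monomial x^c lies in M, see [allin_mon]. *)
Definition allin : bool := [|| W 0, W 1 | W 2%:R] && [forall i, B i ==> W (i + 1) && W (i + 2%:R)].

Lemma allinE : allin = [&& [|| W 0, W 1 | W 2%:R], B 0 ==> W 1 && W 2%:R,
  B 1 ==> W 2%:R && W 0 & B 2%:R ==> W 0 && W 1].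
Proof.
rewrite /allin; congr (_ && _); apply/forallP/and3P => [H|[h0 h1 h2]].
  by have := H 0; have := H 1; have := H 2%:R; rewrite !ord3_val.
by elim/ord3_ind; rewrite !ord3_val.
Qed.

Lemma sum_bool3 (F : bool * 'I_3 -> nat) :
  (\sum_x F x = F (true, 0%R) + F (true, 1%R) + F (true, 2%:R%R) +
               (F (false, 0%R) + F (false, 1%R) + F (false, 2%:R%R)))%N.
Proof.
rewrite (eq_bigr (fun x => F (x.1, x.2))) => [|[]//].
by rewrite -(pair_bigA _ (fun u v => F (u, v))) /= big_bool !sum3.
Qed.

(** [H1] and [H2] unfolded on six booleans, so that the vertex identity can be decided in 64 cases.
    The prefixes [ot], [of], [it], [if] mark outgoing and incoming edges with first component true
    or false. *)
Definition vertex_ok (W0 W1 W2 B0 B1 B2 : bool) : bool :=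
  let ot0 := W1 && ~~ B2 in let ot1 := W2 && ~~ B0 in let ot2 := W0 && ~~ B1 in let of0 := ~~ W2 &&
    B1 in let of1 := ~~ W0 && B2 in let of2 := ~~ W1 && B0 in
  let it0 := W2 && ~~ B1 in let it1 := W0 && ~~ B2 in let it2 := W1 && ~~ B0 in let if0 := ~~ W1 &&
    B2 in let if1 := ~~ W2 && B0 in let if2 := ~~ W0 && B1 in
  [&& ~~ (ot0 && ot1), ~~ (ot0 && ot2), ~~ (ot0 && of0), ~~ (ot0 && of1), ~~ (ot0 && of2), ~~ (ot1
    && ot2), ~~ (ot1 && of0), ~~ (ot1 && of1), ~~ (ot1 && of2), ~~ (ot2 && of0), ~~ (ot2 && of1), ~~
    (ot2 && of2), ~~ (of0 && of1), ~~ (of0 && of2) & ~~ (of1 && of2)] &&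
  [&& ~~ (it0 && ot1), ~~ (it0 && of0), ~~ (it0 && of1), ~~ (it1 && ot2), ~~ (it1 && of1), ~~ (it1
    && of2), ~~ (it2 && ot0), ~~ (it2 && of0), ~~ (it2 && of2), ~~ (if0 && ot0), ~~ (if0 && ot1), ~~
    (if0 && of1), ~~ (if1 && ot1), ~~ (if1 && ot2), ~~ (if1 && of2), ~~ (if2 && ot0), ~~ (if2 &&
    ot2) & ~~ (if2 && of0)].

Definition corner_at (W0 W1 W2 B0 B1 B2 : bool) : nat :=
  let ot0 := W1 && ~~ B2 in let ot1 := W2 && ~~ B0 in let ot2 := W0 && ~~ B1 in let of0 := ~~ W2 &&
    B1 in let of1 := ~~ W0 && B2 in let of2 := ~~ W1 && B0 in
  let it0 := W2 && ~~ B1 in let it1 := W0 && ~~ B2 in let it2 := W1 && ~~ B0 in let if0 := ~~ W1 &&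
    B2 in let if1 := ~~ W2 && B0 in let if2 := ~~ W0 && B1 in
  (it0 && [|| ot1, ot2, of0, of1 | of2]) + (it1 && [|| ot0, ot2, of0, of1 | of2]) + (it2 && [|| ot0,
    ot1, of0, of1 | of2]) + (if0 && [|| ot0, ot1, ot2, of1 | of2]) + (if1 && [|| ot0, ot1, ot2, of0
    | of2]) + (if2 && [|| ot0, ot1, ot2, of0 | of1]).

Lemma vertex_okP : vertex_ok (W 0) (W 1) (W 2%:R) (B 0) (B 1) (B 2%:R).
Proof.
have h1 x y : x != y -> ~~ (outb x && outb y).
  by move=> /eqP xy; apply/negP => /andP[ox oy]; apply: xy; apply: H1.
have h2 x y : x != y -> y.2 != x.2 - 1 -> ~~ (inb x && outb y).
  move=> /negPf xy /negPf xy2; apply/negP => /andP[ox oy].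
  by have := H2 ox oy; rewrite xy xy2.
rewrite /vertex_ok; apply/andP; split.
  repeat (apply/andP; split).
  by have := @h1 (true, 0) (true, 1) isT; rewrite /outb /= !ord3_val.
  by have := @h1 (true, 0) (true, 2%:R) isT; rewrite /outb /= !ord3_val.
  by have := @h1 (true, 0) (false, 0) isT; rewrite /outb /= !ord3_val.
  by have := @h1 (true, 0) (false, 1) isT; rewrite /outb /= !ord3_val.
  by have := @h1 (true, 0) (false, 2%:R) isT; rewrite /outb /= !ord3_val.
  by have := @h1 (true, 1) (true, 2%:R) isT; rewrite /outb /= !ord3_val.
  by have := @h1 (true, 1) (false, 0) isT; rewrite /outb /= !ord3_val.
  by have := @h1 (true, 1) (false, 1) isT; rewrite /outb /= !ord3_val.
  by have := @h1 (true, 1) (false, 2%:R) isT; rewrite /outb /= !ord3_val.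
  by have := @h1 (true, 2%:R) (false, 0) isT; rewrite /outb /= !ord3_val.
  by have := @h1 (true, 2%:R) (false, 1) isT; rewrite /outb /= !ord3_val.
  by have := @h1 (true, 2%:R) (false, 2%:R) isT; rewrite /outb /= !ord3_val.
  by have := @h1 (false, 0) (false, 1) isT; rewrite /outb /= !ord3_val.
  by have := @h1 (false, 0) (false, 2%:R) isT; rewrite /outb /= !ord3_val.
  by have := @h1 (false, 1) (false, 2%:R) isT; rewrite /outb /= !ord3_val.
repeat (apply/andP; split).
by have := @h2 (true, 0) (true, 1) isT isT; rewrite /inb /outb /= !ord3_val.
by have := @h2 (true, 0) (false, 0) isT isT; rewrite /inb /outb /= !ord3_val.
by have := @h2 (true, 0) (false, 1) isT isT; rewrite /inb /outb /= !ord3_val.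
by have := @h2 (true, 1) (true, 2%:R) isT isT; rewrite /inb /outb /= !ord3_val.
by have := @h2 (true, 1) (false, 1) isT isT; rewrite /inb /outb /= !ord3_val.
by have := @h2 (true, 1) (false, 2%:R) isT isT; rewrite /inb /outb /= !ord3_val.
by have := @h2 (true, 2%:R) (true, 0) isT isT; rewrite /inb /outb /= !ord3_val.
by have := @h2 (true, 2%:R) (false, 0) isT isT; rewrite /inb /outb /= !ord3_val.
by have := @h2 (true, 2%:R) (false, 2%:R) isT isT; rewrite /inb /outb /= !ord3_val.
by have := @h2 (false, 0) (true, 0) isT isT; rewrite /inb /outb /= !ord3_val.
by have := @h2 (false, 0) (true, 1) isT isT; rewrite /inb /outb /= !ord3_val.
by have := @h2 (false, 0) (false, 1) isT isT; rewrite /inb /outb /= !ord3_val.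
by have := @h2 (false, 1) (true, 1) isT isT; rewrite /inb /outb /= !ord3_val.
by have := @h2 (false, 1) (true, 2%:R) isT isT; rewrite /inb /outb /= !ord3_val.
by have := @h2 (false, 1) (false, 2%:R) isT isT; rewrite /inb /outb /= !ord3_val.
by have := @h2 (false, 2%:R) (true, 0) isT isT; rewrite /inb /outb /= !ord3_val.
by have := @h2 (false, 2%:R) (true, 2%:R) isT isT; rewrite /inb /outb /= !ord3_val.
by have := @h2 (false, 2%:R) (false, 0) isT isT; rewrite /inb /outb /= !ord3_val.
Qed.

Lemma vertex_sum W0 W1 W2 B0 B1 B2 : vertex_ok W0 W1 W2 B0 B1 B2 ->
  (2 * (W0 + W1 + W2) = B0 + B1 + B2 + 3 * [&& [|| W0, W1 | W2], B0 ==> W1 && W2,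
     B1 ==> W2 && W0 & B2 ==> W0 && W1] + corner_at W0 W1 W2 B0 B1 B2)%N.
Proof. by case: W0; case: W1; case: W2; case: B0; case: B1; case: B2. Qed.

(** Going once around the hexagon, Omega is entered as often as it is left. *)
Lemma in_out x : inb x -> exists y, outb y.
Proof.
have E : [|| inb (true, 0), inb (true, 1), inb (true, 2%:R), inb (false, 0), inb (false, 1)
    | inb (false, 2%:R)] -> [|| outb (true, 0), outb (true, 1), outb (true, 2%:R),
      outb (false, 0), outb (false, 1) | outb (false, 2%:R)].
  rewrite /inb /outb /= !ord3_val.
  move: (W 0) (W 1) (W 2%:R) (B 0) (B 1) (B 2%:R); clear.
  by case; case; case; case; case; case.
move=> ix; have /E : [|| inb (true, 0), inb (true, 1), inb (true, 2%:R), inb (false, 0),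
    inb (false, 1) | inb (false, 2%:R)].
  by case: x ix => [[]]; elim/ord3_ind => ->; rewrite ?orbT.
by case/orP => [?|/orP[?|/orP[?|/orP[?|/orP[?|?]]]]]; eexists; eassumption.
Qed.

Lemma in_turn x : inb x && ~~ st x = inb x && [exists y, outb y && (y != x)].
Proof.
case: (boolP (inb x)) => //= ix; have [y oy] := in_out ix.
rewrite (H3 ix oy); apply/idP/existsP => [xy|[z /andP[oz zx]]].
  by exists y; rewrite oy eq_sym.
by apply: contra zx => /eqP ->; rewrite (H1 oz oy).
Qed.

Lemma corner_sum : (\sum_x (inb x && ~~ st x) =
  corner_at (W 0%R) (W 1%R) (W 2%:R%R) (B 0%R) (B 1%R) (B 2%:R%R))%N.
Proof.
rewrite sum_bool3 !in_turn.
have ex (P : pred (bool * 'I_3)) : [exists y, P y] = [|| P (true, 0), P (true, 1), P (true, 2%:R),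
    P (false, 0), P (false, 1) | P (false, 2%:R)].
  apply/existsP/idP => [[[[]]]|].
  - by elim/ord3_ind => ->; rewrite ?orbT.
  - by elim/ord3_ind => ->; rewrite ?orbT.
  by case/orP => [?|/orP[?|/orP[?|/orP[?|/orP[?|?]]]]]; eexists; eassumption.
rewrite !ex /inb /outb /= !ord3_val /corner_at.
move: (W 0) (W 1) (W 2%:R) (B 0) (B 1) (B 2%:R); clear.
by case; case; case; case; case; case.
Qed.

Lemma vertex_count : (2 * \sum_i W i = \sum_i B i + 3 * allin + \sum_x (inb x && ~~ st x))%N.
Proof. by rewrite corner_sum allinE !sum3 (vertex_sum vertex_okP). Qed.

(** Meant for the corners of [w], where acyclicity is known for M^w but not for M. *)
Lemma allin_at (i : 'I_3) : W i -> (forall k, k != i -> B k -> forall l, l != k -> W l) -> allin.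
Proof.
move=> Wi HB; have hB k l : k != i -> l != k -> B k ==> W l.
  by move=> ki lk; apply/implyP => Bk; apply: HB lk.
rewrite allinE; have := vertex_okP; move: Wi.
move: i hB {HB}; elim/ord3_ind => hB.
- have := hB 1 2%:R isT isT; have := hB 2%:R 1 isT isT.
  move: (W 0) (W 1) (W 2%:R) (B 0) (B 1) (B 2%:R); clear.
  by case; case; case; case; case; case.
- have := hB 0 2%:R isT isT; have := hB 2%:R 0 isT isT.
  move: (W 0) (W 1) (W 2%:R) (B 0) (B 1) (B 2%:R); clear.
  by case; case; case; case; case; case.
have := hB 0 1 isT isT; have := hB 1 0 isT isT.
move: (W 0) (W 1) (W 2%:R) (B 0) (B 1) (B 2%:R); clear.
by case; case; case; case; case; case.
Qed.

End Local.

(** * The boundary polygon, vertex by vertex *)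

Section Polygon.
Variables (Om : pred expo) (p : seq edge) (D : nat).
Hypotheses (Om_polygon : boundary Om p) (Om_slopes : cyclic_slopes p)
  (Om_degree : degree p D).

Definition ein (c : expo) (x : bool * 'I_3) : edge :=
  (x.1, x.2, c - ebase (x.2 + (if x.1 then 2%:R else 1))).
Definition eout (c : expo) (x : bool * 'I_3) : edge :=
  (x.1, x.2, c - ebase (x.2 + (if x.1 then 1 else 2%:R))).

Lemma etgt_ein c x : etgt (ein c x) = c.
Proof. by rewrite /etgt /ein /color /slope /= subrK. Qed.

Lemma esrc_eout c x : esrc (eout c x) = c.
Proof. by rewrite /esrc /eout /color /slope /= subrK. Qed.

Lemma ein_etgt e c : etgt e = c -> e = ein c e.1.
Proof. by case: e => -[col s] u; rewrite /etgt /ein /color /slope /= => <-; rewrite addrK. Qed.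

Lemma bedge_ein c x : deg c = 2 ->
  bedge Om (ein c x) = inb (fun i => Om (c - ebase i)) (fun i => Om (sub2 i c)) x.
Proof.
move=> c2; case: x => -[] s; rewrite /bedge /ein /inb /color /slope /= degB c2 deg_ebase /=.
  by rewrite addrAC sub2r.
by rewrite addrAC sub2l.
Qed.

Lemma bedge_eout c x : deg c = 2 ->
  bedge Om (eout c x) = outb (fun i => Om (c - ebase i)) (fun i => Om (sub2 i c)) x.
Proof.
move=> c2; case: x => -[] s; rewrite /bedge /eout /outb /color /slope /= degB c2 deg_ebase /=.
  by rewrite addrAC sub2l.
by rewrite addrAC sub2r.
Qed.

Lemma uniq_p : uniq p.
Proof. by case: Om_polygon => _ /map_uniq. Qed.

Lemma src_inj e f : e \in p -> f \in p -> esrc e = esrc f -> e = f.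
Proof.
case: Om_polygon => _ up _ _ ep fp ef.
have /eqP ij : index e p == index f p.
  rewrite -(nth_uniq (esrc e) _ _ up) ?size_map ?index_mem //.
  by rewrite !(nth_map e) ?index_mem // !nth_index // ef.
by rewrite -(nth_index e ep) ij nth_index.
Qed.

Lemma next_src e : e \in p -> next p e \in p /\ esrc (next p e) = etgt e.
Proof.
move=> ep; case: Om_polygon => _ _ cp _; split; first by rewrite mem_next.
by have /eqP := next_cycle cp ep.
Qed.

Lemma vertex_hyps c : deg c = 2 ->
  let W i := Om (c - ebase i) in let B i := Om (sub2 i c) in
  [/\ forall x y, outb W B x -> outb W B y -> x = y,
      forall x y, inb W B x -> outb W B y -> (x == y) || (y.2 == x.2 - 1) &
      forall x y, inb W B x -> outb W B y ->
        straight (ein c x) (next p (ein c x)) = (x == y)].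
Proof.
move=> c2 W B; case: Om_polygon => _ _ _ memp.
have nx x y : inb W B x -> outb W B y -> ein c x \in p /\ next p (ein c x) = eout c y.
  rewrite -bedge_ein // -bedge_eout // -!memp => ip op; split=> //.
  have [np ns] := next_src ip; apply: src_inj => //.
  by rewrite ns etgt_ein esrc_eout.
have ste x y : straight (ein c x) (eout c y) = (x == y).
  by case: x y => -[] sx [] sy; rewrite /straight /color /slope.
split=> [x y|x y ix oy|x y ix oy].
- rewrite -!bedge_eout // -!memp => ox oy.
  have := src_inj ox oy; rewrite !esrc_eout => /(_ erefl).
  by move: x y {ox oy} => [cx sx] [cy sy] [-> ->].
- have [ip ne] := nx _ _ ix oy.
  by have := next_cycle Om_slopes ip; rewrite ne ste.
by have [ip ->] := nx _ _ ix oy.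
Qed.

Lemma sum_etgt (F : edge -> nat) c : deg c = 2 ->
  (\sum_(e <- p | etgt e == c) F e =
   \sum_x inb (fun i => Om (c - ebase i)%R) (fun i => Om (sub2 i c)) x * F (ein c x))%N.
Proof.
move=> c2; rewrite (partition_big (fun e : edge => e.1) xpredT) //=; apply: eq_bigr => x _.
rewrite -bedge_ein //; case: Om_polygon => _ _ _ <-.
rewrite (eq_bigl (pred1 (ein c x))) => [|e]; last first.
  apply/andP/eqP => [[/eqP /ein_etgt -> /eqP <-]//|->].
  by rewrite etgt_ein eqxx; case: x => /= ? ?; rewrite eqxx.
case: (boolP (ein c x \in p)) => ip.
  rewrite big_mkcond (bigD1_seq (ein c x)) ?uniq_p //= eqxx mul1n.
  by rewrite big1 ?addn0 // => e /negPf ->.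
rewrite mul0n big_seq_cond big1 // => e /andP[ep /eqP ee].
by move: ip; rewrite -ee ep.
Qed.

(** Otherwise [v] would have a sharp corner at the vertex c: its two edges there would be
    consecutive on the boundary, with slopes j + 1 and then j + 2, the wrong cyclic direction. *)
Lemma no_acute v j : deg v = 0 -> Om v -> Om (v + ebase (j + 1)) || Om (v + ebase (j + 2%:R)).
Proof.
move=> v0 Ov; apply/norP => -[n1 n2].
pose c := v + ebase (j + 1) + ebase (j + 2%:R).
have c2 : deg c = 2 by rewrite /c !degE v0.
have [_ H2 _] := vertex_hyps c2.
have sc : sub2 j c = v by rewrite /sub2 /c addrAC !addrK.
have W1 : c - ebase (j + 2%:R) = v + ebase (j + 1) by rewrite addrK.
have W2 : c - ebase (j + 1) = v + ebase (j + 2%:R) by rewrite /c addrAC addrK.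
have := H2 (false, j + 1) (false, j + 2%:R).
rewrite /inb /outb /= !ord3E sc W1 W2 Ov n1 n2 => /(_ isT isT).
by clear; elim/ord3_ind: j.
Qed.

End Polygon.

Lemma allin_mon a b c : acyc a b c ->
  allin (fun i => mon a b (c - ebase i)) (fun i => mon a b (sub2 i c)) = mon a b c.
Proof.
move=> /cube_acyc; rewrite allinE; move: (mon a b c) (mon a b (sub3 c)).
move: (mon a b (c - ebase 0)) (mon a b (c - ebase 1)) (mon a b (c - ebase 2%:R)).
move: (mon a b (sub2 0 c)) (mon a b (sub2 1 c)) (mon a b (sub2 2%:R c)).
by case; case; case; case; case; case; case; case.
Qed.

Lemma ord3_third (i k : 'I_3) : k != i -> exists l, [/\ l != i, l != k & i = l + 1 /\ k = l + 2%:R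
  \/ i = l + 2%:R /\ k = l + 1].
Proof.
elim/ord3_ind: i; elim/ord3_ind: k => // _;
  [exists 2%:R | exists 1 | exists 2%:R | exists 0 | exists 1 | exists 0];
  rewrite !ord3_val; split=> //; auto.
Qed.

Lemma ord3_third_uniq (i k l l' : 'I_3) :
  k != i -> l != i -> l != k -> l' != i -> l' != k -> l' = l.
Proof. by elim/ord3_ind: i; elim/ord3_ind: k; elim/ord3_ind: l; elim/ord3_ind: l'. Qed.

Lemma lee_deg_eq c d : lee c d -> deg d <= deg c -> c = d.
Proof.
move=> cd dc; apply/eqP; apply: contraTT dc => /(lee_lt cd) [i /lee_deg].
by rewrite degB deg_ebase -ltNge; move: (deg c) (deg d); clear; lia.
Qed.

Section Count.
Variables (Om : pred expo) (p : seq edge) (D : nat) (a b : seq expo).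
Hypotheses (Om_polygon : boundary Om p) (Om_slopes : cyclic_slopes p)
  (Om_degree : degree p D) (Om_ab : decomposition Om a b).

Lemma Om_mon c : deg c = 0 \/ deg c = 1 -> Om c = mon a b c.
Proof.
move=> dc; case: Om_ab => _ _ _ ->; have tc : triangle c.
  by rewrite /triangle; case: dc => ->.
by congr (_ && ~~ _); apply: eq_has => x; rewrite /Delta tc.
Qed.

Lemma Om_black c i : deg c = 2 -> Om (sub2 i c) = mon a b (sub2 i c).
Proof. by move=> c2; apply: Om_mon; left; rewrite deg_sub2 c2. Qed.

Lemma Om_white c i : deg c = 2 -> Om (c - ebase i) = mon a b (c - ebase i).
Proof. by move=> c2; apply: Om_mon; right; rewrite degB deg_ebase c2. Qed.

Definition inside (c : expo) : bool :=
  allin (fun i => Om (c - ebase i)) (fun i => Om (sub2 i c)).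

Lemma etgt_grd e : e \in p -> etgt e \in grdl a 2.
Proof.
case: Om_polygon => _ _ _ -> /andP[/eqP e1 H]; rewrite mem_grdl /grd /etgt degD deg_ebase e1 eqxx andbT.
apply: above_add; move: H; case: (color e) => /andP[O1 O2].
  by move: O1; rewrite Om_mon ?e1; [case/andP|right].
move: O2; rewrite Om_mon; last by left; rewrite degB deg_ebase e1.
by case/andP => H _; apply: above_le H; apply: lee_sub.
Qed.

Lemma count_segments : (\sum_(c <- grdl a 2)
   \sum_(x : bool * 'I_3) (inb (fun i => Om (c - ebase i)%R) (fun i => Om (sub2 i c)) x &&
      ~~ straight (ein c x) (next p (ein c x))) = 3 * D)%N.
Proof.
rewrite -Om_degree /nsegments -sum1_count.
pose F e := if ~~ straight e (next p e) then 1%N else 0%N.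
transitivity (\sum_(c <- grdl a 2) \sum_(e <- p | etgt e == c) F e)%N.
  rewrite big_seq [RHS]big_seq; apply: eq_bigr => c; rewrite mem_grdl => /andP[_ /eqP c2].
  rewrite (sum_etgt Om_polygon) //; apply: eq_bigr => x _.
  by rewrite /F; case: (inb _ _ _); case: (straight _ _).
under eq_bigr do rewrite big_mkcond /=.
rewrite exchange_big [RHS]big_mkcond /= big_seq [RHS]big_seq; apply: eq_bigr => e ep.
rewrite (bigD1_seq (etgt e)) ?uniq_grdl ?etgt_grd //= eqxx big1 ?addn0 // => c ce.
by rewrite eq_sym (negPf ce).
Qed.

(** The identity [vertex_count] summed over the lattice vertices: each triangle has three corners,
    and the boundary turns 3D times. *)
Lemma count_vertices : (6 * size (monl a b 1) =
  3 * size (monl a b 0) + 3 * \sum_(c <- grdl a 2) inside c + 3 * D)%N.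
Proof.
have lee0 i : lee 0 (ebase i) by apply/leeP => j; rewrite !ffunE; case: (_ == _).
have cW i : (\sum_(c <- grdl a 2) Om (c - ebase i)%R)%N = size (monl a b 1).
  rewrite -(count_shift a b (d := ebase i) (j := 1) (k := 2)) ?deg_ebase //.
  rewrite big_seq [RHS]big_seq; apply: eq_bigr => c; rewrite mem_grdl => /andP[_ /eqP c2].
  by rewrite Om_white.
have cB i : (\sum_(c <- grdl a 2) Om (sub2 i c))%N = size (monl a b 0).
  rewrite -(count_shift a b (d := ebase (i + 1) + ebase (i + 2%:R)) (j := 0) (k := 2)).
  - rewrite big_seq [RHS]big_seq; apply: eq_bigr => c; rewrite mem_grdl => /andP[_ /eqP c2].
    by rewrite Om_black // /sub2 opprD (addrA c).
  - exact: lee_trans (lee0 _) (lee_add (ebase (i + 1)) (i + 2%:R)).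
  by rewrite degD !deg_ebase.
have -> : (6 * size (monl a b 1) = \sum_(c <- grdl a 2) 2 * \sum_i Om (c - ebase i)%R)%N.
  by rewrite -big_distrr exchange_big /= sum3 !cW; lia.
have -> : (3 * size (monl a b 0) = \sum_(c <- grdl a 2) \sum_i Om (sub2 i c))%N.
  by rewrite exchange_big /= sum3 !cB; lia.
rewrite -count_segments big_distrr -!big_split /= big_seq [RHS]big_seq; apply: eq_bigr => c.
rewrite mem_grdl => /andP[_ /eqP c2].
have [H1 H2 H3] := vertex_hyps Om_polygon Om_slopes c2.
exact: (vertex_count H1 H2 (st := fun x => straight (ein c x) (next p (ein c x))) H3).
Qed.

Lemma count_mon : (forall c, deg c = 2 -> acyc a b c) ->
  (2 * size (monl a b 1) = size (monl a b 0) + size (monl a b 2) + D)%N.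
Proof.
move=> ac; have : (\sum_(c <- grdl a 2) inside c = size (monl a b 2))%N.
  rewrite -(count_shift a b (d := 0) (j := 2) (k := 2)) ?leexx ?deg0 //.
  rewrite big_seq [RHS]big_seq; apply: eq_bigr => c; rewrite mem_grdl => /andP[_ /eqP c2].
  rewrite subr0 -(allin_mon (ac c c2)) /inside; congr (nat_of_bool (allin _ _)).
    by apply/funext => i; rewrite Om_white.
  by apply/funext => i; rewrite Om_black.
by have := count_vertices; lia.
Qed.

Section White.
Variable (w : expo).
Hypotheses (w1 : deg w = 1) (Ow : Om w) (ac : forall c, deg c = 2 -> acyc a (w :: b) c).

Lemma mon_cons c : deg c <= 1 -> mon a (w :: b) c = mon a b c && (c != w).
Proof.
move=> c1; rewrite /mon /above /= negb_or; case: (eqVneq c w) => [->|cw].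
  by rewrite leexx !andbF.
suff -> : lee w c = false by rewrite !andbT.
by apply: contraNF cw => /lee_deg_eq ->; rewrite ?w1.
Qed.

(** Exactness of the Koszul complex of M^w at the corner c = w + e_i, where x^c and x^(c - e_i) are
    both killed, forbids the other patterns. In this form the position of [w] relative to the
    boundary enters the proof. *)
Lemma white_star i k : k != i -> Om (w - ebase k) -> Om (w + ebase i - ebase k).
Proof.
have mw : mon a b w by rewrite -Om_mon //; right.
pose c := w + ebase i => ki Ok; have c2 : deg c = 2 by rewrite degD deg_ebase w1.
have mc : mon a (w :: b) c = false.
  by rewrite /mon /above /= lee_add ?andbF.
have Wi : mon a (w :: b) (c - ebase i) = false.
  by rewrite mon_cons addrK ?w1 // eqxx andbF.
have sc l k' : l != i -> l != k' -> k' != i -> sub2 l c = w - ebase k'.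
  move=> li lk ki'; have [E|E] : (i = l + 1 /\ k' = l + 2%:R) \/ (i = l + 2%:R /\ k' = l + 1).
    by have [l' [li' lk' E]] := ord3_third ki'; rewrite (ord3_third_uniq ki' li' lk' li lk).
  - by case: E => Ei ->; rewrite /sub2 -Ei /c addrK.
  by case: E => Ei ->; rewrite /sub2 -Ei /c addrAC addrK.
have Wk k' : k' != i -> mon a (w :: b) (c - ebase k') = Om (c - ebase k').
  move=> ki'; rewrite mon_cons ?degB ?deg_ebase ?c2 // Om_white //.
  case: (_ =P w) => [E|]; last by rewrite andbT.
  have /ffunP/(_ i) : c = w + ebase k' by rewrite -[in RHS]E subrK.
  by rewrite /c !ffunE eqxx (negPf ki') => /addrI.
have Bk k' l : l != i -> l != k' -> k' != i -> mon a (w :: b) (sub2 l c) = Om (w - ebase k').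
  move=> li lk ki'; rewrite (sc l k') // mon_cons ?degB ?deg_ebase ?w1 // Om_mon; last first.
    by left; rewrite degB deg_ebase w1.
  case: (_ =P w) => [E|]; last by rewrite andbT.
  by have := congr1 deg E; rewrite degB deg_ebase w1.
have Bt l : l != i -> mon a (w :: b) (sub3 c) -> mon a (w :: b) (sub2 l c).
  move=> li /andP[at3 _].
  have [k' [ki' kl _]] := ord3_third li; have lk : l != k' by rewrite eq_sym.
  rewrite (Bk k') // Om_mon; last by left; rewrite degB deg_ebase w1.
  have s3 : lee (sub3 c) (sub2 l c) by rewrite -(sub3_sub2 l); apply: lee_sub.
  rewrite -(sc l k') // /mon (above_le s3) //=.
  case/andP: mw => _; apply: contra; apply: above_le; rewrite (sc l k') //.
  exact: lee_sub.
have [l [li lk _]] := ord3_third ki.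
rewrite -/c -Wk //; move: Ok; rewrite -(Bk k l) //.
have := Bt l li; have := Bt k ki; have := cube_acyc (ac c2); move: mc Wi ki li lk.
move: (c) (w :: b) => c' b'; clear; elim/ord3_ind: i => -> ->.
- move: (mon a b' (sub3 c')) => t; elim/ord3_ind: k => //; elim/ord3_ind: l => // _ _ _;
  move: (mon a b' (c' - ebase 1)) (mon a b' (c' - ebase 2%:R));
  move: (mon a b' (sub2 0 c')) (mon a b' (sub2 1 c')) (mon a b' (sub2 2%:R c'));
  by case: t; case; case; case; case; case=> // _ // /(_ isT).
- move: (mon a b' (sub3 c')) => t; elim/ord3_ind: k => //; elim/ord3_ind: l => // _ _ _;
  move: (mon a b' (c' - ebase 0)) (mon a b' (c' - ebase 2%:R));
  move: (mon a b' (sub2 0 c')) (mon a b' (sub2 1 c')) (mon a b' (sub2 2%:R c'));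
  by case: t; case; case; case; case; case=> // _ // /(_ isT).
move: (mon a b' (sub3 c')) => t; elim/ord3_ind: k => //; elim/ord3_ind: l => // _ _ _;
  move: (mon a b' (c' - ebase 0)) (mon a b' (c' - ebase 1));
  move: (mon a b' (sub2 0 c')) (mon a b' (sub2 1 c')) (mon a b' (sub2 2%:R c'));
  by case: t; case; case; case; case; case=> // _ // /(_ isT).
Qed.

(** At the three corners w + e_i the hexagon is interior to Omega, while the monomial is killed in
    M^w. These corners are the 3 in [count_white]. *)
Lemma inside_white c : c \in grdl a 2 ->
  (inside c = mon a (w :: b) c + \sum_i (c == (w + ebase i)%R) :> nat)%N.
Proof.
rewrite mem_grdl => /andP[_ /eqP c2].
case: (boolP [exists i, c == w + ebase i]) => [/existsP[i /eqP cE]|nc].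
  have mc : mon a (w :: b) c = false by rewrite /mon /above /= cE lee_add ?andbF.
  rewrite mc (bigD1 i) //= {2}cE eqxx big1 => [|j ji]; last first.
    rewrite cE; case: (_ =P _) => // /addrI /ffunP/(_ i).
    by rewrite !ffunE eqxx (negPf ji).
  have [H1 H2 _] := vertex_hyps Om_polygon Om_slopes c2.
  suff -> : inside c by [].
  apply: (allin_at H1 H2 (i := i)); first by rewrite cE addrK.
  move=> k ki Bk l lk; case: (eqVneq l i) => [->|li]; first by rewrite cE addrK.
  rewrite cE; apply: white_star => //.
  have [k' [k'i k'l E]] := ord3_third li; move: Bk.
  rewrite (ord3_third_uniq li k'i k'l ki) 1?eq_sym // /sub2.
  by case: E => -[<- <-]; rewrite cE ?addrK // addrAC addrK.
rewrite big1 => [|i _]; last by apply/eqP; rewrite eqb0; move: nc => /existsPn/(_ i).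
rewrite addn0 -(allin_mon (ac c2)) /inside; congr (nat_of_bool (allin _ _)); apply/funext => i.
  rewrite Om_white // mon_cons ?degB ?deg_ebase ?c2 //.
  suff -> : c - ebase i != w by rewrite andbT.
  by apply: contraNneq nc => <-; apply/existsP; exists i; rewrite subrK.
rewrite Om_black // mon_cons ?deg_sub2 ?c2 //.
suff -> : sub2 i c != w by rewrite andbT.
by apply: contra_eq_neq w1 => <-; rewrite deg_sub2 c2.
Qed.

Lemma monl_white : perm_eq (monl a b 1) (w :: monl a (w :: b) 1).
Proof.
have mw : mon a b w by rewrite -Om_mon //; right.
apply: uniq_perm; rewrite ?uniq_monl //.
  by rewrite /= uniq_monl mem_monl mon_cons ?w1 // eqxx andbF.
move=> c; rewrite inE !mem_monl; case: (eqVneq c w) => [->|cw] /=; first by rewrite mw w1.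
case: (deg c =P 1) => [c1|]; last by rewrite !andbF.
by rewrite mon_cons ?c1 // cw !andbT.
Qed.

Lemma monl_black : monl a (w :: b) 0 = monl a b 0.
Proof.
apply: eq_in_filter => c; rewrite mem_grdl => /andP[ac0 /eqP c0].
have := @mon_cons c; rewrite c0 /mon ac0 !andTb => /(_ isT) ->.
by case: (c =P w) c0 => [->|]; rewrite ?w1 ?andbT.
Qed.

Lemma count_white :
  (2 * (size (monl a (w :: b) 1)).+1 = size (monl a (w :: b) 0) + size (monl a (w :: b) 2) + 3 + D)%N.
Proof.
have := count_vertices; rewrite (perm_size monl_white) /= -monl_black.
suff -> : (\sum_(c <- grdl a 2) inside c = size (monl a (w :: b) 2) + 3)%N.
  by clear; move: (size _) (size _) (size _); lia.
rewrite -(count_shift a (w :: b) (d := 0) (j := 2) (k := 2)) ?leexx ?deg0 //.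
have e3 : (\sum_(c <- grdl a 2) \sum_i (c == (w + ebase i)%R) = 3)%N.
  rewrite exchange_big /= (eq_bigr (fun=> 1%N)) ?sum1_card ?card_ord // => i _.
  rewrite (bigD1_seq (w + ebase i)) ?uniq_grdl //= ?eqxx ?big1 // => [c /negPf -> //|].
  rewrite mem_grdl /grd degD deg_ebase w1 eqxx andbT above_add //.
  by move: Ow; rewrite Om_mon; [case/andP|right].
rewrite -[X in (_ + X)%N]e3 -big_split big_seq [RHS]big_seq; apply: eq_bigr => c ca /=.
by rewrite subr0 inside_white.
Qed.

End White.
End Count.

(** * Koszul numerics and the window of degrees *)

Lemma count_chi a b (j : int) : (forall c, deg c = j -> acyc a b c) ->
  (size (monl a b j) + 3 * size (monl a b (j - 2)) =
   3 * size (monl a b (j - 1)) + size (monl a b (j - 3)))%N.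
Proof.
move=> ac; have lee0 i : lee 0 (ebase i) by apply/leeP => k; rewrite !ffunE; case: (_ == _).
have c3 : (\sum_(c <- grdl a j) mon a b c = size (monl a b j))%N.
  rewrite -(count_shift a b (d := 0) (j := j) (k := j)) ?leexx ?deg0 ?addr0 //.
  by apply: eq_bigr => c _; rewrite subr0.
have c2 i : (\sum_(c <- grdl a j) mon a b (c - ebase i)%R = size (monl a b (j - 1)))%N.
  by rewrite -(count_shift a b (d := ebase i) (j := j - 1) (k := j)) ?deg_ebase ?subrK.
have c1 i : (\sum_(c <- grdl a j) mon a b (sub2 i c) = size (monl a b (j - 2)))%N.
  rewrite -(count_shift a b (d := ebase (i + 1) + ebase (i + 2%:R)) (j := j - 2) (k := j)).
  - by apply: eq_bigr => c _; rewrite /sub2 opprD (addrA c).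
  - exact: lee_trans (lee0 _) (lee_add (ebase (i + 1)) (i + 2%:R)).
  by rewrite degD !deg_ebase subrK.
have c0 : (\sum_(c <- grdl a j) mon a b (sub3 c) = size (monl a b (j - 3)))%N.
  rewrite -(count_shift a b (d := ebase 0 + ebase 1 + ebase 2%:R) (j := j - 3) (k := j)).
  - by apply: eq_bigr => c _; rewrite /sub3 !opprD !(addrA c).
  - apply: lee_trans (lee_add (ebase 0 + ebase 1) 2%:R).
    exact: lee_trans (lee0 _) (lee_add (ebase 0) 1).
  by rewrite !degD !deg_ebase subrK.
have -> : (3 * size (monl a b (j - 2)) = \sum_(c <- grdl a j) \sum_(i : 'I_3) mon a b (sub2 i c))%N.
  by rewrite exchange_big /= sum3 !c1; lia.
have -> : (3 * size (monl a b (j - 1)) = \sum_(c <- grdl a j) \sum_(i : 'I_3) mon a b (c - ebase i)%R)%N.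
  by rewrite exchange_big /= sum3 !c2; lia.
rewrite -c3 -c0 -!big_split /= big_seq [RHS]big_seq; apply: eq_bigr => c.
by rewrite mem_grdl => /andP[_ /eqP /ac []].
Qed.

Lemma window_of_resolution (C : numFieldType) (q : qparam C) a b d F1 F2 F3 :
  all (fun c => deg c <= 1) b -> all (above a) b ->
  mon_resolution (module q a b) a F1 F2 F3 ->
  (forall c, 1 <= deg c <= d.+1%:Z -> c \notin a) ->
  (forall c, 2 <= deg c <= d.+1%:Z -> [/\ c \notin F1, c \notin F2 & c \notin F3]) ->
  window a b d.
Proof.
move=> /allP b1 ba res na nF; split=> c cd; last by move=> ac; apply: above_sub (na _ cd).
have [n1 n2 n3] := nF c cd.
apply: (resolution_acyc res ba) n1 n2 n3 _; first by apply: na; lia.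
by apply/negP => /b1; lia.
Qed.

Lemma stable_window (C : numFieldType) (q : qparam C) a b d : (0 < d)%N ->
  all (fun c => deg c <= 1) b -> all (above a) b -> stable q a b d -> window a b d.
Proof.
move=> d0 b1 ba /(_ d0) [F1 [F2 [F3 [res nn]]]].
have nF c : 1 <= deg c <= d.+1%:Z -> [/\ c \notin a, c \notin F1, c \notin F2 & c \notin F3].
  move=> cd; have : c \notin a ++ F1 ++ F2 ++ F3.
    by apply/negP => /nn; apply; move: cd; lia.
  by rewrite !mem_cat !negb_or => /and4P[].
apply: (window_of_resolution b1 ba res) => c cd; first by case: (nF c cd).
by have [] : [/\ c \notin a, c \notin F1, c \notin F2 & c \notin F3] by apply: nF; lia.
Qed.

(** The ignored generator x^w of F_1 has degree 1, and acyclicity is only required from degree 2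
    on. *)
Lemma stablew_window (C : numFieldType) (q : qparam C) a b w d : (0 < d)%N -> deg w = 1 ->
  all (fun c => deg c <= 1) (w :: b) -> all (above a) (w :: b) -> stablew q a b w d ->
  window a (w :: b) d.
Proof.
move=> d0 w1 b1 ba /(_ d0) [F1 [F2 [F3 [res nn]]]].
have nF c : 1 <= deg c <= d.+1%:Z -> [/\ c \notin a, c \notin rem w F1, c \notin F2 & c \notin F3].
  move=> cd; have : c \notin a ++ rem w F1 ++ F2 ++ F3.
    by apply/negP => /nn; apply; move: cd; lia.
  by rewrite !mem_cat !negb_or => /and4P[].
apply: (window_of_resolution b1 ba res) => c cd; first by case: (nF c cd).
have [|_ n1 n2 n3] := nF c; first by move: cd; lia.
split=> //; apply: contra n1 => cF; have cw : c != w.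
  by apply: contraTneq cd => ->; rewrite w1.
case: (boolP (w \in F1)) => [wF|/rem_id -> //].
by move: cF; rewrite (perm_mem (perm_to_rem wF)) inE (negPf cw).
Qed.

(** * From the maps to the minimal resolution *)

Section Assembly.
Local Opaque bd1 bd2 bd3 rbd1 rbd2 rbd3 xm qmul.
Variables (C : numFieldType) (q : qparam C) (a b : seq expo) (I : nat -> Prop) (e s : seq int).
Local Notation T := (qtorus q).
Local Notation sg := (sigma q).
Variables (G : 'cV[T]_(size e)) (L : 'M[T]_(size s, size e)).
Hypothesis win : forall d, I d -> (0 < d)%N -> window a b d.
Hypothesis K0 : surjK q a b 0.
Hypothesis e01 : forall i : 'I_(size e), 0 <= e`_i <= 1.
Hypothesis s2 : forall k : 'I_(size s), s`_k = 2.
Local Notation ev f := ((f *m G) 0 0).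
Hypothesis GQ : forall i : 'I_(size e), kerQ a b e`_i (G i 0).
Hypothesis G_onto0 : forall h, kerQ a b 0 h ->
  exists2 f, fr 0 f & supp_in (above b) (h - ev f).
Hypothesis G_inj0 : forall f, fr 0 f -> supp_in (above b) (ev f) -> f = 0.
Hypothesis G_onto1 : forall d, I d -> (0 < d)%N -> forall h, kerQ a b 1 h ->
  exists2 f, fr 1 f & supp_in (above b) (h - ev f).
Hypothesis G_inj1 : forall d, I d -> (0 < d)%N ->
  forall f, fr 1 f -> supp_in (above b) (ev f) -> f = 0.
Hypothesis LG : forall k, supp_in (above b) ((L *m G) k 0).
Hypothesis L_onto : forall d, I d -> (1 < d)%N -> forall f, fr 2 f -> supp_in (above b) (ev f) ->
  exists2 h, fr 2 h & f = h *m L.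
Hypothesis L_inj : forall d, I d -> (1 < d)%N -> forall h, fr 2 h -> h *m L = 0 -> h = 0.
Hypothesis L_deg : forall (k : 'I_(size s)) (i : 'I_(size e)), supp_in (grd [:: 0] (s`_k - e`_i)) (L
  k i).

Lemma grd0P (j : int) (h : T) : supp_in (grd [:: 0] j) h <-> inA h /\ hom j h.
Proof.
rewrite /grd /above; split=> [H|[hA /homP hj] c ch]; last first.
  by rewrite /= (hA c ch) (hj c ch).
split; first by move=> c /H /andP[/=]; rewrite orbF.
by apply/homP => c /H /andP[].
Qed.

Lemma freeP f (d : int) : free (e := e) (q := q) d f <-> fr d f.
Proof. by split=> H i; apply/grd0P; apply: H. Qed.

Lemma freeP_s f (d : int) : free (e := s) (q := q) d f <-> fr d f.
Proof. by split=> H i; apply/grd0P; apply: H. Qed.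

Lemma kerKP (d : int) h : num (kerK (module q a b)) h -> hom d h -> kerQ a b d h.
Proof.
move=> [/= /spanP ha /spanP hb] /homP hd; split=> // c ch.
by rewrite /grd ha //= hd.
Qed.

Lemma min_resolution_of_maps : min_resolution I (kerK (module q a b)) e s.
Proof.
exists G, L; split=> [i|k i|k|d Id].
- have [Gg Gb] := GQ i; split; first split.
  + by apply/spanP; apply: grd_above Gg.
  + exact/spanP.
  by apply/homP => c /Gg /andP[].
- have [LA Lh] := (proj1 (grd0P _ _) (@L_deg k i)); split=> // se.
  by move: se; rewrite s2 => se; have := e01 i; rewrite -se.
- exact/spanP.
(* Stability is void in degree 0, so no window is available there and that degree is checked
   directly. *)
case: (posnP d) => [->|d0]; last first.
  have wd := win Id d0.
  have on j : (j <= 1)%N -> (j <= d)%N -> forall h, kerQ a b j h ->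
      exists2 f, fr j f & supp_in (above b) (h - ev f).
    by case: j => [|[|//]] _ _; [exact: G_onto0|exact: G_onto1 Id d0].
  have ij j f : (j <= 1)%N -> (j <= d)%N -> fr j f -> supp_in (above b) (ev f) -> f = 0.
    by case: j => [|[|//]] _ _; [exact: G_inj0|exact: G_inj1 Id d0 _].
  split.
  + move=> h hn hd; have [f fd fb] := ev_onto wd K0 on (leqnn d) (kerKP hn hd).
    by exists f; [exact/freeP|exact/spanP].
  + move=> f /freeP fd /spanP fb.
    have [h hd ->] := rel_onto wd K0 e01 GQ on ij (@L_onto d Id) (@L_inj d Id) (leqnn d) fd fb.
    by exists h => //; apply/freeP_s.
  move=> h /freeP_s hd hL.
  exact: (rel_inj wd K0 e01 s2 GQ on ij LG (@L_onto d Id) (@L_inj d Id) L_deg (leqnn d) hd hL).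
split.
- move=> h hn hd; have [f fd fb] := G_onto0 (kerKP hn hd).
  by exists f; [exact/freeP|exact/spanP].
- move=> f /freeP fd /spanP fb; exists 0; last by rewrite mul0mx (G_inj0 fd fb).
  by apply/freeP_s => i; rewrite mxE; apply: supp_in0.
by move=> h /freeP_s hd _; apply/rowP => k; rewrite mxE; apply: grd0_neg (hd k); rewrite s2.
Qed.

End Assembly.

(** * Bases of Q_1 and of the relations *)

(** [Z] collects kernel elements that are already known, such as the x_i m in Q^w_1; with no rows it
    yields a plain basis. *)
Lemma kernel_complement (F : fieldType) m n p r (Z : 'M[F]_(m, n)) (K : 'M[F]_(n, p)) :
  row_free Z -> Z *m K = 0 -> n = (\rank K + (m + r))%N ->
  exists X : 'M_(r, n), [/\ X *m K = 0, row_free (col_mx Z X) &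
    forall v : 'rV_n, v *m K = 0 -> (v <= col_mx Z X)%MS].
Proof.
move=> fZ ZK nE; have ZkK : (Z <= kermx K)%MS by apply/sub_kermxP.
have rD : \rank (kermx K :\: Z)%MS = r.
  have := mxrank_cap_compl (kermx K) Z; rewrite (capmxC _ Z) (capmx_idPl ZkK) mxrank_ker.
  by move/eqP: fZ => ->; move: nE; lia.
have [X XD] : exists X : 'M_(r, n), (X :=: kermx K :\: Z)%MS.
  by rewrite -rD; exists (row_base (kermx K :\: Z)%MS); apply: eq_row_base.
have kS : (kermx K <= col_mx Z X)%MS.
  rewrite -(addsmx_diff_cap_eq (kermx K) Z) -addsmxE addsmxC addsmxS ?capmxSr //.
  by rewrite XD.
exists X; split.
- by apply/sub_kermxP; rewrite XD diffmxSl.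
- rewrite /row_free eqn_leq rank_leq_row /=; apply: leq_trans (mxrankS kS).
  by rewrite mxrank_ker; move: nE; lia.
by move=> v vK; apply: submx_trans kS; apply/sub_kermxP.
Qed.

Section Coordinates.
Variables (C : numFieldType) (q : qparam C).
Local Notation T := (qtorus q).
Local Notation sg := (sigma q).
Local Opaque xm qmul.

Section Vec.
Variables (l : seq expo).

Definition vec (h : T) : 'rV[C]_(size l) := \row_k mcoeff l`_k h.
Definition unv (v : 'rV[C]_(size l)) : T := \sum_k v 0 k *: xm q l`_k.

Hypothesis ul : uniq l.

Lemma coef_unv v (k : 'I_(size l)) : mcoeff l`_k (unv v) = v 0 k.
Proof.
rewrite /unv coef_sum (eq_bigr (fun i => if i == k then v 0 i else 0)); last first.
  move=> i _; rewrite coefZ coef_xm nth_uniq // (inj_eq val_inj).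
  by case: (i == k); rewrite ?mulr1 ?mulr0.
by rewrite -big_mkcond big_pred1_eq.
Qed.

Lemma vec_unv v : vec (unv v) = v.
Proof. by apply/rowP => k; rewrite mxE coef_unv. Qed.

Lemma unv0 : unv 0 = 0.
Proof. by rewrite /unv big1 // => k _; rewrite mxE scale0r. Qed.

Lemma supp_unv v : supp_in (mem l) (unv v).
Proof.
apply: supp_in_sum => k _; apply: supp_inZ; apply: supp_in_xm.
by rewrite inE mem_nth.
Qed.

Lemma coef_unv_vec h c : c \in l -> mcoeff c (unv (vec h)) = mcoeff c h.
Proof.
move=> cl; have ci : (index c l < size l)%N by rewrite index_mem.
have {1 2}-> : c = l`_(Ordinal ci) by rewrite /= nth_index.
by rewrite coef_unv mxE.
Qed.

Lemma vecD h h' : vec (h + h') = vec h + vec h'.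
Proof. by apply/rowP => k; rewrite !mxE coefD. Qed.

Lemma vecN h : vec (- h) = - vec h.
Proof. by apply/rowP => k; rewrite !mxE coefN. Qed.

Lemma vecZ c h : vec (c *: h) = c *: vec h.
Proof. by apply/rowP => k; rewrite !mxE coefZ. Qed.

Lemma vec_sum (I : Type) (r : seq I) (P : pred I) F :
  vec (\sum_(i <- r | P i) F i) = \sum_(i <- r | P i) vec (F i).
Proof.
by apply/rowP => k; rewrite summxE mxE coef_sum; apply: eq_bigr => i _; rewrite mxE.
Qed.

End Vec.

Variables (a b : seq expo).

Lemma above_vec (j : int) h : supp_in (grd a j) h ->
  supp_in (above b) h <-> vec (monl a b j) h = 0.
Proof.
move=> hj; split=> H.
  apply/rowP => k; rewrite !mxE; apply/eqP; apply: contraT => /H.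
  have := mem_nth 0 (ltn_ord k); rewrite mem_monl => /andP[/andP[_ /negPf ->]].
  by [].
move=> c ch; apply: contraT => cb; have cm : c \in monl a b j.
  by rewrite mem_monl /mon cb andbT; exact: hj ch.
by move: ch; rewrite -(coef_unv_vec (uniq_monl a b j) h cm) H unv0 coef0 eqxx.
Qed.

Lemma unv_vec_mod (j : int) h : supp_in (grd a j) h ->
  supp_in (above b) (h - unv (vec (monl a b j) h)).
Proof.
move=> hj c; case: (boolP (c \in monl a b j)) => cm.
  by rewrite coefD coefN coef_unv_vec ?uniq_monl // subrr eqxx.
rewrite coefD coefN (supp_in_out (@supp_unv _ _) cm) subr0 => /hj gc.
apply: contraT => cb; move: cm; rewrite mem_monl /mon cb andbT.
by case/andP: gc => -> ->.
Qed.

Lemma grd_unv (j : int) v : supp_in (grd a j) (@unv (monl a b j) v).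
Proof.
apply: supp_inW (@supp_unv _ v) => c; rewrite inE mem_monl /mon /grd.
by case/andP => /andP[-> _] ->.
Qed.

Definition Kmx (j : int) : 'M[C]_(size (monl a b j), size (monl a b (j + 1))) :=
  \matrix_(k, i) mcoeff (monl a b (j + 1))`_i (xm q (monl a b j)`_k * sg).

Lemma vec_unv_sg (j : int) v :
  vec (monl a b (j + 1)) (@unv (monl a b j) v * sg) = v *m Kmx j.
Proof.
apply/rowP => i; rewrite [LHS]mxE [RHS]mxE /unv mulr_suml coef_sum; apply: eq_bigr => k _.
by rewrite scale_mul coefZ [X in _ = _ * X]mxE.
Qed.

Lemma vec_sg (j : int) h : supp_in (grd a j) h ->
  vec (monl a b (j + 1)) (h * sg) = vec (monl a b j) h *m Kmx j.
Proof.
move=> hj; rewrite -vec_unv_sg; apply/eqP; rewrite -subr_eq0 -vecN -vecD -mulNr -mulrDl.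
have gd : supp_in (grd a j) (h - unv (vec (monl a b j) h)).
  by apply: supp_inB hj (@grd_unv _ _).
apply/eqP/above_vec; first exact: grd_sigma gd.
exact/above_sigma/unv_vec_mod.
Qed.

Lemma kerQ_vec (j : int) h :
  kerQ a b j h <-> supp_in (grd a j) h /\ vec (monl a b j) h *m Kmx j = 0.
Proof.
split=> -[hj H]; split=> //; first by rewrite -vec_sg //; apply/above_vec; first exact: grd_sigma hj.
by apply/(above_vec (j := j + 1)); [exact: grd_sigma hj | rewrite vec_sg].
Qed.

Lemma kerQ_unv (j : int) v : v *m Kmx j = 0 -> kerQ a b j (@unv (monl a b j) v).
Proof. by move=> H; apply/kerQ_vec; rewrite vec_unv ?uniq_monl //; split=> //; apply: grd_unv. Qed.

Lemma rank_Kmx (j : int) : surjK q a b j -> \rank (Kmx j) = size (monl a b (j + 1)).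
Proof.
move=> sK; apply/eqP; rewrite -[_ == _]/(row_full _) -sub1mx; apply/row_subP => i.
have [h hj hE] := sK _ (@grd_unv (j + 1) (row i 1%:M)).
apply/submxP; exists (vec (monl a b j) h); rewrite -vec_sg //.
rewrite -{1}(@vec_unv (monl a b (j + 1)) (uniq_monl _ _ _) (row i 1%:M)).
apply/eqP; rewrite -subr_eq0 -vecN -vecD; apply/eqP/above_vec => //.
by apply: supp_inB (@grd_unv _ _) _; apply: grd_sigma hj.
Qed.

Lemma vec_comb (l : seq expo) m (x : 'rV[C]_m) (Z : 'I_m -> T) :
  vec l (\sum_i x 0 i *: Z i) = x *m \matrix_i vec l (Z i).
Proof. by rewrite vec_sum mulmx_sum_row; apply: eq_bigr => i _; rewrite vecZ rowK. Qed.

Lemma kerQ_free (j : int) m (Z : 'I_m -> T) :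
  (forall i, kerQ a b j (Z i)) ->
  (forall x : 'rV[C]_m, supp_in (above b) (\sum_i x 0 i *: Z i) -> x = 0) ->
  let Zm := \matrix_i vec (monl a b j) (Z i) in row_free Zm /\ Zm *m Kmx j = 0.
Proof.
move=> ZQ Zi Zm; split.
  rewrite -kermx_eq0; apply/eqP/row_matrixP => i.
  rewrite row0; apply: Zi; apply/(above_vec (j := j)).
    by apply: supp_in_sum => k _; apply: supp_inZ; case: (ZQ k).
  by rewrite vec_comb -row_mul mulmx_ker row0.
apply/row_matrixP => i; rewrite row0 row_mul rowK.
by have [_] := proj1 (kerQ_vec _ _) (ZQ i).
Qed.

Lemma kerQ_free_le (j : int) m (Z : 'I_m -> T) :
  (forall i, kerQ a b j (Z i)) ->
  (forall x : 'rV[C]_m, supp_in (above b) (\sum_i x 0 i *: Z i) -> x = 0) ->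
  (m + \rank (Kmx j) <= size (monl a b j))%N.
Proof.
move=> ZQ Zi; have [/eqP fZ ZK] := kerQ_free ZQ Zi.
have : (\matrix_i vec (monl a b j) (Z i) <= kermx (Kmx j))%MS by apply/sub_kermxP.
move/mxrankS; rewrite fZ mxrank_ker => H.
by have := rank_leq_row (Kmx j); move: H; clear; lia.
Qed.

Lemma kerQ_basis (j : int) m r (Z : 'I_m -> T) :
  size (monl a b j) = (\rank (Kmx j) + (m + r))%N ->
  (forall i, kerQ a b j (Z i)) ->
  (forall x : 'rV[C]_m, supp_in (above b) (\sum_i x 0 i *: Z i) -> x = 0) ->
  exists X : 'I_r -> T, [/\ forall k, kerQ a b j (X k),
    forall h, kerQ a b j h -> exists (x : 'rV[C]_m) (y : 'rV[C]_r),
      supp_in (above b) (h - (\sum_i x 0 i *: Z i + \sum_k y 0 k *: X k)) &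
    forall (x : 'rV[C]_m) (y : 'rV[C]_r),
      supp_in (above b) (\sum_i x 0 i *: Z i + \sum_k y 0 k *: X k) -> x = 0 /\ y = 0].
Proof.
move=> nE ZQ Zi; pose l := monl a b j; pose Zm := \matrix_i vec l (Z i).
have Zg i : supp_in (grd a j) (Z i) by case: (ZQ i).
have [fZ ZK] := kerQ_free ZQ Zi.
have vZ (x : 'rV[C]_m) : vec l (\sum_i x 0 i *: Z i) = x *m Zm by apply: vec_comb.
have gZ (x : 'rV[C]_m) : supp_in (grd a j) (\sum_i x 0 i *: Z i).
  by apply: supp_in_sum => i _; apply: supp_inZ.
have [X [XK fX sX]] := kernel_complement fZ ZK nE.
pose Y k := @unv l (row k X).
have YQ k : kerQ a b j (Y k) by apply: kerQ_unv; rewrite -row_mul XK row0.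
have Yg k : supp_in (grd a j) (Y k) by case: (YQ k).
have vY (y : 'rV[C]_r) : vec l (\sum_i y 0 i *: Y i) = y *m X.
  rewrite vec_sum mulmx_sum_row; apply: eq_bigr => i _.
  by rewrite vecZ vec_unv ?uniq_monl.
have gY (y : 'rV[C]_r) : supp_in (grd a j) (\sum_i y 0 i *: Y i).
  by apply: supp_in_sum => i _; apply: supp_inZ.
exists Y; split=> // [h hQ|x y H].
  have [hj hK] := proj1 (kerQ_vec _ _) hQ.
  have /submxP[u uE] := sX _ hK; exists (lsubmx u), (rsubmx u).
  apply/(above_vec (j := j)); first by apply: supp_inB hj _; apply: supp_inD.
  by rewrite vecD vecN vecD vZ vY uE -mul_row_col hsubmxK subrr.
have xy0 : row_mx x y *m col_mx Zm X = 0.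
  by rewrite mul_row_col -vZ -vY -vecD; apply/above_vec; first exact: supp_inD.
have : row_mx x y = row_mx 0 0.
  by rewrite row_mx0; apply: (row_free_inj fX); rewrite xy0 mul0mx.
by move/eq_row_mx.
Qed.

Section Relations.
Variables (e : seq int) (G : 'cV[T]_(size e)) (r : nat).
Hypotheses (GQ : forall i : 'I_(size e), kerQ a b e`_i (G i 0))
  (sK : surjK q a b 2)
  (ev_on : forall h, kerQ a b 2 h ->
    exists2 f, fr 2 f & supp_in (above b) (h - (f *m G) 0 0))
  (rE : (\sum_(i < size e) size (monl [:: 0%R] [::] (2 - e`_i)%R) + size (monl a b 3) =
         r + size (monl a b 2))%N).

Definition frmon : seq ('I_(size e) * expo) :=
  [seq (i, c) | i : 'I_(size e) <- enum 'I_(size e), c : expo <- monl [:: 0] [::] (2 - e`_i)].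
Local Notation N := (size frmon).
Local Notation P k := (tnth (in_tuple frmon) k).

Lemma uniq_frmon : uniq frmon.
Proof.
apply: allpairs_uniq_dep; first exact: enum_uniq.
  by move=> i _; apply: uniq_monl.
by move=> [i c] [i' c'] _ _ /= [-> ->].
Qed.

Lemma mem_frmon i c : ((i, c) \in frmon) = grd [:: 0] (2 - e`_i) c.
Proof.
apply/allpairsPdep/idP => [[i' [c' [_ H [-> ->]]]]|H].
  by move: H; rewrite mem_monl /mon andbT.
by exists i, c; rewrite mem_enum mem_monl /mon andbT.
Qed.

Definition vef (f : 'rV[T]_(size e)) : 'rV[C]_N := \row_k mcoeff (P k).2 (f 0 (P k).1).
Definition unf (v : 'rV[C]_N) : 'rV[T]_(size e) :=
  \row_i \sum_(k | (P k).1 == i) v 0 k *: xm q (P k).2.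

Lemma coef_unf v k : mcoeff (P k).2 (unf v 0 (P k).1) = v 0 k.
Proof.
rewrite /unf mxE coef_sum (eq_bigr (fun l => if l == k then v 0 l else 0)); last first.
  move=> l /eqP l1; rewrite coefZ coef_xm; case: (l =P k) => [->|lk].
    by rewrite eqxx mulr1.
  case: (_ =P _) => [l2|]; last by rewrite mulr0.
  case: lk; apply/val_inj/eqP; rewrite -(nth_uniq (P k) (ltn_ord l) (ltn_ord k) uniq_frmon).
  rewrite -[nth _ _ l](tnth_nth _ (in_tuple frmon)) -[nth _ _ k](tnth_nth _ (in_tuple frmon)).
  by rewrite [P l]surjective_pairing [P k]surjective_pairing l1 l2.
by rewrite (bigD1 k) //= eqxx big1 ?addr0 // => l /andP[_ /negPf ->].
Qed.

Lemma vef_unf v : vef (unf v) = v.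
Proof. by apply/rowP => k; rewrite mxE coef_unf. Qed.

Lemma fr_unf v : fr 2 (unf v).
Proof.
move=> i; rewrite mxE; apply: supp_in_sum => k /eqP ki; apply: supp_inZ; apply: supp_in_xm.
rewrite -mem_frmon -ki -surjective_pairing; exact: mem_tnth.
Qed.

Lemma vef_inj f g : fr 2 f -> fr 2 g -> vef f = vef g -> f = g.
Proof.
move=> fd gd fg; apply/rowP => i; apply: torusP => c.
case: (boolP ((i, c) \in frmon)) => [/(tnthP (in_tuple frmon))[k kE]|].
  by move/rowP: fg => /(_ k); rewrite !mxE -kE.
by rewrite mem_frmon => nc; rewrite (supp_in_out (fd i) nc) (supp_in_out (gd i) nc).
Qed.

Definition Emx : 'M[C]_(N, size (monl a b 2)) :=
  \matrix_(k, j) mcoeff (monl a b 2)`_j (xm q (P k).2 * G (P k).1 0).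

Lemma vec_ev_unf v : vec (monl a b 2) ((unf v *m G) 0 0) = v *m Emx.
Proof.
apply/rowP => j; rewrite [LHS]mxE [RHS]mxE mxE coef_sum.
rewrite (partition_big (fun k => (P k).1) xpredT) //=; apply: eq_bigr => i _.
rewrite mxE mulr_suml coef_sum; apply: eq_bigr => k /eqP ki.
by rewrite scale_mul coefZ [X in _ = _ * X]mxE ki.
Qed.

Lemma ev_grd f : fr 2 f -> supp_in (grd a 2) ((f *m G) 0 0).
Proof.
move=> fd; rewrite mxE; apply: supp_in_sum => i _.
by apply: grd_mul (fd i) (proj1 (GQ i)); rewrite subrK.
Qed.

Lemma Emx_ker : (Emx :=: kermx (Kmx 2))%MS.
Proof.
apply/eqmxP/andP; split.
  apply/sub_kermxP/row_matrixP => k; rewrite row0 row_mul rowE -vec_ev_unf.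
  rewrite -vec_sg; last exact/ev_grd/fr_unf.
  apply/above_vec; first exact/grd_sigma/ev_grd/fr_unf.
  rewrite mxE mulr_suml; apply: supp_in_sum => i _; rewrite -mulrA.
  by apply: above_mul (grd_above (@fr_unf _ i)) (proj2 (GQ i)).
apply/row_subP => i; set v := row i _.
have vK : v *m Kmx 2 = 0 by rewrite /v -row_mul mulmx_ker row0.
have [f fd fE] := ev_on (kerQ_unv vK).
apply/submxP; exists (vef f); rewrite -vec_ev_unf.
have -> : unf (vef f) = f by apply: vef_inj (@fr_unf _) fd (vef_unf _).
rewrite -{1}(@vec_unv (monl a b 2) (uniq_monl _ _ _) v).
apply/eqP; rewrite -subr_eq0 -vecN -vecD; apply/eqP/above_vec => //.
by apply: supp_inB (@grd_unv _ _) _; apply: ev_grd.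
Qed.

(** The image of the evaluation is Q_2, of dimension dim M_2 - dim M_3 since K is onto M_3; so [r]
    is the nullity, the number of relations of degree 2. *)
Lemma size_frmon : N = (\rank Emx + (0 + r))%N.
Proof.
rewrite Emx_ker mxrank_ker rank_Kmx // size_allpairs_dep sumnE big_map big_enum /=.
move: rE; have : (size (monl a b 3) <= size (monl a b 2))%N.
  by rewrite -(rank_Kmx sK) rank_leq_row.
rewrite (_ : 2 + 1 = 3 :> int) // [X in _ -> _ -> X = _](eq_bigl xpredT) //.
by move: (\sum_(i < _) _)%N (size (monl a b 3)) (size (monl a b 2)); clear; lia.
Qed.

Lemma relations_basis : exists Y : 'I_r -> 'rV[T]_(size e), [/\ forall k, fr 2 (Y k),
    forall k, supp_in (above b) ((Y k *m G) 0 0),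
    forall f, fr 2 f -> supp_in (above b) ((f *m G) 0 0) ->
      exists y : 'rV[C]_r, forall i, f 0 i = \sum_k y 0 k *: Y k 0 i &
    forall y : 'rV[C]_r, (forall i, \sum_k y 0 k *: Y k 0 i = 0) -> y = 0].
Proof.
have [||X [XE fX sX]] := kernel_complement (Z := (0 : 'M_(0, N))) _ _ size_frmon.
- by rewrite /row_free mxrank0.
- by rewrite mul0mx.
pose Y k := unf (row k X).
have vY (y : 'rV[C]_r) i : \sum_k y 0 k *: Y k 0 i = unf (y *m X) 0 i.
  rewrite [RHS]mxE (eq_bigr (fun k => \sum_(l | (P l).1 == i) (y 0 k * X k l) *: xm q (P l).2)).
    rewrite exchange_big; apply: eq_bigr => l _ /=; rewrite mxE scaler_suml.
    by apply: eq_bigr.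
  by move=> k _; rewrite mxE scaler_sumr; apply: eq_bigr => l _; rewrite scalerA mxE.
exists Y; split=> [k|k|f fd fb|y y0].
- exact: fr_unf.
- apply/(above_vec (j := 2)); first exact/ev_grd/fr_unf.
  by rewrite vec_ev_unf -row_mul XE row0.
- have ff : unf (vef f) = f by apply: vef_inj (@fr_unf _) fd (vef_unf _).
  have : (vef f <= col_mx (0 : 'M_(0, N)) X)%MS.
    by apply: sX; rewrite -vec_ev_unf ff; apply/above_vec => //; apply: ev_grd.
  move=> /submxP[u uE]; exists (rsubmx u) => i; rewrite vY -ff uE.
  by rewrite -[u in LHS]hsubmxK mul_row_col mulmx0 add0r.
have : row_mx 0 y = 0 :> 'rV[C]_(0 + r).
  apply: (row_free_inj fX); rewrite mul0mx mul_row_col mul0mx add0r.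
  rewrite -[LHS]vef_unf -[RHS]vef_unf; congr vef; apply/rowP => i; rewrite -vY y0.
  by rewrite mxE big1 // => k _; rewrite mxE scale0r.
by move=> /(congr1 (@rsubmx _ _ 0 r)); rewrite row_mxKr linear0.
Qed.

End Relations.
End Coordinates.

Section Generators.
Local Opaque bd1 bd2 bd3 rbd1 rbd2 rbd3 xm qmul.
Variables (C : numFieldType) (q : qparam C).
Local Notation T := (qtorus q).

Lemma lee0_deg0 c : lee 0 c -> deg c = 0 -> c = 0.
Proof. by move=> c0 cd; rewrite (lee_deg_eq c0) ?cd ?deg0. Qed.

Lemma grd0_const (h : T) : supp_in (grd [:: 0] 0) h -> h = mcoeff 0 h *: xm q 0.
Proof.
move=> h0; apply: torusP => c; rewrite coefZ coef_xm.
case: (0 =P c) => [<-|c0]; first by rewrite mulr1.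
rewrite mulr0 (supp_in_out h0) //; apply/negP => /andP[]; rewrite /above /= orbF => lc /eqP dc.
by apply: c0; rewrite (lee0_deg0 lc dc).
Qed.

Lemma grd0_scale (k : C) : supp_in (grd [:: 0] 0) (k *: xm q 0).
Proof.
apply: supp_inZ; apply: supp_in_xm.
by rewrite /grd /above /= leexx deg0.
Qed.

Lemma scale1_mul (k : C) (h : T) : (k *: xm q 0) * h = k *: h.
Proof. by rewrite scale_mul; congr (_ *: _); apply: mul1r. Qed.

Variables (a b : seq expo) (I : nat -> Prop) (e s : seq int).
Variables (G : 'cV[T]_(size e)).
Hypothesis win : forall d, I d -> (0 < d)%N -> window a b d.
Hypothesis K0 : surjK q a b 0.
Hypothesis e01 : forall i : 'I_(size e), 0 <= e`_i <= 1.
Hypothesis s2 : forall k : 'I_(size s), s`_k = 2.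
Local Notation ev f := ((f *m G) 0 0).
Hypothesis GQ : forall i : 'I_(size e), kerQ a b e`_i (G i 0).
Hypothesis G_onto0 : forall h, kerQ a b 0 h ->
  exists2 f, fr 0 f & supp_in (above b) (h - ev f).
Hypothesis G_inj0 : forall f, fr 0 f -> supp_in (above b) (ev f) -> f = 0.
Hypothesis G_onto1 : forall d, I d -> (0 < d)%N -> forall h, kerQ a b 1 h ->
  exists2 f, fr 1 f & supp_in (above b) (h - ev f).
Hypothesis G_inj1 : forall d, I d -> (0 < d)%N ->
  forall f, fr 1 f -> supp_in (above b) (ev f) -> f = 0.
Hypothesis count2 : forall d, I d -> (1 < d)%N ->
  (\sum_(i < size e) size (monl [:: 0%R] [::] (2 - e`_i)%R) + size (monl a b 3) =
   size s + size (monl a b 2))%N.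

Lemma resolution_of_generators : min_resolution I (kerK (module q a b)) e s.
Proof.
(* If no degree beyond 1 is asked for, the relations are invisible and the zero matrix serves. *)
case: (pselect (exists2 d, I d & (1 < d)%N)) => [[d Id d1]|no]; last first.
  apply: (min_resolution_of_maps (G := G) (L := 0)) => //.
  - by move=> k; rewrite mul0mx mxE; apply: supp_in0.
  - by move=> d Id d1; case: no; exists d.
  - by move=> d Id d1; case: no; exists d.
  by move=> k i; rewrite mxE; apply: supp_in0.
have d0 : (0 < d)%N by apply: ltn_trans d1.
have wd := win Id d0; have sK : surjK q a b 2 by apply: (surjK_le wd K0 (j := 2)).
have on j : (j <= 1)%N -> (j <= d)%N -> forall h, kerQ a b j h ->
    exists2 f, fr j f & supp_in (above b) (h - ev f).
  by case: j => [|[|//]] _ _; [exact: G_onto0|exact: G_onto1 Id d0].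
have [Y [Y2 YG Yon Yin]] := relations_basis GQ sK (fun h => ev_onto wd K0 on d1 (h := h)) (count2 Id d1).
pose L : 'M[T]_(size s, size e) := \matrix_(k, i) Y k 0 i.
have mL (y : 'rV[C]_(size s)) (h : 'rV[T]_(size s)) i :
    (forall k, h 0 k = y 0 k *: xm q 0) -> (h *m L) 0 i = \sum_k y 0 k *: Y k 0 i.
  by move=> hy; rewrite mxE; apply: eq_bigr => k _; rewrite hy scale1_mul mxE.
have hy (h : 'rV[T]_(size s)) : fr 2 h -> forall k, h 0 k = mcoeff 0 (h 0 k) *: xm q 0.
  by move=> h2 k; apply: grd0_const; move: (h2 k); rewrite s2.
apply: (min_resolution_of_maps (G := G) (L := L)) => //.
- move=> k; have := YG k; congr (supp_in _ _); rewrite [LHS]mxE [RHS]mxE.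
  by apply: eq_bigr => i _; rewrite [X in _ = X * _]mxE.
- move=> _ _ _ f f2 fb; have [y yE] := Yon f f2 fb.
  exists (\row_k (y 0 k *: xm q 0)); last first.
    by apply/rowP => i; rewrite yE (mL y) // => k; rewrite mxE.
  by move=> k; rewrite mxE s2; apply: grd0_scale.
- move=> _ _ _ h h2 hL; pose y : 'rV[C]_(size s) := \row_k mcoeff 0 (h 0 k).
  have hyE k : h 0 k = y 0 k *: xm q 0 by rewrite mxE; apply: hy.
  have y0 : y = 0 by apply: Yin => i; rewrite -(mL y h i hyE) hL mxE.
  by apply/rowP => k; rewrite hyE y0 !mxE scale0r.
by move=> k i; rewrite mxE s2; apply: Y2.
Qed.

End Generators.

Lemma lee0_deg1 c : lee 0 c -> deg c = 1 -> exists i, c = ebase i.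
Proof.
move=> c0 c1; have [|i ci] := lee_lt c0; first by apply/eqP => e0; move: c1; rewrite -e0 deg0.
exists i; apply/eqP; rewrite -subr_eq0; apply/eqP/lee0_deg0 => //.
by rewrite degB deg_ebase c1.
Qed.

Lemma monl_neg (j : int) : j < 0 -> monl [:: 0] [::] j = [::].
Proof.
move=> j0; apply: size0nil; apply/eqP; rewrite size_eq0; apply: contraT.
case E: (monl _ _ _) => [//|c l] _; have : c \in monl [:: 0] [::] j by rewrite E mem_head.
rewrite mem_monl /mon /above /= orbF => /andP[/andP[/lee_deg]].
by rewrite deg0 => ? _ /eqP ?; lia.
Qed.

(** [count_chi] applied to A itself reduces degrees 1 and 2 to degree 0. *)
Lemma size_monl_free : (size (monl [:: 0%R] [::] 0) = 1)%N /\
  (size (monl [:: 0%R] [::] 1) = 3)%N /\ (size (monl [:: 0%R] [::] 2) = 6)%N.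
Proof.
have s0 : (size (monl [:: 0%R] [::] 0) = 1)%N.
  rewrite -[1%N]/(size [:: (0 : expo)]); apply/perm_size/uniq_perm; rewrite ?uniq_monl //.
  move=> c; rewrite inE mem_monl /mon /above /= orbF andbT; apply/andP/eqP => [[c0 /eqP cd]|->].
    exact: lee0_deg0.
  by rewrite leexx deg0.
have nil0 : size (@nil expo) = 0%N by [].
have := @count_chi [:: 0] [::] 1 (fun c c1 => acyc_free (eq_ind_r (fun x => 1 <= x) (lexx 1) c1)).
rewrite (_ : 1 - 1 = 0 :> int) // [monl _ _ (1 - 2)]monl_neg // [monl _ _ (1 - 3)]monl_neg // s0
  nil0 => s1.
have ac2 c : deg c = 2 -> acyc [:: 0] [::] c by move=> c2; apply: acyc_free; rewrite c2.
have := count_chi ac2; rewrite (_ : 2 - 2 = 0 :> int) // (_ : 2 - 1 = 1 :> int) // [monl _ _ (2 -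
  3)]monl_neg // s0 nil0.
by move: s1; clear; move: (size _) (size _); lia.
Qed.

Lemma nth_constant (x : int) n (i : 'I_(size (nseq n x))) : (nseq n x)`_i = x.
Proof.
have : (i < n)%N by apply: leq_trans (ltn_ord i) _; rewrite size_nseq.
by rewrite nth_nseq => ->.
Qed.

Lemma mulmx_row_col (R : pzRingType) n (f : 'rV[R]_n.+1) (G : 'cV_n.+1) :
  (f *m G) 0 0 = f 0 ord0 * G ord0 0 + \sum_k f 0 (lift ord0 k) * G (lift ord0 k) 0.
Proof. by rewrite mxE big_ord_recl. Qed.

(** * The two numerical cases: Q_0 zero, and Q_0 a line *)

Section Cases.
Local Opaque bd1 bd2 bd3 rbd1 rbd2 rbd3 xm qmul.
Variables (C : numFieldType) (q : qparam C).
Local Notation T := (qtorus q).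

Lemma grd1_lin (h : T) : supp_in (grd [:: 0] 1) h ->
  h = \sum_i mcoeff (ebase i) h *: xm q (ebase i).
Proof.
move=> h1; apply: torusP => c; rewrite coef_sum.
rewrite (eq_bigr (fun i => mcoeff c h * (ebase i == c)%:R)) => [|i _]; last first.
  by rewrite coefZ coef_xm; case: (_ =P c) => [->//|_]; rewrite !mulr0.
rewrite -mulr_sumr; case: (boolP (grd [:: 0] 1 c)) => [/andP[]|nc]; last first.
  by rewrite (supp_in_out h1 nc) mul0r.
rewrite /above /= orbF => c0 /eqP /(lee0_deg1 c0)[i ->].
rewrite (bigD1 i) //= eqxx big1 ?addr0 ?mulr1 // => j ji.
by rewrite (inj_eq ebase_inj) (negPf ji).
Qed.

Variables (a b : seq expo) (I : nat -> Prop) (D : nat).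
Local Notation N j := (size (monl a b j)).
Hypothesis win : forall d, I d -> (0 < d)%N -> window a b d.
Hypothesis K0 : surjK q a b 0.
Hypothesis count2 : forall d, I d -> (1 < d)%N -> (N 3 + 3 * N 1 = 3 * N 2 + N 0)%N.

Lemma rank_Kmx1 d : I d -> (0 < d)%N -> \rank (Kmx q a b 1) = N 2.
Proof. by move=> Id d0; have := rank_Kmx (surjK_le (win Id d0) K0 d0). Qed.

Lemma resolution_injective :
  (forall h, kerQ (q := q) a b 0 h -> supp_in (above b) h) ->
  N 0 = N 1 -> (forall d, I d -> (0 < d)%N -> N 1 = (N 2 + D)%N) ->
  min_resolution I (kerK (module q a b)) (nseq D 1) (nseq D 2).
Proof.
move=> inj0 N01 N12.
have [G [GQ [Gon Gin]]] : exists G : 'cV[T]_(size (nseq D (1 : int))),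
  (forall i, kerQ a b 1 (G i 0)) /\
  (forall d, I d -> (0 < d)%N -> forall h : T, kerQ a b 1 h ->
     exists y : 'rV[C]_(size (nseq D (1 : int))), supp_in (above b) (h - \sum_k y 0 k *: G k 0)) /\
  (forall d, I d -> (0 < d)%N -> forall y : 'rV[C]_(size (nseq D (1 : int))),
     supp_in (above b) (\sum_k y 0 k *: G k 0) -> y = 0).
  (* If the range does not reach degree 1, nothing is known about Q_1 and nothing is claimed, so
     zero generators are acceptable. *)
  case: (pselect (exists2 d, I d & (0 < d)%N)) => [[d Id d0]|no]; last first.
    exists 0; split; first by move=> i; rewrite mxE; split; rewrite ?mul0r; apply: supp_in0.
    by split=> d Id d0; case: no; exists d.
  have [|||X [XQ Xon Xin]] := @kerQ_basis C q a b 1 0 (size (nseq D (1 : int))) (fun=> 0).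
  - by rewrite (rank_Kmx1 Id d0) (N12 d Id d0) size_nseq.
  - by case.
  - by move=> x _; apply/rowP => -[].
  exists (\col_i X i); split; first by move=> i; rewrite mxE.
  have S y : \sum_k y 0 k *: (\col_i X i) k 0 = \sum_(i < 0) (0 : 'rV[C]_0) 0 i *: (0 : T) + \sum_k
    y 0 k *: X k.
    by rewrite big_ord0 add0r; apply: eq_bigr => k _; rewrite mxE.
  split=> _ _ _.
    move=> h /Xon[x [y H]]; exists y; rewrite S.
    by move: H; rewrite !big_ord0.
  by move=> y; rewrite S => /Xin [].
have fc (f : 'rV[T]_(size (nseq D (1 : int)))) : fr 1 f -> forall k, f 0 k = mcoeff 0 (f 0 k) *: xm q 0.
  by move=> f1 k; apply: grd0_const; move: (f1 k); rewrite nth_constant.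
have evE (y : 'rV[C]_(size (nseq D (1 : int)))) (f : 'rV[T]_(size (nseq D (1 : int)))) :
    (forall k, f 0 k = y 0 k *: xm q 0) -> (f *m G) 0 0 = \sum_k y 0 k *: G k 0.
  by move=> fy; rewrite mxE; apply: eq_bigr => k _; rewrite fy scale1_mul.
have f0 f : fr 0 f -> f = 0 :> 'rV[T]_(size (nseq D (1 : int))).
  by move=> f0; apply/rowP => i; rewrite [RHS]mxE; apply: grd0_neg (f0 i); rewrite nth_constant.
apply: (resolution_of_generators (G := G)) => //.
- by move=> i; rewrite nth_constant.
- exact: nth_constant.
- by move=> i; rewrite nth_constant.
- move=> h /inj0 hb; exists 0; first by move=> i; rewrite mxE; apply: supp_in0.
  by rewrite mul0mx mx0E subr0.
- by move=> f /f0.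
- move=> d Id d0 h /(Gon d Id d0)[y yE]; exists (\row_k (y 0 k *: xm q 0)).
    by move=> k; rewrite mxE nth_constant; apply: grd0_scale.
  by rewrite (evE y) // => k; rewrite mxE.
- move=> d Id d0 f f1; rewrite (evE (\row_k mcoeff 0 (f 0 k))) => [/(Gin d Id d0) y0|k]; last first.
    by rewrite mxE; apply: fc.
  apply/rowP => k; rewrite fc // [RHS]mxE; move/rowP: y0 => /(_ k); rewrite !mxE => ->.
  exact: scale0r.
move=> d Id d1; rewrite (eq_bigr (fun=> 3%N)) => [|i _]; last first.
  by rewrite nth_constant; case: size_monl_free => _ [].
rewrite sum_nat_const card_ord !size_nseq.
by have := count2 Id d1; have := N12 d Id (ltnW d1); lia.
Qed.

Lemma resolution_one (m0 : T) : kerQ a b 0 m0 ->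
  (forall h : T, kerQ a b 0 h -> exists k, supp_in (above b) (h - k *: m0)) ->
  (forall k, supp_in (above b) (k *: m0) -> k = 0) ->
  (forall d, I d -> (0 < d)%N -> forall k : 'I_3 -> C,
     supp_in (above b) (\sum_i k i *: (xm q (ebase i) * m0)) -> forall i, k i = 0) ->
  N 0 = (N 1).+1 -> (forall d, I d -> (0 < d)%N -> N 1 = (N 2 + D + 2)%N) ->
  min_resolution I (kerK (module q a b)) (0 :: nseq D.-1 1) (nseq D 2).
Proof.
move=> mQ mon_ min_ sweep N01 N12; set n := D.-1.
have xQ i : kerQ a b 1 (xm q (ebase i) * m0).
  case: mQ => m0g m0b; split; first exact: grd_xe m0g.
  by rewrite -mulrA; apply: above_xe.
have xfree d : I d -> (0 < d)%N -> forall x : 'rV[C]_3,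
    supp_in (above b) (\sum_i x 0 i *: (xm q (ebase i) * m0)) -> x = 0.
  by move=> Id d0 x /(sweep d Id d0 (fun i => x 0 i)) x0; apply/rowP => i; rewrite x0 mxE.
(* The three independent elements x_i m0 give 3 <= dim Q_1 = D + 2, so D is positive and [D.-1] is a
   true predecessor. *)
have nE d : I d -> (0 < d)%N -> n.+1 = D.
  move=> Id d0; rewrite prednK //.
  by have := kerQ_free_le xQ (xfree d Id d0); rewrite (rank_Kmx1 Id d0) (N12 d Id d0); lia.
have [X [XQ [Xon Xin]]] : exists X : 'I_(size (nseq n (1 : int))) -> T,
  (forall i, kerQ a b 1 (X i)) /\
  (forall d, I d -> (0 < d)%N -> forall h : T, kerQ a b 1 h ->
     exists (x : 'I_3 -> C) (y : 'I_(size (nseq n (1 : int))) -> C),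
       supp_in (above b) (h - (\sum_i x i *: (xm q (ebase i) * m0) + \sum_k y k *: X k))) /\
  (forall d, I d -> (0 < d)%N -> forall (x : 'I_3 -> C) (y : 'I_(size (nseq n (1 : int))) -> C),
     supp_in (above b) (\sum_i x i *: (xm q (ebase i) * m0) + \sum_k y k *: X k) ->
     (forall i, x i = 0) /\ forall k, y k = 0).
  case: (pselect (exists2 d, I d & (0 < d)%N)) => [[d Id d0]|no]; last first.
    exists (fun=> 0); split; first by move=> i; split; rewrite ?mul0r; apply: supp_in0.
    by split=> d Id d0; case: no; exists d.
  have [|X [XQ Xon Xin]] := @kerQ_basis C q a b 1 3 (size (nseq n (1 : int))) (fun i => xm q (ebase
    i) * m0) _ xQ (xfree d Id d0).
    by rewrite (rank_Kmx1 Id d0) (N12 d Id d0) size_nseq; have := nE d Id d0; lia.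
  exists X; split=> //; split=> _ _ _.
    by move=> h /Xon[x [y H]]; exists (fun i => x 0 i), (fun k => y 0 k).
  move=> x y H; have [|x0 y0] := Xin (\row_i x i) (\row_k y k).
    rewrite (eq_bigr (fun i => x i *: (xm q (ebase i) * m0))) => [|i _]; last by rewrite [X in X *:
      _]mxE.
    by rewrite [X in _ + X](eq_bigr (fun k => y k *: X k)) => [//|k _]; rewrite [X in X *: _]mxE.
  split=> i; [move/rowP: x0|move/rowP: y0]; by move=> /(_ i); rewrite !mxE.
set e := (0 : int) :: nseq n 1; pose G : 'cV[T]_(size e) := \col_i oapp X m0 (unlift ord0 i).
have G0 : G ord0 0 = m0 by rewrite mxE unlift_none.
have Gk k : G (lift ord0 k) 0 = X k by rewrite mxE liftK.
have evE (f : 'rV[T]_(size e)) :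
    (f *m G) 0 0 = f 0 ord0 * m0 + \sum_k f 0 (lift ord0 k) * X k.
  apply: etrans (@mulmx_row_col T (size (nseq n (1 : int))) f G) _.
  rewrite G0 (eq_bigr (fun k => f 0 (lift ord0 k) * X k)); first reflexivity.
  by move=> k _; rewrite Gk.
have e0 : e`_(ord0 : 'I_(size e)) = 0 by [].
have e1 (k : 'I_(size (nseq n (1 : int)))) : e`_(lift ord0 k) = 1 by rewrite /= nth_constant.
have cs (P : 'I_(size e) -> Prop) : P ord0 -> (forall k, P (lift ord0 k)) -> forall i, P i.
  by move=> P0 P1 i; case: (unliftP ord0 i) => [k ->|->].
apply: (@resolution_of_generators C q a b I e (nseq D 2) G win K0).
- by case=> -[//|k] ki /=; rewrite nth_nseq; case: ifP.
- exact: nth_constant.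
- by apply: cs => [|k]; [rewrite G0; exact: mQ|rewrite Gk e1; exact: XQ].
- move=> h /mon_[k kE]; exists (\row_i (if unlift ord0 i is None then k *: xm q 0 else 0)).
    apply: cs => [|i]; [rewrite mxE unlift_none|rewrite mxE liftK; exact: supp_in0].
    exact: grd0_scale.
  rewrite evE mxE unlift_none scale1_mul big1 ?addr0 // => i _.
  by rewrite mxE liftK mul0r.
- move=> f f0; have f1 k : f 0 (lift ord0 k) = 0.
    by apply: grd0_neg (f0 _); rewrite e1.
  have fE : f 0 ord0 = mcoeff 0 (f 0 ord0) *: xm q 0 by apply: grd0_const; apply: (f0 ord0).
  rewrite evE big1 ?addr0 => [|k _]; last by rewrite f1 mul0r.
  rewrite fE scale1_mul => /min_ k0; apply/rowP; apply: cs => [|k]; rewrite [RHS]mxE //.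
  by rewrite fE k0 scale0r.
- move=> d Id d0 h /(Xon d Id d0)[x [y xyE]].
  exists (\row_i (if unlift ord0 i is Some k then y k *: xm q 0 else \sum_j x j *: xm q (ebase j))).
    apply: cs => [|i]; [rewrite mxE unlift_none|rewrite mxE liftK].
      apply: supp_in_sum => j _; apply: supp_inZ; apply: supp_in_xm.
      rewrite /grd /above /= orbF deg_ebase eqxx andbT.
      by apply/leeP => l; rewrite !ffunE; case: (_ == _).
    by rewrite e1; apply: grd0_scale.
  move: xyE; congr (supp_in _ (_ - _)); rewrite evE mxE unlift_none mulr_suml; congr (_ + _).
    by apply: eq_bigr => j _; rewrite scale_mul.
  by apply: eq_bigr => k _; rewrite mxE liftK scale1_mul.
- move=> d Id d0 f f1; rewrite evE => H.
  have f1E k : f 0 (lift ord0 k) = mcoeff 0 (f 0 (lift ord0 k)) *: xm q 0.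
    by apply: grd0_const; move: (f1 (lift ord0 k)); rewrite e1.
  have f0E := grd1_lin (f1 ord0).
  have [|x0 y0] := Xin d Id d0 (fun i => mcoeff (ebase i) (f 0 ord0))
     (fun k => mcoeff 0 (f 0 (lift ord0 k))).
    move: H; rewrite {1}f0E mulr_suml.
    rewrite (eq_bigr (fun i => mcoeff (ebase i) (f 0 ord0) *: (xm q (ebase i) * m0))) => [|j _].
      rewrite [X in _ + X](eq_bigr (fun k => mcoeff 0 (f 0 (lift ord0 k)) *: X k)) => [//|k _].
      by rewrite {1}f1E scale1_mul.
    by rewrite scale_mul.
  apply/rowP; apply: cs => [|k]; rewrite [RHS]mxE.
    by rewrite f0E big1 // => j _; rewrite x0 scale0r.
  by rewrite f1E y0 scale0r.
move=> d Id d1; rewrite big_ord_recl e0 (eq_bigr (fun=> 3%N)) => [|i _]; last first.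
  by rewrite e1; case: size_monl_free => _ [].
have cn : #|'I_(size (nseq n (1 : int)))| = n by rewrite card_ord size_nseq.
rewrite sum_nat_const [X in (_ + X * _ + _)%N]cn size_nseq; case: size_monl_free => _ [_ ->].
by have := count2 Id d1; have := N12 d Id (ltnW d1); have := nE d Id (ltnW d1); lia.
Qed.

End Cases.

(** * The tiling of maximal volume *)

Section Tilings.
Variables (Bk Wh : seq expo).
Hypotheses (uBk : uniq Bk) (uWh : uniq Wh).
Hypothesis (dBk : forall v, v \in Bk -> deg v = 0).

Definition tiling (t : expo -> 'I_3) : bool :=
  perm_eq [seq v + ebase (t v) | v <- Bk] Wh.

(* The height of one tiling relative to another sums to the difference of their
   values of vol. *)
Definition vol (t : expo -> 'I_3) : int := \sum_(v <- Bk) (t v == 0)%:R * v 1.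

Lemma tiling_sum t (F : expo -> int) : tiling t ->
  \sum_(v <- Bk) F (v + ebase (t v)) = \sum_(u <- Wh) F u.
Proof. by move=> /(perm_big _) <-; rewrite big_map. Qed.

Lemma tiling_mem t v : tiling t -> v \in Bk -> v + ebase (t v) \in Wh.
Proof. by move=> /perm_mem <- vB; apply/mapP; exists v. Qed.

Lemma tiling_inj t v v' : tiling t -> v \in Bk -> v' \in Bk ->
  v + ebase (t v) = v' + ebase (t v') -> v = v'.
Proof.
move=> tt vB vB' e; have um : uniq [seq v + ebase (t v) | v <- Bk] by rewrite (perm_uniq tt).
have /eqP ij : index v Bk == index v' Bk.
  rewrite -(nth_uniq v _ _ um) ?size_map ?index_mem //.
  by rewrite !(nth_map v) ?index_mem // !nth_index // e.
by rewrite -(nth_index v vB) ij nth_index.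
Qed.

Lemma deg0_coord (v w : expo) : deg v = deg w -> v 0 = w 0 -> v 1 = w 1 -> v = w.
Proof.
rewrite /deg !sum3 => e e0 e1; apply/ffunP; elim/ord3_ind => //.
by move: e; rewrite e0 e1 => /addrI.
Qed.

Section Height.
Variables (t t' : expo -> 'I_3).
Hypotheses (tt : tiling t) (tt' : tiling t').

(** The difference of two perfect matchings: a flow without divergence at black triangles
    ([flow_sum]) and at white ones ([flow_white]), hence the flux of a height function. *)
Definition flow (v : expo) (k : 'I_3) : int := (t v == k)%:R - (t' v == k)%:R.

(* The height of t relative to t' at the lattice vertices z with (z 0, z 1) = (x, y). *)
Definition hgt (x y : int) : int :=
  \sum_(v <- Bk | (v 0 == x - 1) && (y <= v 1)) flow v 0.

Definition hgtv (z : expo) : int := hgt (z 0) (z 1).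

Lemma flow_sum v : \sum_k flow v k = 0.
Proof.
rewrite sumrB (bigD1 (t v)) //= eqxx big1 => [|k kt]; last by rewrite eq_sym (negPf kt).
rewrite (bigD1 (t' v)) //= eqxx big1 => [|k kt]; last by rewrite eq_sym (negPf kt).
by rewrite subrr.
Qed.

Lemma flow_white (F : expo -> int) :
  \sum_(v <- Bk) \sum_k flow v k * F (v + ebase k) = 0.
Proof.
have E s : tiling s -> \sum_(v <- Bk) \sum_k (s v == k)%:R * F (v + ebase k) = \sum_(u <- Wh) F u.
  move=> /tiling_sum <-; apply: eq_bigr => v _.
  rewrite (bigD1 (s v)) //= eqxx mul1r big1 ?addr0 // => k ks.
  by rewrite eq_sym (negPf ks) mul0r.
rewrite -[RHS](subrr (\sum_(u <- Wh) F u)) -{1}(E t) // -(E t') // -sumrB.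
apply: eq_bigr => v _; rewrite -sumrB; apply: eq_bigr => k _.
by rewrite /flow mulrBl.
Qed.

Lemma sum_at0 (F : expo -> int) (x y : int) :
  ~~ has (fun v : expo => (v 0 == x) && (v 1 == y)) Bk ->
  \sum_(v <- Bk | (v 0 == x) && (v 1 == y)) F v = 0.
Proof. by move=> /hasPn none; rewrite big_seq_cond big1 // => v /andP[/none /negPf ->]. Qed.

Lemma sum_atv (F : expo -> int) v : v \in Bk ->
  \sum_(v' <- Bk | (v' 0 == v 0) && (v' 1 == v 1)) F v' = F v.
Proof.
move=> vB; rewrite big_mkcond (bigD1_seq v) //= !eqxx /= big_seq_cond big1 ?addr0 //.
move=> w /andP[wB wv]; case: ifP => // /andP[/eqP w0 /eqP w1]; case/eqP: wv.
by apply: deg0_coord; rewrite // !dBk.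
Qed.

Lemma hgt_step0 x y :
  hgt x y - hgt x (y + 1) = \sum_(v <- Bk | (v 0 == x - 1) && (v 1 == y)) flow v 0.
Proof.
clear tt tt'; rewrite /hgt !(big_mkcond (fun v : expo => _ && _)) /= -sumrB.
apply: eq_bigr => v _.
case: (v 0 == x - 1) => //=.
have -> : (y <= v 1) = (v 1 == y) || (y + 1 <= v 1) by lia.
case: eqP => [->|_] /=; last by rewrite subrr.
have -> : (y + 1 <= y) = false by lia.
by rewrite subr0.
Qed.

(** Conservation over the white triangles of the half-column u 0 = x, u 1 >= y, minus conservation
    over its black triangles: all flow inside cancels, leaving the two lateral sides, which are
    heights, and the end of the half-column. *)
Lemma hgt_step1 x y :
  hgt (x + 1) y - hgt x y = \sum_(v <- Bk | (v 0 == x) && (v 1 == y - 1)) flow v 1.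
Proof.
have := flow_white (fun u => ((u 0 == x) && (y <= u 1))%:R).
have : \sum_(v <- Bk) (\sum_k flow v k) * ((v 0 == x) && (y <= v 1))%:R = 0.
  by rewrite big1 // => v _; rewrite flow_sum mul0r.
move=> e1 e2; apply/eqP; rewrite -subr_eq0; apply/eqP.
rewrite -[LHS]subr0 -[X in _ - X = _]e1 -[LHS]addr0 -[X in _ + X = _]e2.
rewrite /hgt !(big_mkcond (fun v : expo => _ && _)) /=.
rewrite -!sumrB -big_split big1 //= => v _.
rewrite !sum3 !ffunE /=; move: (flow v 0) (flow v 1) (flow v 2%:R) (v 0) (v 1) => f0 f1 f2 v0 v1.
rewrite !addr0 !addrK.
have -> : (v0 == x - 1) = (v0 + 1 == x) by lia.
have -> : (y <= v1 + 1) = (v1 == y - 1) || (y <= v1) by lia.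
have -> : (v1 == y - 1) = (v1 == y - 1) && ~~ (y <= v1) by lia.
by case: (v0 == x); case: (v0 + 1 == x); case: (v1 == y - 1); case: (y <= v1) => //=; lia.
Qed.

Lemma flow_hgtv v k : v \in Bk ->
  flow v k = hgtv (v + ebase (k + 2%:R) + ebase k) - hgtv (v + ebase k + ebase (k + 1)).
Proof.
move=> vB; have F0 : flow v 0 = hgt (v 0 + 1) (v 1) - hgt (v 0 + 1) (v 1 + 1).
  by rewrite hgt_step0 addrK (sum_atv (fun v => flow v 0)).
have F1 : flow v 1 = hgt (v 0 + 1) (v 1 + 1) - hgt (v 0) (v 1 + 1).
  by rewrite hgt_step1 addrK (sum_atv (fun v => flow v 1)).
have F2 : flow v 2%:R = hgt (v 0) (v 1 + 1) - hgt (v 0 + 1) (v 1).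
  by have := flow_sum v; rewrite sum3 F0 F1; lia.
by elim/ord3_ind: k; rewrite ?F0 ?F1 ?F2 /hgtv !ord3_val !ffunE /= ?addr0.
Qed.

(** Black triangles with a corner of positive height. Following t there and t' elsewhere gives the
    tiling of relative height max(h, 0), the join in the lattice of tilings. *)
Definition posv (v : expo) : bool :=
  [|| 0 < hgtv (v + ebase 0 + ebase 1), 0 < hgtv (v + ebase 1 + ebase 2%:R)
    | 0 < hgtv (v + ebase 2%:R + ebase 0)].

Definition join_tiling (v : expo) : 'I_3 := if posv v then t v else t' v.

Lemma posvE (k : 'I_3) v :
  posv v = [|| 0 < hgtv (v + ebase k + ebase (k + 1)),
    0 < hgtv (v + ebase (k + 1) + ebase (k + 2%:R)) | 0 < hgtv (v + ebase (k + 2%:R) + ebase k)].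
Proof.
rewrite /posv; elim/ord3_ind: k; rewrite ?ord3_val //.
  by rewrite orbC -orbA.
by rewrite orbA orbC.
Qed.

(** Suppose rhombi over v (from t) and w (from t') shared the white triangle u. The height then
    drops by one across the edge of v, starting from a corner of u that must be positive. Either
    this corner belongs to w, or the drop across the edge of w carries the same value to a corner of
    w; but w has no positive corner. *)
Lemma join_inj_aux v w : v \in Bk -> w \in Bk -> posv v -> ~~ posv w ->
  v + ebase (t v) = w + ebase (t' w) -> v = w.
Proof.
move=> vB wB pv pw e; apply/eqP; apply: contraT => vw.
set a := t v in e; set b := t' w in e; set u := v + ebase a in e.
have ab : a != b by apply: contra vw => /eqP ab; move/eqP: e; rewrite /u ab => /eqP /addIr ->.
have ta : t' v != a.
  by apply: contra vw => /eqP ta; apply/eqP; apply: (tiling_inj tt' vB wB); rewrite ta.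
have tb : t w != b.
  by apply: contra vw => /eqP tb; apply/eqP; apply: (tiling_inj tt vB wB); rewrite tb -e.
pose p i := hgtv (u + ebase i).
have pE1 : hgtv (v + ebase (a + 2%:R) + ebase a) = p (a + 2%:R) by rewrite /p /u addrAC.
have pE2 : hgtv (v + ebase a + ebase (a + 1)) = p (a + 1) by [].
have pE3 : hgtv (w + ebase (b + 2%:R) + ebase b) = p (b + 2%:R) by rewrite /p e addrAC.
have pE4 : hgtv (w + ebase b + ebase (b + 1)) = p (b + 1) by rewrite /p e.
have f1 : flow v a = 1 by rewrite /flow eqxx (negPf ta).
have f2 : flow w b = -1 by rewrite /flow eqxx (negPf tb).
have g1 := flow_hgtv a vB; rewrite f1 pE1 pE2 in g1.
have g2 := flow_hgtv b wB; rewrite f2 pE3 pE4 in g2.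
move: pw; rewrite (posvE b) pE3 pE4 !negb_or => /and3P[n1 _ n2].
have q1 := flow_hgtv (a + 1) vB; have q2 := flow_hgtv (a + 2%:R) vB.
rewrite !ord3E in q1 q2.
have z1 : flow v (a + 1) = - (t' v == a + 1)%:R.
  by rewrite /flow -/a [a == _](_ : _ = false) ?sub0r //; elim/ord3_ind: (a).
have z2 : flow v (a + 2%:R) = - (t' v == a + 2%:R)%:R.
  by rewrite /flow -/a [a == _](_ : _ = false) ?sub0r //; elim/ord3_ind: (a).
move: pv; rewrite (posvE a) pE1 pE2 => pv.
have pa : 0 < p (a + 2%:R).
  move: q2 pv; rewrite pE1 z2 => q2 pv; move: q2 pv g1.
  move: (hgtv (v + ebase (a + 1) + ebase (a + 2%:R))) (p (a + 2%:R)) (p (a + 1)).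
  by clear=> x y z; case: (t' v == a + 2%:R) => /=; lia.
have /orP[/eqP bE|/eqP bE] : (b == a + 1) || (b == a + 2%:R).
- by move: (a) (b) ab; clear; elim/ord3_ind; elim/ord3_ind.
- by move: n1; rewrite bE !ord3E pa.
move: n1 n2 g2 g1 pa; rewrite bE !ord3E.
by move: (p a) (p (a + 1)) (p (a + 2%:R)); clear=> x y z; lia.
Qed.

Lemma join_tilingP : tiling join_tiling.
Proof.
have jW v : v \in Bk -> v + ebase (join_tiling v) \in Wh.
  by move=> vB; rewrite /join_tiling; case: (posv v); apply: tiling_mem.
have uj : uniq [seq v + ebase (join_tiling v) | v <- Bk].
  rewrite map_inj_in_uniq // => v w vB wB; rewrite /join_tiling.
  case: (boolP (posv v)) => pv; case: (boolP (posv w)) => pw.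
  - exact: tiling_inj.
  - exact: join_inj_aux.
  - by move=> e; symmetry; apply: join_inj_aux.
  - exact: tiling_inj.
have sz : size Wh = size [seq v + ebase (join_tiling v) | v <- Bk].
  by rewrite -(perm_size tt) !size_map.
have sub : {subset [seq v + ebase (join_tiling v) | v <- Bk] <= Wh}.
  by move=> u /mapP[v vB ->]; apply: jW.
have [|_ e] := uniq_min_size uj sub; first by rewrite sz.
exact: uniq_perm.
Qed.

End Height.

(** Summation by parts: over the box, [flow v 0] is counted once for each row up to v 1, that is v 1
    + B times, and the constant B drops out. *)
Lemma vol_hgt t t' (B : nat) :
  (forall v, v \in Bk -> - B%:Z < v 0 < B%:Z /\ - B%:Z < v 1 < B%:Z) ->
  tiling t -> tiling t' ->
  vol t - vol t' = \sum_(i < B.*2.+1) \sum_(j < B.*2.+1) hgt t t' (i%:Z - B%:Z) (j%:Z - B%:Z + 1).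
Proof.
move=> bB tt tt'.
(* Both tilings cover the same white triangles; comparing the sums of first exponents shows that
   they use equally many rhombi of direction 0. *)
have z0 : \sum_(v <- Bk) flow t t' v 0 = 0.
  have := flow_white tt tt' (fun u => u 0); rewrite (eq_bigr (fun v => flow t t' v 0)) //.
  move=> v _; rewrite sum3 !ffunE /= !addr0 mulrDr mulr1.
  by have := flow_sum t t' v; rewrite sum3; lia.
transitivity (\sum_(v <- Bk) flow t t' v 0 * (v 1 + B%:Z)).
  rewrite (eq_bigr (fun v => flow t t' v 0 * v 1 + flow t t' v 0 * B%:Z)) => [|v _]; last first.
    by rewrite mulrDr.
  rewrite big_split /= -mulr_suml z0 mul0r addr0 /vol -sumrB; apply: eq_bigr => v _.
  by rewrite /flow mulrBl.
rewrite (eq_bigr (fun i : 'I_ _ => \sum_(v <- Bk) \sum_(j < B.*2.+1)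
   if (v 0 == i%:Z - B%:Z - 1) && (j%:Z - B%:Z + 1 <= v 1) then flow t t' v 0 else 0)); last first.
  by move=> i _; rewrite exchange_big; apply: eq_bigr => j _; rewrite /hgt big_mkcond.
rewrite exchange_big /= big_seq [RHS]big_seq; apply: eq_bigr => v /bB [v0 v1].
have iP : (`|(v 0 + B%:Z + 1)%R| < B.*2.+1)%N by lia.
rewrite (bigD1 (Ordinal iP)) //= [X in _ = _ + X]big1 ?addr0 => [|i ni]; last first.
  apply: big1 => j _; case: eqP => //= e; case/eqP: ni; apply: val_inj => /=; rewrite e.
  by have -> : i%:Z - B%:Z - 1 + B%:Z + 1 = i%:Z by lia.
have -> : v 0 == `|(v 0 + B%:Z + 1)%R|%N%:Z - B%:Z - 1 by lia.
pose m := `|(v 1 + B%:Z)%R|%N.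
rewrite (eq_bigr (fun j : 'I_(B.*2.+1) => if (j < m)%N then flow t t' v 0 else 0)); last first.
  move=> j _ /=; have -> : (j%:Z - B%:Z + 1 <= v 1) = (j < m)%N by rewrite /m; lia.
  by [].
rewrite -big_mkcond -(big_ord_widen _ (fun=> flow t t' v 0)); last by rewrite /m; lia.
rewrite sumr_const card_ord -mulr_natr; congr (_ * _); rewrite natz /m gez0_abs //; move: (v 1) v1
  => z; lia.
Qed.

Definition in_box (B : nat) : Prop :=
  forall v, v \in Bk -> - B%:Z < v 0 < B%:Z /\ - B%:Z < v 1 < B%:Z.

(** Induction downwards from the top of the box, where both heights vanish. One step adds
    [flow v 0], and [posv] lets the join take that step exactly when the maximum does. *)
Lemma join_hgt t t' (B : nat) x y : in_box B -> tiling t -> tiling t' ->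
  hgt (join_tiling t t') t' x y = Num.max (hgt t t' x y) 0.
Proof.
move=> bB tt tt'.
have big s (z : int) : B%:Z <= z -> hgt s t' x z = 0.
  move=> Bz; rewrite /hgt big_seq_cond big1 // => v /andP[/bB [_ v1]] /andP[_ zv].
  by case/andP: v1 => _ lt; have := le_lt_trans (le_trans Bz zv) lt; rewrite ltxx.
have [n] : exists n : nat, B%:Z - n%:Z <= y by exists `|(B%:Z - y)%R|%N; lia.
elim: n y => [|n IH] y yB; first by rewrite !big ?maxxx //; lia.
have {}IH := IH (y + 1) _; have e1 := hgt_step0 (join_tiling t t') t' x y.
have e2 := hgt_step0 t t' x y; rewrite IH in e1; last by lia.
have [/hasP[v vB /andP[/eqP v0 /eqP v1]]|none] :=
    boolP (has (fun v : expo => (v 0 == x - 1) && (v 1 == y)) Bk); last first.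
  by rewrite !sum_at0 // in e1 e2; move: e1 e2; lia.
have S (F : expo -> int) : \sum_(v <- Bk | (v 0 == x - 1) && (v 1 == y)) F v = F v.
  by rewrite -v0 -v1; apply: sum_atv.
rewrite !S in e1 e2.
have f0 := flow_hgtv tt tt' 0 vB; have f1 := flow_hgtv tt tt' 1 vB.
have f2 := flow_hgtv tt tt' 2%:R vB.
have pE := posvE t t' 0 v; rewrite !ord3_val in f0 f1 f2 pE.
have [xv yv] : x = v 0 + 1 /\ y = v 1 by rewrite v0 v1 subrK.
have h2 : hgtv t t' (v + ebase 0 + ebase 1) = hgt t t' x (y + 1).
  by rewrite /hgtv !ffunE /= !addr0 xv yv.
have h1 : hgtv t t' (v + ebase 2%:R + ebase 0) = hgt t t' x y.
  by rewrite /hgtv !ffunE /= !addr0 xv yv.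
rewrite h1 h2 in f0 f1 f2 pE.
have fj : flow (join_tiling t t') t' v 0 = if posv t t' v then flow t t' v 0 else 0.
  by rewrite /flow /join_tiling; case: ifP => _ //; rewrite subrr.
rewrite fj pE in e1; move: e1 f0 f1 f2.
move: (hgt t t' x y) (hgt t t' x (y + 1)) (hgtv _ _ _) (hgt (join_tiling t t') t' x y).
clear=> h0 h1 h2 hj; rewrite /flow.
have M (z : int) : Num.max z 0 = if 0 < z then z else 0 by case: leP.
rewrite !M; move: (t v) (t' v).
case: (boolP (0 < h0)) => ?; case: (boolP (0 < h1)) => ?; case: (boolP (0 < h2)) => ?;
  by elim/ord3_ind; elim/ord3_ind => /=; lia.
Qed.

(** The join exceeds t' in volume by the sum of max(h, 0), so maximality gives h <= 0. Equal volumes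
    then give h = 0, and a zero height has zero flow. *)
Lemma max_vol_uniq t t' (B : nat) : in_box B -> tiling t -> tiling t' ->
  (forall s, tiling s -> vol s <= vol t') -> vol t = vol t' ->
  {in Bk, t =1 t'}.
Proof.
move=> bB tt tt' tmax vt.
have tj := join_tilingP tt tt'.
have vj := vol_hgt bB tj tt'; have v0 := vol_hgt bB tt tt'.
have pos : \sum_(i < B.*2.+1) \sum_(j < B.*2.+1)
    Num.max (hgt t t' (i%:Z - B%:Z) (j%:Z - B%:Z + 1)) 0 <= 0.
  apply: le_trans (_ : vol (join_tiling t t') - vol t' <= 0); last first.
    by rewrite subr_le0 tmax.
  by rewrite vj; apply: ler_sum => i _; apply: ler_sum => j _; rewrite (join_hgt _ _ bB).
have le0 (i j : 'I_(B.*2.+1)) : hgt t t' (i%:Z - B%:Z) (j%:Z - B%:Z + 1) <= 0.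
  have p0 (k l : 'I_(B.*2.+1)) : 0 <= Num.max (hgt t t' (k%:Z - B%:Z) (l%:Z - B%:Z + 1)) 0.
    by rewrite le_max lexx orbT.
  have : Num.max (hgt t t' (i%:Z - B%:Z) (j%:Z - B%:Z + 1)) 0 <= 0.
    apply: le_trans pos; rewrite (bigD1 i) //= (bigD1 j) //= -addrA lerDl.
    by rewrite addr_ge0 // sumr_ge0 // => k _; rewrite sumr_ge0.
  by rewrite ge_max => /andP[].
have eq0 (i j : 'I_(B.*2.+1)) : hgt t t' (i%:Z - B%:Z) (j%:Z - B%:Z + 1) = 0.
  apply/eqP; rewrite eq_le le0 /=.
  move: v0; rewrite vt subrr (bigD1 i) //= (bigD1 j) //=.
  have n1 : \sum_(k < B.*2.+1 | k != j) hgt t t' (i%:Z - B%:Z) (k%:Z - B%:Z + 1) <= 0.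
    by apply: sumr_le0 => k _.
  have n2 : \sum_(k < B.*2.+1 | k != i) \sum_(l < B.*2.+1) hgt t t' (k%:Z - B%:Z) (l%:Z - B%:Z + 1) <= 0.
    by apply: sumr_le0 => k _; apply: sumr_le0.
  by move: n1 n2; move: (hgt _ _ _ _) (\sum_(k < _ | _) _) (\sum_(k < _ | _) _); clear; lia.
have z x y : - B%:Z <= x <= B%:Z -> - B%:Z < y <= B%:Z -> hgt t t' x y = 0.
  move=> xB yB.
  have iP : (`|(x + B%:Z)%R| < B.*2.+1)%N by lia.
  have jP : (`|(y + B%:Z - 1)%R| < B.*2.+1)%N by lia.
  have := eq0 (Ordinal iP) (Ordinal jP) => /=.
  have -> : `|(x + B%:Z)%R|%N%:Z - B%:Z = x by lia.
  by have -> : `|(y + B%:Z - 1)%R|%N%:Z - B%:Z + 1 = y by lia.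
move=> v vB; have [b0 b1] := bB v vB.
have f0 := flow_hgtv tt tt' 0 vB; have f1 := flow_hgtv tt tt' 1 vB.
rewrite /hgtv !ord3_val !ffunE /= !addr0 in f0 f1.
have e1 : hgt t t' (v 0 + 1) (v 1) = 0 by apply: z; move: (v 0) (v 1) b0 b1; clear; lia.
have e2 : hgt t t' (v 0 + 1) (v 1 + 1) = 0.
  by apply: z; move: (v 0) (v 1) b0 b1; clear; lia.
have e3 : hgt t t' (v 0) (v 1 + 1) = 0.
  by apply: z; move: (v 0) (v 1) b0 b1; clear; lia.
rewrite e1 e2 e3 subrr /flow in f0 f1.
by move: f0 f1; move: (t v) (t' v); elim/ord3_ind; elim/ord3_ind.
Qed.

End Tilings.

(** * Generic invertibility of K on M_0 *)

Section Adjacency.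
Variables (Bk Wh : seq expo).
Hypotheses (uBk : uniq Bk) (uWh : uniq Wh) (sBW : size Wh = size Bk).
Local Notation n := (size Bk).
Local Notation bk i := (nth 0 Bk (nat_of_ord i)).
Local Notation wh i := (nth 0 Wh (nat_of_ord i)).

(** A Kasteleyn matrix without signs: for a nonzero determinant one uncancelled term is enough. *)
Definition kast (R : pzRingType) (wgt : 'I_3 -> expo -> R) : 'M[R]_n :=
  \matrix_(i, j) \sum_k (bk i + ebase k == wh j)%:R * wgt k (bk i).

Lemma kast_adj (R : pzRingType) (wgt : 'I_3 -> expo -> R) i j k :
  bk i + ebase k = wh j -> kast wgt i j = wgt k (bk i).
Proof.
move=> e; rewrite mxE (bigD1 k) //= e eqxx mul1r big1 ?addr0 // => l lk.
rewrite -e (inj_eq (addrI _)) (inj_eq ebase_inj) (negPf lk) mul0r //.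
Qed.

Lemma kast_nadj (R : pzRingType) (wgt : 'I_3 -> expo -> R) i j :
  (forall k, bk i + ebase k != wh j) -> kast wgt i j = 0.
Proof. by move=> H; rewrite mxE big1 // => k _; rewrite (negPf (H k)) mul0r. Qed.

Definition matching (s : 'S_n) : bool := [forall i, exists k, bk i + ebase k == wh (s i)].

Definition dir (s : 'S_n) (v : expo) : 'I_3 :=
  if insub (index v Bk) is Some i then
    odflt 0 [pick k | v + ebase k == wh (s i)] else 0.

Lemma dirP (s : 'S_n) i : matching s -> bk i + ebase (dir s (bk i)) = wh (s i).
Proof.
move=> /forallP/(_ i)/existsP[k ek]; rewrite /dir; case: insubP => [u _ uE|]; last first.
  by rewrite index_uniq ?ltn_ord.
have -> : u = i by apply: val_inj; rewrite /= uE index_uniq.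
by case: pickP => [l /eqP //|/(_ k)]; rewrite ek.
Qed.

Lemma mem_bk (i : 'I_n) : bk i \in Bk.
Proof. exact: mem_nth. Qed.

Lemma wh_inj (i j : 'I_n) : wh i = wh j -> i = j.
Proof. by move=> /eqP; rewrite nth_uniq ?sBW // => /eqP /val_inj. Qed.

Lemma map_bk (T : Type) (f : expo -> T) : [seq f v | v <- Bk] = [seq f (bk i) | i <- enum 'I_n].
Proof.
rewrite -{1}(mkseq_nth 0 Bk) /mkseq -val_enum_ord -!map_comp.
by apply: eq_map.
Qed.

Lemma map_wh : Wh = [seq wh i | i <- enum 'I_n].
Proof.
by rewrite -{1}(mkseq_nth 0 Wh) sBW /mkseq -val_enum_ord -!map_comp; apply: eq_map.
Qed.

Lemma dir_tiling (s : 'S_n) : matching s -> tiling Bk Wh (dir s).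
Proof.
move=> ms; rewrite /tiling map_bk [in X in perm_eq _ X]map_wh.
have -> : [seq bk i + ebase (dir s (bk i)) | i <- enum 'I_n] =
          [seq wh i | i <- [seq s i | i <- enum 'I_n]].
  by rewrite -[RHS]map_comp; apply: eq_map => i /=; apply: dirP.
apply/perm_map/uniq_perm; rewrite ?enum_uniq ?(map_inj_uniq perm_inj) ?enum_uniq //.
move=> i; rewrite mem_enum inE; apply/mapP; exists ((s^-1)%g i).
  by rewrite mem_enum.
by rewrite permKV.
Qed.

Lemma tiling_dir t : tiling Bk Wh t ->
  exists2 s : 'S_n, matching s & {in Bk, dir s =1 t}.
Proof.
move=> tt.
have lt (i : 'I_n) : (index (bk i + ebase (t (bk i)))%R Wh < n)%N.
  by rewrite -[X in (_ < X)%N]sBW index_mem; apply: tiling_mem (mem_bk i).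
pose f i := Ordinal (lt i).
have fE i : wh (f i) = bk i + ebase (t (bk i)).
  by rewrite nth_index // (tiling_mem tt (mem_bk i)).
have fi : injective f.
  move=> i j e; have := fE i; rewrite e fE => /(tiling_inj uWh tt (mem_bk j) (mem_bk i)).
  by move/eqP; rewrite nth_uniq // => /eqP /val_inj ->.
have ms : matching (perm fi).
  by apply/forallP => i; apply/existsP; exists (t (bk i)); rewrite permE fE.
exists (perm fi) => // v vB.
have vi : (index v Bk < n)%N by rewrite index_mem.
have vE : bk (Ordinal vi) = v by rewrite /= nth_index.
have := dirP (Ordinal vi) ms; rewrite permE fE vE => /addrI; exact: ebase_inj.
Qed.

Lemma matching_inj (s s' : 'S_n) : matching s -> matching s' ->
  {in Bk, dir s =1 dir s'} -> s = s'.
Proof.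
move=> ms ms' e; apply/permP => i; apply: wh_inj.
by rewrite -!dirP // e // mem_bk.
Qed.

Lemma prod_kast (R : comNzRingType) (wgt : 'I_3 -> expo -> R) (s : 'S_n) :
  \prod_(i < n) kast wgt i (s i) =
  if matching s then \prod_(i < n) wgt (dir s (bk i)) (bk i) else 0.
Proof.
case: ifP => [ms|/negbT]; first by apply: eq_bigr => i _; apply: kast_adj; apply: dirP.
move=> ms; case: (pickP (fun i : 'I_n => ~~ [exists k, bk i + ebase k == wh (s i)])).
  move=> i; rewrite negb_exists => /forallP H.
  by rewrite (bigD1 i) //= kast_nadj ?mul0r.
by move=> H; case/negP: ms; apply/forallP => i; move: (H i) => /negbFE.
Qed.

Hypothesis dBk : forall v, v \in Bk -> deg v = 0.
Variables (B : nat) (F : fieldType).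
Hypothesis box : in_box Bk B.

(** Shifted by B to stay nonnegative; the total exponent of a matching is then n * B plus its
    [vol]. *)
Definition wexp (k : 'I_3) (v : expo) : nat :=
  if k == 0 then `|(v 1 + B%:Z)%R|%N else B.

Lemma det_kast_neq0 t0 : tiling Bk Wh t0 ->
  \det (kast (fun k v => 'X^(wexp k v) : {poly F})) != 0.
Proof.
move=> /tiling_dir [s0 ms0 _].
pose V (s : 'S_n) := (\sum_(i < n) wexp (dir s (bk i)) (bk i))%N.
have VE s : (V s)%:Z = (n * B)%N%:Z + vol Bk (dir s).
  rewrite /V /vol (big_nth 0) big_mkord -natz natr_sum.
  have -> : (n * B)%N%:Z = \sum_(i < n) B%:Z by rewrite sumr_const card_ord -mulr_natl natz; lia.
  rewrite -big_split; apply: eq_bigr => i _ /=; rewrite /wexp natz.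
  have [_ b1] := box (mem_bk i).
  case: (dir s (bk i) == 0); rewrite ?mul1r ?mul0r ?addr0 //=.
  by rewrite gez0_abs ?[B%:Z + _]addrC //; move: (nth 0 Bk i 1) b1; clear; lia.
case: (arg_maxnP V ms0) => s ms smax.
have vmax t : tiling Bk Wh t -> vol Bk t <= vol Bk (dir s).
  move=> /tiling_dir [s' ms' e]; have := smax s' ms'.
  have -> : vol Bk t = vol Bk (dir s').
    by rewrite /vol big_seq [RHS]big_seq; apply: eq_bigr => v vB; rewrite e.
  move: (VE s') (VE s); move: (vol _ _) (vol _ _) (V s) (V s') (n * B)%N; clear; lia.
(* The coefficient at the maximal exponent receives a sign from [s] and nothing from the other
   permutations. *)
apply/eqP => /(congr1 (fun p : {poly F} => p`_(V s))).
rewrite poly.coef0 /determinant poly.coef_sum.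
have cE (s' : 'S_n) : ((-1) ^+ s' * \prod_(i < n) 'X^(wexp (dir s' (bk i)) (bk i)) : {poly F})`_(V s) =
    (-1) ^+ s' * (V s == V s')%:R.
  by rewrite prodrXr mulr_sign; case: (odd_perm s'); rewrite ?poly.coefN coefXn ?mulN1r ?mul1r.
rewrite (bigD1 s) //= prod_kast ms cE eqxx mulr1 big1 ?addr0 => [|s' s's].
  by move=> /eqP; rewrite signr_eq0.
rewrite prod_kast; case: ifP => ms'; last by rewrite mulr0 poly.coef0.
rewrite cE; case: eqP => [e|_]; last by rewrite mulr0.
case/eqP: s's; apply: matching_inj => //.
apply: (max_vol_uniq uBk uWh dBk box (dir_tiling ms') (dir_tiling ms) vmax).
by have := VE s'; rewrite -e VE => /addrI.
Qed.

End Adjacency.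

Lemma prod3 (R : comPzRingType) (F : 'I_3 -> R) : \prod_i F i = F 0 * F 1 * F 2%:R.
Proof.
rewrite !big_ord_recl big_ord0 mulr1 mulrA.
by congr (_ * _ * _); congr (F _); apply: val_inj.
Qed.

Lemma cocycE (C : fieldType) (q : qparam C) (c d : expo) :
  cocyc q c d = q 0 1 ^ (c 1 * d 0) * q 0 2%:R ^ (c 2%:R * d 0) * q 1 2%:R ^ (c 2%:R * d 1).
Proof.
rewrite /cocyc -(pair_big_dep xpredT (fun i j : 'I_3 => (i < j)%N)
  (fun i j => q i j ^ (c j * d i))) /=.
rewrite prod3 !(big_mkcond (fun j : 'I_3 => (_ < j)%N)) !prod3 /=.
by rewrite !mul1r !mulr1.
Qed.

Section Generic.
Variables (C : numFieldType) (Bk Wh : seq expo) (B : nat).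
Hypotheses (uBk : uniq Bk) (uWh : uniq Wh) (sBW : size Wh = size Bk).
Hypothesis dBk : forall v, v \in Bk -> deg v = 0.
Hypothesis box : forall v, v \in Bk -> forall i, - B%:Z < v i < B%:Z.

Local Notation var i := (mpolyX C (mnm1 i) : mpoly 3 C).

(** The scalar [cocyc v e_k] times (q_12 q_23 q_31)^B, written in the coordinates (q_12, q_23, q_31)
    so that no negative power remains; q_13 = q_31^-1 accounts for the exponent B - v 2. *)
Definition mwgt (k : 'I_3) (v : expo) : mpoly 3 C :=
  if k == 0 then var 0 ^+ `|(v 1 + B%:Z)%R|%N * var 1 ^+ B * var 2%:R ^+ `|(B%:Z - v 2%:R)%R|%N
  else if k == 1 then var 0 ^+ B * var 1 ^+ `|(v 2%:R + B%:Z)%R|%N * var 2%:R ^+ B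
  else var 0 ^+ B * var 1 ^+ B * var 2%:R ^+ B.

Definition qprod (q : qparam C) : C := q 0 1 * q 1 2%:R * q 2%:R 0.

Lemma qcoord_val (q : qparam C) : (qcoord q 0 = q 0 1) * (qcoord q 1 = q 1 2%:R) *
  (qcoord q 2%:R = q 2%:R 0).
Proof. by rewrite /qcoord !ord3_val. Qed.

Lemma meval_mwgt (q : qparam C) k v : v \in Bk ->
  meval (qcoord q) (mwgt k v) = qprod q ^+ B * cocyc q v (ebase k).
Proof.
move=> /box bv.
have X (t : C) (z : int) : - B%:Z < z < B%:Z -> t != 0 -> t ^+ `|(z + B%:Z)%R|%N = t ^+ B * t ^ z.
  move=> zB t0; rewrite !exprnP -expfzDr //; congr (_ ^ _); move: zB; clear; lia.
have Y (z : int) : - B%:Z < z < B%:Z -> q 2%:R 0 ^+ `|(B%:Z - z)%R|%N = q 2%:R 0 ^+ B * q 0 2%:R ^ z.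
  move=> zB; rewrite (qijV q 0 2%:R) exprz_inv !exprnP -expfzDr ?qij_neq0 //.
  congr (_ ^ _); move: zB; clear; lia.
rewrite cocycE !ffunE /mwgt /qprod.
elim/ord3_ind: k => /=; rewrite !mevalM ?rmorphXn /= ?mevalXU !qcoord_val ?X ?Y ?qij_neq0 //;
  by rewrite !exprMn ?mulr1 ?mulr0 ?expr0z ?mulr1; ring.
Qed.

Lemma map_kast (R S : pzRingType) (f : {rmorphism R -> S}) (w : 'I_3 -> expo -> R)
    (w' : 'I_3 -> expo -> S) : (forall k v, v \in Bk -> f (w k v) = w' k v) ->
  map_mx f (kast Bk Wh w) = kast Bk Wh w'.
Proof.
move=> ww; apply/matrixP => i j; rewrite !mxE rmorph_sum; apply: eq_bigr => k _.
by rewrite rmorphM rmorph_nat ww // mem_bk.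
Qed.

Lemma poly_nonroot (p : {poly C}) : p != 0 -> exists x, p.[x] != 0.
Proof.
move=> p0; apply: contrapT => N.
have := max_poly_roots p0 (rs := [seq i%:R | i <- iota 0 (size p)]).
rewrite size_map size_iota ltnn => H; have : false; last by [].
apply: H; last by rewrite map_inj_uniq ?iota_uniq // => i j /eqP; rewrite eqr_nat => /eqP.
apply/allP => x _; apply: contraT => nr; case: N; exists x; exact: nr.
Qed.

Section Tau.
Variables (tau : C) (tau0 : tau != 0).

(** The curve q_12 = tau, q_23 = q_31 = 1. On it [cocyc v e_k] is tau^(v 1) for k = 0 and 1
    otherwise, the weight that defines [vol]. *)
Definition qtau_fun (i j : 'I_3) : C :=
  if (i == 0) && (j == 1) then tau else if (i == 1) && (j == 0) then tau^-1 else 1.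

Lemma qtau_neq0 i j : qtau_fun i j != 0.
Proof. by rewrite /qtau_fun; case: ifP => _ //; case: ifP => _; rewrite ?invr_eq0 ?oner_eq0. Qed.

Lemma qtau_id i : qtau_fun i i = 1.
Proof. by elim/ord3_ind: i. Qed.

Lemma qtauV i j : qtau_fun i j = (qtau_fun j i)^-1.
Proof. by elim/ord3_ind: i; elim/ord3_ind: j; rewrite /qtau_fun /= ?invrK ?invr1. Qed.

Definition qtau : qparam C := QParam qtau_neq0 qtau_id qtauV.

End Tau.

Lemma generic_poly (m : nat) (t0 : expo -> 'I_3) : tiling Bk Wh t0 ->
  exists P : mpoly 3 C, (exists q : qparam C, meval (qcoord q) P != 0) /\
    forall q : qparam C, meval (qcoord q) P != 0 ->
      \det (kast Bk Wh (fun k v => cocyc q v (ebase k))) != 0 /\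
      forall i, (0 < i <= m)%N -> qprod q ^+ i != 1.
Proof.
move=> tt; pose V : mpoly 3 C := var 0 * var 1 * var 2%:R.
pose P := \det (kast Bk Wh mwgt) * \prod_(i < m) (V ^+ i.+1 - 1).
have PE q : meval (qcoord q) P =
    (qprod q ^+ B) ^+ size Bk * \det (kast Bk Wh (fun k v => cocyc q v (ebase k))) *
    \prod_(i < m) (qprod q ^+ i.+1 - 1).
  rewrite mevalM -det_map_mx (map_kast (w' := fun k v => qprod q ^+ B * cocyc q v (ebase k))).
    congr (_ * _); last first.
      rewrite rmorph_prod; apply: eq_bigr => i _.
      by rewrite /= mevalB rmorphXn /= !mevalM !mevalXU meval1 !qcoord_val.
    rewrite -detZ; congr (\det _); apply/matrixP => i j; rewrite !mxE mulr_sumr.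
    by apply: eq_bigr => k _; ring.
  by move=> k v vB /=; apply: meval_mwgt.
exists P; split=> [|q]; last first.
  rewrite PE !mulf_eq0 !negb_or => /andP[/andP[_ nd] /prodf_neq0 np]; split=> // i.
  case: i => [//|i] /= im; have /= := np (Ordinal im) isT.
  by rewrite subr_eq0.
pose p1 := \det (kast Bk Wh (fun k v => 'X^(wexp B k v) : {poly C})).
pose p2 : {poly C} := \prod_(i < m) ('X^(i.+1) - 1).
have p1n : p1 != 0.
  have b2 : in_box Bk B by move=> v vB; split; apply: box.
  exact: (det_kast_neq0 uBk uWh sBW dBk C b2 tt).
have p2n : p2 != 0.
  apply/prodf_neq0 => i _; apply/negP => /eqP /(congr1 (fun p : {poly C} => size p)).
  by rewrite size_XnsubC // size_poly0.
(* The factor X keeps tau nonzero, as a parameter must be. *)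
have [tau] : exists x, (p1 * p2 * 'X).[x] != 0.
  by apply: poly_nonroot; rewrite !mulf_neq0 ?polyX_eq0.
rewrite !hornerE !mulf_eq0 !negb_or => /andP[/andP[t1 t2] t0'].
exists (qtau t0'); rewrite PE.
have qE : qprod (qtau t0') = tau by rewrite /qprod /= /qtau_fun /= !mulr1.
rewrite qE !mulf_neq0 ?expf_neq0 //; last first.
  apply/prodf_neq0 => i _; move: t2; rewrite /p2 horner_prod => /prodf_neq0 /(_ i isT).
  by rewrite !hornerE.
apply: contra t1 => /eqP d0; rewrite /p1 -horner_evalE -det_map_mx.
rewrite (map_kast (w' := fun k v => tau ^+ B * cocyc (qtau t0') v (ebase k))) => [|k v vB].
  have -> : kast Bk Wh (fun k v => tau ^+ B * cocyc (qtau t0') v (ebase k)) =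
      tau ^+ B *: kast Bk Wh (fun k v => cocyc (qtau t0') v (ebase k)).
    apply/matrixP => i j; rewrite !mxE mulr_sumr.
    by apply: eq_bigr => k _; ring.
  by rewrite detZ d0 mulr0.
rewrite /= horner_evalE hornerXn cocycE !ffunE /qtau_fun /= !exp1rz !mulr1 /wexp.
have := box vB 1; have [_|_] := eqVneq k 0 => bv /=.
  rewrite /qtau_fun /= mulr1 !exprnP -expfzDr //; congr (_ ^ _).
  by rewrite gez0_abs; [rewrite addrC|case/andP: bv => /ltW; rewrite -subr_ge0 opprK].
by rewrite mulr0 expr0z mulr1.
Qed.

End Generic.

(** * Degree 0: kernel and surjectivity of K *)

Section Kernel0.
Variables (C : numFieldType) (q : qparam C) (a b : seq expo).
Local Notation T := (qtorus q).
Local Notation sg := (sigma q).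
Local Notation Bk := (monl a b 0).
Local Notation Wh := (monl a b 1).
Local Opaque qmul xm.

Lemma tileable_tiling (Om : pred expo) :
  (forall c, deg c = 0 \/ deg c = 1 -> Om c = mon a b c) -> tileable Om ->
  exists t, tiling Bk Wh t.
Proof.
move=> OM [t [tB tW]]; exists t; rewrite /tiling; apply: uniq_perm; rewrite ?uniq_monl //.
  rewrite map_inj_in_uniq ?uniq_monl // => v v'.
  rewrite !mem_monl => /andP[mv /eqP v0] /andP[mv' /eqP v0'] e.
  have Ov : Om v by rewrite OM //; left.
  have Ov' : Om v' by rewrite OM //; left.
  have [|x [_ ux]] := tW (v + ebase (t v)) _ (tB v v0 Ov); first by rewrite degD v0 deg_ebase.
  by rewrite -(ux v) // -(ux v').
move=> u; apply/mapP/idP => [[v]|].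
  rewrite !mem_monl => /andP[mv /eqP v0] ->.
  have uE : deg (v + ebase (t v)) = 1 by rewrite degD v0 deg_ebase.
  rewrite uE eqxx andbT -OM; last by right.
  by apply: tB; rewrite ?OM //; left.
rewrite mem_monl => /andP[mu /eqP u1].
have [|v [[v0 Ov ->] _]] := tW u u1; first by rewrite OM //; right.
by exists v => //; rewrite mem_monl v0 eqxx andbT -OM //; left.
Qed.

Lemma coef_sg (h : T) u : mcoeff u (h * sg) =
  \sum_k cocyc q (u - ebase k) (ebase k) * mcoeff (u - ebase k) h.
Proof.
by rewrite /sigma mulr_sumr coef_sum; apply: eq_bigr => k _; rewrite coef_Mxm.
Qed.

Lemma surjK_rank (j : int) : \rank (Kmx q a b j) = size (monl a b (j + 1)) -> surjK q a b j.
Proof.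
move=> rK h hj; have fK : row_full (Kmx q a b j) by apply/eqP.
have /submxP[u uE] := submx_full (vec (monl a b (j + 1)) h) fK.
exists (@unv C q (monl a b j) u); first exact: grd_unv.
apply/(@above_vec C q a b (j + 1)).
  by apply: supp_inB hj _; apply: grd_sigma (@grd_unv _ _ _ _ _ _).
by rewrite vecD vecN vec_unv_sg -uE subrr.
Qed.

Hypothesis sBW : size Wh = size Bk.
Hypothesis det0 : \det (kast Bk Wh (fun k v => cocyc q v (ebase k))) != 0.

Lemma Kmx0_free (v : 'rV[C]_(size Bk)) : v *m Kmx q a b 0 = 0 -> v = 0.
Proof.
move=> vK; set A := kast Bk Wh (fun k v => cocyc q v (ebase k)).
have uA : A \in unitmx by rewrite unitmxE unitfE det0.
have : v *m A = 0.
  apply/rowP => j; move/rowP: vK => /(_ (cast_ord (esym sBW) j)); rewrite !mxE => H.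
  rewrite -[RHS]H; apply: eq_bigr => k _; congr (_ * _); rewrite !mxE coef_sg.
  have E (x y z : expo) : (x == y - z) = (x + z == y) by rewrite eq_sym subr_eq eq_sym.
  apply: eq_bigr => l _ /=; rewrite coef_xm E.
  by case: eqP => [<-|_]; rewrite ?mul0r ?mulr0 // addrK mul1r mulr1.
by move/(congr1 (mulmx^~ (invmx A))); rewrite mulmxK // mul0mx.
Qed.

Lemma kerQ0_eq0 (h : T) : kerQ a b 0 h -> supp_in (above b) h.
Proof. by move=> /kerQ_vec[hj /Kmx0_free H]; apply/(@above_vec C q a b 0). Qed.

Lemma surjK0 : surjK q a b 0.
Proof.
apply: surjK_rank; transitivity (size Bk); last by rewrite -sBW.
apply/eqP; rewrite -[_ == _]/(row_free _) -kermx_eq0; apply/eqP/row_matrixP => i.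
by rewrite row0; apply: Kmx0_free; rewrite -row_mul mulmx_ker row0.
Qed.

Section White.
Variables (w : expo) (w1 : deg w = 1) (mw : mon a b w).

(** In degrees at most 1 the only monomial of A x^w is x^w itself. *)
Lemma supp_cons (P : pred expo) (h : T) : (forall c, P c -> deg c <= 1) -> supp_in P h ->
  mcoeff w h = 0 -> supp_in (above (w :: b)) h -> supp_in (above b) h.
Proof.
move=> P1 hP hw hb c ch; have := hb c ch; rewrite /above /= => /orP[wc|//].
have cw : w = c by apply: lee_deg_eq wc _; rewrite w1; apply/P1/hP.
by move: ch; rewrite -cw hw eqxx.
Qed.

Lemma supp_above_cons (h : T) : supp_in (above b) h -> supp_in (above (w :: b)) h.
Proof. by apply: supp_inW => c cb; rewrite /above /= -/(above b c) cb orbT. Qed.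

Lemma surjK0_cons : surjK q a (w :: b) 0.
Proof. by move=> h /surjK0[h' ? ?]; exists h' => //; apply: supp_above_cons. Qed.

Lemma kerQ0_cons : exists m0 : T, [/\ kerQ a (w :: b) 0 m0,
  forall h, kerQ a (w :: b) 0 h -> exists k, supp_in (above (w :: b)) (h - k *: m0) &
  forall k, supp_in (above (w :: b)) (k *: m0) -> k = 0].
Proof.
have [aw bw] := andP mw.
have gw : supp_in (grd a 1) (xm q w) by apply: supp_in_xm; rewrite /grd aw w1 eqxx.
have [m0 m0g m0E] := surjK0 gw.
have d1 c : grd a 1 c -> deg c <= 1 by case/andP=> _ /eqP ->.
exists m0; split=> //.
- split=> //; rewrite -[m0 * sg](subKr (xm q w)); apply: supp_inB.
    by apply: supp_in_xm; rewrite /above /= leexx.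
  exact: supp_above_cons.
- move=> h [hg hb]; exists (mcoeff w (h * sg)); apply/supp_above_cons/kerQ0_eq0.
  split; first by apply: supp_inB hg _; apply: supp_inZ.
  rewrite mulrBl scale_mul.
  set k := mcoeff w (h * sg).
  have -> : h * sg - k *: (m0 * sg) = h * sg - k *: xm q w + k *: (xm q w - m0 * sg).
    by rewrite scalerBr addrA subrK.
  apply: supp_inD; last exact: supp_inZ.
  apply: (supp_cons (P := grd a 1)) => //.
  + by apply: supp_inB; [exact: grd_sigma hg|exact: supp_inZ].
  + by rewrite coefD coefN coefZ coef_xm eqxx mulr1 subrr.
  apply: supp_inB hb _; apply: supp_inZ; apply: supp_in_xm.
  by rewrite /above /= leexx.
move=> k kb; have kb' : supp_in (above b) (k *: m0).
  apply: (supp_cons (P := grd a 0)) => //; first by move=> c /andP[_ /eqP ->].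
    by apply: supp_inZ.
  by rewrite (supp_in_out (P := grd a 0)) //; [exact: supp_inZ|rewrite /grd w1 andbF].
have : supp_in (above b) (k *: xm q w).
  have -> : k *: xm q w = k *: (xm q w - m0 * sg) + (k *: m0) * sg.
    by rewrite scalerBr scale_mul subrK.
  by apply: supp_inD; [exact: supp_inZ|exact: above_sigma].
move=> /(_ w); rewrite coefZ coef_xm eqxx mulr1 => H.
by apply/eqP; apply: contraNT bw.
Qed.

End White.
End Kernel0.

Lemma seq_argmin (X : eqType) (s : seq X) (f : X -> int) : s != [::] ->
  exists2 x, x \in s & forall y, y \in s -> f x <= f y.
Proof.
elim: s => [//|x s IH] _; case: (eqVneq s [::]) => [->|/IH[y ys yE]].
  by exists x; rewrite ?mem_head // => y; rewrite inE => /eqP ->.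
case: (leP (f x) (f y)) => xy.
  exists x; first exact: mem_head.
  by move=> z; rewrite inE => /orP[/eqP -> //|/yE]; apply: le_trans.
exists y; first by rewrite inE ys orbT.
by move=> z; rewrite inE => /orP[/eqP ->|/yE //]; apply: ltW.
Qed.

(** Two linear equations with a common solution (p1, p2) are proportional. The factors s1, s2 stand
    for [cocyc e e], which completes the scalars taken at u - e to those taken at u. *)
Lemma two_terms (F : fieldType) (k1 k2 r c1 c2 d1 d2 p1 p2 s1 s2 : F) :
  s1 != 0 -> s2 != 0 -> d1 != 0 -> c2 != 0 -> p2 != 0 ->
  c1 * p1 + c2 * p2 = 0 -> k1 * (d1 * p1) + k2 * (d2 * p2) = 0 ->
  d1 * s1 * (c2 * s2) * r = d2 * s2 * (c1 * s1) -> k1 = k2 * r.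
Proof.
move=> s1n s2n d1n c2n p2n E1 E2 T; apply/eqP; rewrite -subr_eq0.
have n : d1 * c2 * p2 * (s1 * s2) != 0 by rewrite !mulf_neq0.
rewrite -(mulIr_eq0 _ (mulIf n)); apply/eqP.
have -> : (k1 - k2 * r) * (d1 * c2 * p2 * (s1 * s2)) =
  k1 * d1 * s1 * s2 * (c1 * p1 + c2 * p2) -
  k2 * p2 * (d1 * s1 * (c2 * s2) * r - d2 * s2 * (c1 * s1)) -
  c1 * s1 * s2 * (k1 * (d1 * p1) + k2 * (d2 * p2)) by ring.
by rewrite E1 E2 T subrr !mulr0 !subr0.
Qed.

(** * Linear forms killing the kernel of K on M^w_0 *)

Section Sweep.
Variables (C : numFieldType) (q : qparam C).
Local Notation T := (qtorus q).
Local Notation sg := (sigma q).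

Section Powers.
Variables (F : fieldType) (x y z : F).
Hypotheses (x0 : x != 0) (y0 : y != 0) (z0 : z != 0).

Definition pow3 (i j k : int) : F := x ^ i * y ^ j * z ^ k.

Lemma pow3M i j k i' j' k' : pow3 i j k * pow3 i' j' k' = pow3 (i + i') (j + j') (k + k').
Proof. by rewrite /pow3 !expfzDr //; ring. Qed.

Lemma pow3X i j k n : pow3 i j k ^ n = pow3 (i * n) (j * n) (k * n).
Proof. by rewrite /pow3 !expfzMl !exprz_exp. Qed.

End Powers.

(* The ratios of the characters u |-> x_j x^u / x^u x_j over the three pairs of
   variables differ by powers of q_12 q_23 q_31. *)
Lemma cocyc_turn (i : 'I_3) u : deg u = 1 ->
  cocyc q (ebase (i + 1)) u * cocyc q u (ebase (i + 2%:R)) *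
    (q (i + 1) (i + 2%:R) * qprod q ^ (- u i)) =
  cocyc q (ebase (i + 2%:R)) u * cocyc q u (ebase (i + 1)).
Proof.
pose P := pow3 (q 0 1) (q 0 2%:R) (q 1 2%:R).
have M : forall i j k i' j' k', P i j k * P i' j' k' = P (i + i') (j + j') (k + k').
  by apply: pow3M; apply: qij_neq0.
have X i' j k n : P i' j k ^ n = P (i' * n) (j * n) (k * n) by apply: pow3X.
have cE c d : cocyc q c d = P (c 1 * d 0) (c 2%:R * d 0) (c 2%:R * d 1) by apply: cocycE.
have q01 : q 0 1 = P 1 0 0 by rewrite /P /pow3 !expr0z !mulr1.
have q12 : q 1 2%:R = P 0 0 1 by rewrite /P /pow3 !expr0z !mul1r.
have q20 : q 2%:R 0 = P 0 (-1) 0 by rewrite (qijV q 2%:R 0) /P /pow3 !expr0z mulr1 mul1r.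
rewrite /deg sum3 => u1; rewrite !cE /qprod q01 q12 q20 !M X; elim/ord3_ind: i;
  rewrite !ord3_val !ffunE /= ?q01 ?q12 ?q20 !M; move: u1; move: (u 0) (u 1) (u 2%:R);
  clear => u0 u1 u2 u1E; congr (P _ _ _); lia.
Qed.

Variables (Om : pred expo) (a b : seq expo) (w : expo) (m0 : T) (B : nat).
Hypotheses (Om_mon : forall c, deg c = 0 \/ deg c = 1 -> Om c = mon a b c) (w1 : deg w = 1).
Hypothesis no_acute : forall v j, deg v = 0 -> Om v ->
  Om (v + ebase (j + 1)) || Om (v + ebase (j + 2%:R)).
Hypothesis white_star : forall i k, k != i -> Om (w - ebase k) -> Om (w + ebase i - ebase k).
Hypothesis box : forall v, v \in monl a b 0 -> forall i, - B%:Z < v i < B%:Z.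
Hypothesis Q1 : forall i, (0 < i <= 3 * B)%N -> qprod q ^+ i != 1.
Hypothesis m0Q : kerQ a (w :: b) 0 m0.
Hypothesis m0_neq0 : ~ supp_in (above b) m0.
Variable k : 'I_3 -> C.
Hypothesis km0 : supp_in (above (w :: b)) (\sum_i k i *: (xm q (ebase i) * m0)).

Let S := [seq v <- monl a b 0 | mcoeff v m0 != 0].

Lemma sweep_supp_neq0 : S != [::].
Proof.
apply: contra_notN m0_neq0 => /eqP S0 c ch; apply: contraT => cb.
have [/(_ c ch) gc _] := m0Q.
suff : c \in S by rewrite S0.
rewrite mem_filter ch mem_monl /mon cb /=.
by case/andP: gc => -> ->.
Qed.

(** The equation to be used must sit at a white triangle with the same i-th exponent as [v], and not
    at [w], where K m0 need not vanish. If the first candidate is [w], [white_star] supplies the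
    other. *)
Lemma sweep_nbr v i : deg v = 0 -> Om v ->
  exists2 l, l != i & Om (v + ebase l) && (v + ebase l != w).
Proof.
move=> v0 Ov; have H l l' : l != i -> l' != i -> l' != l -> Om (v + ebase l) ->
    exists2 l, l != i & Om (v + ebase l) && (v + ebase l != w).
  move=> li li' ll Ol; case: (eqVneq (v + ebase l) w) => [vw|vw]; last by exists l; rewrite ?Ol.
  have vE : v = w - ebase l by rewrite -vw addrK.
  exists l' => //; apply/andP; split.
    by rewrite vE addrAC; apply: white_star; rewrite 1?eq_sym // -vE.
  by rewrite -vw (inj_eq (addrI _)) (inj_eq ebase_inj).
have i1 : i + 1 != i by clear; elim/ord3_ind: i.
have i2 : i + 2%:R != i by clear; elim/ord3_ind: i.
have i12 : i + 1 != i + 2%:R by clear; elim/ord3_ind: i.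
have [O|O] := orP (no_acute i v0 Ov); last exact: H i2 i1 i12 O.
by apply: H i1 i2 _ O; rewrite eq_sym.
Qed.

Lemma sweep_rel i : exists2 z : int, (forall v, v \in S -> z <= v i) /\ - B%:Z < z &
  k (i + 1) = k (i + 2%:R) * (q (i + 1) (i + 2%:R) * qprod q ^ (- z)).
Proof.
have [v vS vmin] := seq_argmin (fun v : expo => v i) sweep_supp_neq0.
exists (v i).
  by split=> //; move: vS; rewrite mem_filter => /andP[_ /box/(_ i)/andP[]].
have [mv /andP[] ] : mcoeff v m0 != 0 /\ mon a b v && (deg v == 0).
  by move: vS; rewrite mem_filter mem_monl => /andP[].
move=> Mv /eqP v0; have Ov : Om v by rewrite Om_mon; [|left].
have [l li /andP[Ou uw]] := sweep_nbr i v0 Ov; set u := v + ebase l in Ou uw.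
have u1 : deg u = 1 by rewrite degD v0 deg_ebase.
have ui : u i = v i by rewrite !ffunE (negPf li) addr0.
have Mu : mon a b u by rewrite -Om_mon; [|right].
have nu : ~~ above (w :: b) u.
  rewrite /above /= negb_or; case/andP: Mu => _ ->; rewrite andbT.
  by apply: contra uw => wu; rewrite eq_sym; apply/eqP/lee_deg_eq; rewrite ?u1 ?w1.
(* Its i-th exponent is v i - 1, below the minimum on the support; so both equations at [u] have
   only two terms left. *)
have mi : mcoeff (u - ebase i) m0 = 0.
  apply/eqP; apply: contraT => ch; have [/(_ _ ch) gc _] := m0Q.
  have : u - ebase i \in S.
    rewrite mem_filter ch mem_monl /mon /=.
    case/andP: gc => -> ->; rewrite andbT; case/andP: Mu => _; apply: contra.
    by apply: above_le; apply: lee_sub.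
  by move=> /vmin; rewrite !ffunE eqxx (negPf li) addr0; move: (v i); clear => x; lia.
have E1 : cocyc q (u - ebase (i + 1)) (ebase (i + 1)) * mcoeff (u - ebase (i + 1)) m0 +
    cocyc q (u - ebase (i + 2%:R)) (ebase (i + 2%:R)) * mcoeff (u - ebase (i + 2%:R)) m0 = 0.
  have [_ /supp_in_out/(_ nu)] := m0Q; rewrite coef_sg (sum3_rot _ i) mi mulr0 add0r.
  by [].
have E2 : k (i + 1) * (cocyc q (ebase (i + 1)) (u - ebase (i + 1)) * mcoeff (u - ebase (i + 1)) m0) +
    k (i + 2%:R) * (cocyc q (ebase (i + 2%:R)) (u - ebase (i + 2%:R)) * mcoeff (u - ebase (i +
      2%:R)) m0) = 0.
  have := supp_in_out km0 nu; rewrite coef_sum.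
  rewrite (eq_bigr (fun l => k l * (cocyc q (ebase l) (u - ebase l) * mcoeff (u - ebase l) m0))).
    by rewrite (sum3_rot _ i) mi !mulr0 add0r.
  by move=> l' _; rewrite coefZ coef_xmM.
pose e1 := ebase (i + 1); pose e2 := ebase (i + 2%:R).
have split_cocyc e : cocyc q e u = cocyc q e (u - e) * cocyc q e e /\
    cocyc q u e = cocyc q (u - e) e * cocyc q e e.
  by rewrite -cocycDl -cocycDr subrK.
have [A1 B1] := split_cocyc e1; have [A2 B2] := split_cocyc e2.
(* One of the two exponents is [v], whose coefficient is nonzero; the two-term equation then forces
   the other. *)
have p0 : (mcoeff (u - e1) m0 != 0) && (mcoeff (u - e2) m0 != 0).
  have [n1 n2] := (cocyc_neq0 q (u - e1) e1, cocyc_neq0 q (u - e2) e2).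
  have : (mcoeff (u - e1) m0 != 0) || (mcoeff (u - e2) m0 != 0).
    have [->|->] : e1 = ebase l \/ e2 = ebase l; last by rewrite addrK mv orbT.
      rewrite /e1 /e2; move: li; elim/ord3_ind: (i); elim/ord3_ind: l {u Ou uw u1 ui Mu nu mi E1 E2
        e1 e2 split_cocyc A1 B1 A2 B2 n1 n2};
        rewrite ?ord3_val => //; auto.
    by rewrite addrK mv.
  move: E1; rewrite -/e1 -/e2.
  case: (eqVneq (mcoeff (u - e1) m0) 0) => [->|//].
    by rewrite mulr0 add0r => /eqP; rewrite mulf_eq0 (negPf n2) /= => /eqP ->; rewrite eqxx.
  move=> p1 E _; apply: contraTneq isT => p2; move: E; rewrite p2 mulr0 addr0 => /eqP.
  by rewrite mulf_eq0 (negPf n1) (negPf p1).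
have T1 := cocyc_turn i u1; rewrite -/e1 -/e2 A1 A2 B1 B2 ui in T1.
have [p1 p2] := andP p0.
exact: (two_terms (cocyc_neq0 q e1 e1) (cocyc_neq0 q e2 e2) (cocyc_neq0 q e1 (u - e1))
  (cocyc_neq0 q (u - e2) e2) p2 E1 E2 T1).
Qed.

Lemma sweep_zero i : k i = 0.
Proof.
have [z2 [z2S z2B]] := sweep_rel 2%:R; have [z1 [z1S z1B]] := sweep_rel 1.
have [z0 [z0S z0B]] := sweep_rel 0; rewrite !ord3_val => k1 k2 k0.
have q0 : qprod q != 0 by rewrite /qprod !mulf_neq0 ?qij_neq0.
have k0E : k 0 = k 0 * qprod q ^ (1 - z0 - z1 - z2).
  rewrite !expfzDr // expr1z {1}k0 k1 k2 /qprod; ring.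
have : k 0 = 0.
  have [v vS] : exists v, v \in S.
    by move: sweep_supp_neq0; case: S => [//|v s _]; exists v; apply: mem_head.
  have v0 : v 0 + v 1 + v 2%:R = 0.
    by move: vS; rewrite mem_filter mem_monl /deg sum3 => /andP[_ /andP[_ /eqP]].
  (* The minima add up to at most deg v = 0, so n >= 1; each exceeds -B, so n <= 3B. *)
  pose n := `|(1 - z0 - z1 - z2)%R|%N.
  have [nE nB] : 1 - z0 - z1 - z2 = n%:Z /\ (0 < n <= 3 * B)%N.
    move: (z0S v vS) (z1S v vS) (z2S v vS) z0B z1B z2B v0; rewrite /n.
    by move: (v 0) (v 1) (v 2%:R); clear; lia.
  have := Q1 nB; move: k0E; rewrite nE -exprnP => /eqP.
  rewrite -subr_eq0 -{1}[k 0]mulr1 -mulrBr mulf_eq0 subr_eq0 eq_sym => /orP[/eqP //|/eqP ->].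
  by rewrite eqxx.
by move: k1 k2 k0; elim/ord3_ind: i => k1 k2 k0 k00 //; [rewrite k1 k2|rewrite k2]; rewrite k00 !mul0r.
Qed.

End Sweep.

(** * Assembly of the theorem *)

Lemma box_exists (s : seq expo) : exists B : nat, forall v, v \in s -> forall i, - B%:Z < v i < B%:Z.
Proof.
elim: s => [|v s [B BH]]; first by exists 0%N.
exists (B + \sum_i `|(v i)%R|).+1%N => u; rewrite inE => /orP[/eqP ->|us] i; last first.
  have := BH u us i; move: (u i) (\sum_i _)%N; clear; lia.
rewrite (bigD1 i) //=; move: (v i) (\sum_(_ | _) _)%N; clear; lia.
Qed.

Theorem theorem1 (R : realType) (Om : pred expo) (p : seq edge) (D : nat)
    (a b : seq expo)
    (Om_polygon : boundary Om p) (Om_slopes : cyclic_slopes p)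
    (Om_degree : degree p D) (Om_tileable : tileable Om)
    (Om_ab : decomposition Om a b) :
  generically (fun q : qparam (R[i])%C =>
    min_resolution (stable q a b) (kerK (module q a b))
      (nseq D 1) (nseq D 2)
    /\
    forall w : expo, deg w = 1 -> Om w ->
      min_resolution (stablew q a b w) (kerK (module q a (w :: b)))
        (0 :: nseq D.-1 1) (nseq D 2)).
Proof.
have OM := Om_mon Om_ab; have [t tt] := tileable_tiling OM Om_tileable.
have sBW : size (monl a b 1) = size (monl a b 0).
  by rewrite -(perm_size tt) size_map.
have dBk v : v \in monl a b 0 -> deg v = 0 by rewrite mem_monl => /andP[_ /eqP].
have [B box] := box_exists (monl a b 0).
have [P [Pne PH]] := generic_poly (R[i])%C (uniq_monl a b 0) (uniq_monl a b 1) sBW dBk box (3 * B) tt.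
have [a1 b1 ba _] := Om_ab.
exists (fun x => meval x P = 0); split.
- exists (fun P' => P' = P) => x; split=> [H _ ->//|]; exact.
- by have [q /eqP Hq] := Pne; exists q.
move=> q /eqP/PH [det0 Q1]; split.
  apply: resolution_injective.
  - by move=> d Id d0; apply: stable_window d0 b1 ba Id.
  - exact: surjK0 sBW det0.
  - move=> d Id d1; have [ac _] := stable_window (ltnW d1) b1 ba Id.
    by apply: (count_chi (j := 3)) => c c3; apply: ac; rewrite c3; move: d1; clear; lia.
  - exact: kerQ0_eq0 sBW det0.
  - by rewrite sBW.
  move=> d Id d0; have [ac _] := stable_window d0 b1 ba Id.
  have : forall c, deg c = 2 -> acyc a b c by move=> c c2; apply: ac; rewrite c2; move: d0; clear; lia.
  by move/(count_mon Om_polygon Om_slopes Om_degree Om_ab); rewrite sBW; lia.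
move=> w w1 Ow; have mw : mon a b w by rewrite -OM //; right.
have b1' : all (fun c => deg c <= 1) (w :: b) by rewrite /= w1.
have ba' : all (above a) (w :: b) by rewrite /=; case/andP: mw => -> _.
have win d : stablew q a b w d -> (0 < d)%N -> window a (w :: b) d.
  by move=> Id d0; apply: stablew_window Id.
have ac2 d : stablew q a b w d -> (0 < d)%N -> forall c, deg c = 2 -> acyc a (w :: b) c.
  by move=> Id d0 c c2; have [ac _] := win d Id d0; apply: ac; rewrite c2; move: d0; clear; lia.
have N1 := perm_size (monl_white Om_ab w1 Ow); have N0 := monl_black a b w1.
have [m0 [m0Q m0on m0in]] := kerQ0_cons sBW det0 w1 mw.
apply: (resolution_one win _ _ m0Q) => //.
- exact: (surjK0_cons sBW det0).
- move=> d Id d1; apply: (count_chi (j := 3)) => c c3.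
  by have [ac _] := win d Id (ltnW d1); apply: ac; rewrite c3; move: d1; clear; lia.
- move=> d Id d0 k km i.
  apply: (sweep_zero OM w1 _ _ box Q1 m0Q _ km).
  + exact: (no_acute Om_polygon Om_slopes).
  + exact: (white_star Om_ab w1 Ow (ac2 d Id d0)).
  move=> H; have : (1 : R[i]%C) = 0.
    by apply: m0in; rewrite scale1r; apply: supp_above_cons H.
  by move/eqP; rewrite oner_eq0.
- by rewrite N0 -sBW N1.
move=> d Id d0.
have := count_white Om_polygon Om_slopes Om_degree Om_ab w1 Ow (ac2 d Id d0).
by rewrite N0 -sBW N1 /=; clear; move: (size _) (size _); lia.
Qed.
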